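(* Let $(\mathbf{x}_e,\mathbf{x}_p)$ be a musical orbit with image trajectory $\mathbf{X}_\mu$ and time shift $\tau$, and let $\mathcal{B}=\{\mathbf{x}\in\mathbb{R}^3:|\mathbf{x}|<r_\pi\}$ be a ball containing the protonic trajectory $\mathbf{x}_p(\mathbb{R})$ and the image trajectory $\mathbf{X}_\mu(\mathbb{R})$. Then the natural functions $\Delta_s^{\pm}(t,\mathbf{x})=\phi_p^{\pm}(t,\mathbf{x})-\phi_\mu^{\pm}(t+\tau,\mathbf{x})$ belong to $\mathbb{W}^{2,2}(\mathcal{B})$; that is, for each $t$ the function $\mathbf{x}\mapsto\Delta_s^\pm(t,\mathbf{x})$ is in the Sobolev space of functions on $\mathcal{B}$ with distributional derivatives up to order two in $L^2(\mathcal{B})$.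
   Context: Units: speed of light $c=1$; electron (index $e$ or $1$) has charge $e_1=-1$ and mass $m_1=1$; proton (index $p$ or $2$) has charge $e_2=1$ and mass $m_2=M_p>0$. Trajectories and delays. A bounded trajectory is a continuous $\mathbf{x}_j:\mathbb{R}\to\mathbb{R}^3$ with bounded image; it is sub-luminal if $|\dot{\mathbf{x}}_j(t)|<1$ for all $t$ except possibly a countable set. For such a trajectory the delay functions $\phi_j^{\pm}(t,\mathbf{x})\ge0$ are the unique solutions of $\phi_j^{\pm}=|\mathbf{x}-\mathbf{x}_j(t\pm\phi_j^{\pm})|$ on $\mathbb{R}\times\mathbb{R}^3$; put $t_j^{\pm}(t,\mathbf{x})=t\pm\phi_j^{\pm}(t,\mathbf{x})$. Quantities $\mathbf{x}_j^\pm,\mathbf{v}_j^\pm,\mathbf{a}_j^\pm$ are position, velocity, acceleration of $j$ at time $t_j^\pm(t,\mathbf{x})$, and $\hat{\mathbf{n}}_j^{\pm}(t,\mathbf{x})=(\mathbf{x}-\mathbf{x}_j^\pm)/|\mathbf{x}-\mathbf{x}_j^\pm|$. Where defined, $\vec\nabla\phi_j^\pm=\hat{\mathbf{n}}_j^\pm/(1\pm\hat{\mathbf{n}}_j^\pm\cdot\mathbf{v}_j^\pm)$. Orbits. An orbit is a pair of bounded trajectories $(\mathbf{x}_e,\mathbf{x}_p)$, each possessing two derivatives defined piecewise, such that: (a) on each $C^2$ segment the Wheeler–Feynman equations hold: for $i\in\{1,2\}$, $j=3-i$, $\frac{m_i\mathbf{a}_i(t)}{\sqrt{1-\mathbf{v}_i^2}}=e_i[\mathbf{E}_j-(\mathbf{v}_i\cdot\mathbf{E}_j)\mathbf{v}_i+\mathbf{v}_i\times\mathbf{B}_j]$,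 where $\mathbf{E}_j=\frac12(\mathbf{E}_j^++\mathbf{E}_j^-)$, $\mathbf{B}_j=\frac12(\mathbf{B}_j^++\mathbf{B}_j^-)$ are evaluated at $(t,\mathbf{x}_i(t))$, with $\mathbf{E}_j^\pm(t,\mathbf{x})=e_j(1-|\mathbf{v}_j^\pm|^2)\frac{|\vec\nabla\phi_j^\pm|^3}{(\phi_j^\pm)^2}(\hat{\mathbf{n}}_j^\pm\pm\mathbf{v}_j^\pm)+e_j\frac{\hat{\mathbf{n}}_j^\pm\times(\hat{\mathbf{n}}_j^\pm\times\mathbf{J}_j^\pm)}{\phi_j^\pm}$, $\mathbf{B}_j^\pm=\mp\hat{\mathbf{n}}_j^\pm\times\mathbf{E}_j^\pm$, $\mathbf{J}_j^\pm=|\vec\nabla\phi_j^\pm|^3(\mathbf{a}_j^\pm\mp\hat{\mathbf{n}}_j^\pm\times(\mathbf{v}_j^\pm\times\mathbf{a}_j^\pm))$; (b) at velocity discontinuities the left and right values agree (Weierstrass–Erdmann conditions) for $\mathbf{P}_i=\frac{m_i\mathbf{v}_i}{\sqrt{1-\mathbf{v}_i^2}}-\Big(\frac{\mathbf{v}_j^-}{2r_{ji}^-D_{ji}^-}+\frac{\mathbf{v}_j^+}{2r_{ji}^+D_{ji}^+}\Big)$ and $E_i=\frac{m_i}{\sqrt{1-\mathbf{v}_i^2}}-\Big(\frac{1}{2r_{ji}^-D_{ji}^-}+\frac{1}{2r_{ji}^+D_{ji}^+}\Big)$, where $r_{ji}^\pm=\phi_j^\pm(t,\mathbf{x}_i(t))$,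 $D_{ji}^\pm=1/|\vec\nabla\phi_j^\pm(t,\mathbf{x}_i(t))|$. A type-(ii) orbit is a periodic orbit whose velocities have modulus less than $1$ wherever defined and are discontinuous on a countable set of points (breaking points; the corresponding times are breaking times). A musical orbit is a type-(ii) orbit satisfying (P1), (P2), (P3): (P1) Both trajectories are periodic and have the same integer number $2N$ of breaking points inside each period $T$. (P2) There are $\mu\in\mathbb{R}$, a bounded $C^2$ function $\mathtt{G}:\mathbb{R}\to\mathbb{R}^3$ and $\tau\in\{0,T/2\}$ such that the image trajectory $\mathbf{X}_\mu(t)=-\mathtt{G}(t)+\mu\,\mathbf{x}_e(t)$ is sub-luminal ($|\dot{\mathbf{X}}_\mu|<1$ except possibly on a countable set), the map $t^*\mapsto t^*+\tau$ is a one-to-one correspondence from the protonic breaking times onto the breaking times (velocity discontinuities) of $\mathbf{X}_\mu$ (these being also the times of the electronic breaking points), and $\mathbf{x}_p(t^* )=\mathbf{X}_\mu(t^*+\tau)$ for every protonic breaking time $t^*$. The image trajectory is $T$-periodic. (P3) At each protonic breaking time $t^*$, the one-sided velocities (left $\ell$, right $r$) satisfy $\mathbf{v}_p^{\ell}(t^* )=\mathbf{V}_\mu^{\ell}(t^*+\tau)$ and $\mathbf{v}_p^{r}(t^* )=\mathbf{V}_\mu^{r}(t^*+\tau)$, where $\mathbf{V}_\mu=\dot{\mathbf{X}}_\mu=-\dot{\mathtt{G}}+\mu\mathbf{v}_e$. The synchronization functions $\phi_\mu^\pm$ are the delay functions of $\mathbf{X}_\mu$: $\phi_\mu^\pm(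t,\mathbf{x})=|\mathbf{x}-\mathbf{X}_\mu(t\pm\phi_\mu^\pm)|$.
   Formalization: Sub-luminal is taken to mean that the velocity exists off a countable set and has modulus less than 1 wherever it exists (one-sided velocities of the orbit included); if the image trajectory has speed 1 at an isolated time, second derivatives of its delay leave L². *)

(* Defs.v *)
From HB Require Import structures.
From mathcomp Require Import all_boot all_order all_algebra.
From mathcomp Require Import all_classical all_reals all_analysis.

Set Implicit Arguments.
Unset Strict Implicit.
Unset Printing Implicit Defensive.

Import Order.TTheory GRing.Theory Num.Theory.
Import numFieldNormedType.Exports.

Local Open Scope classical_set_scope.
Local Open Scope ring_scope.

(** * Euclidean space *)

(* The library norm on ['rV[R]_3] is the sup norm; it is used only through
   the topology (and hence the derivatives) that it induces. *)

Definition dot {R : realType} (u v : 'rV[R]_3) : R :=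
  \sum_(i < 3) u 0 i * v 0 i.

Definition enorm {R : realType} (u : 'rV[R]_3) : R := Num.sqrt (dot u u).

(* Indices are added modulo 3. *)
Definition cross {R : realType} (u v : 'rV[R]_3) : 'rV[R]_3 :=
  \row_(i < 3) (u 0 (i + 1) * v 0 (i + 2) - u 0 (i + 2) * v 0 (i + 1)).

Definition eball {R : realType} (r : R) : set 'rV[R]_3 :=
  [set y | enorm y < r].

(** * The Sobolev spaces W^{k,2} *)

(* Lebesgue measure lives on [R * R * R], the library having no measurable
   structure on row vectors; [rv3] identifies the two models of R^3. *)
Definition rv3 {R : realType} (p : R * R * R) : 'rV[R]_3 :=
  \row_(i < 3) [:: p.1.1; p.1.2; p.2]`_i.

Definition leb3 {R : realType} :
    {measure set (measurableTypeR R * measurableTypeR R * measurableTypeR R)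
       -> \bar R} :=
  ((@lebesgue_measure R \x @lebesgue_measure R) \x @lebesgue_measure R)%E.

Definition in_L2 {R : realType} (B : set 'rV[R]_3) (f : 'rV[R]_3 -> R) : Prop :=
  (f \_ B) \o rv3 \in Lfun leb3 2%:E.

(* [partials [:: i1; ...; im] f] is d_i1 ... d_im f. *)
Definition partials {R : realType} (s : seq 'I_3) (f : 'rV[R]_3 -> R) :
    'rV[R]_3 -> R :=
  foldr (fun i g y => 'D_(delta_mx 0 i) g y) f s.

Definition test_function {R : realType} (B : set 'rV[R]_3)
    (psi : 'rV[R]_3 -> R) : Prop :=
  [/\ forall (s : seq 'I_3) y, differentiable (partials s psi) y,
      compact (closure [set y | psi y != 0]) &
      closure [set y | psi y != 0] `<=` B].

Definition weak_derivative {R : realType} (B : set 'rV[R]_3) (s : seq 'I_3)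
    (f g : 'rV[R]_3 -> R) : Prop :=
  forall psi, test_function B psi ->
    \int[leb3]_(p in rv3 @^-1` B) (f (rv3 p) * partials s psi (rv3 p)) =
    (-1) ^+ size s *
      \int[leb3]_(p in rv3 @^-1` B) (g (rv3 p) * psi (rv3 p)).

Definition sobolev2 {R : realType} (k : nat) (B : set 'rV[R]_3)
    (f : 'rV[R]_3 -> R) : Prop :=
  in_L2 B f /\
  forall s : seq 'I_3, (size s <= k)%N ->
    exists2 g, in_L2 B g & weak_derivative B s f g.

(** * Trajectories and delay functions *)

Definition bounded_trajectory {R : realType} (x : R -> 'rV[R]_3) : Prop :=
  continuous x /\ bounded_set (range x).

(* The countable exceptional set consists of the times without velocity:
   wherever the velocity exists, its modulus is less than 1. *)
Definition sub_luminal {R : realType} (x : R -> 'rV[R]_3) : Prop :=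
  countable [set t | ~ derivable x t 1] /\
  forall t, derivable x t 1 -> enorm (derive1 x t) < 1.

(* The superscripts + and - are [true] and [false]. *)
Definition pm {R : realType} (b : bool) : R := if b then 1 else -1.

(* For a bounded sub-luminal trajectory the set is a singleton. *)
Definition delay {R : realType} (b : bool) (x : R -> 'rV[R]_3)
    (t : R) (y : 'rV[R]_3) : R :=
  xget 0 [set phi | 0 <= phi /\ phi = enorm (y - x (t + pm b * phi))].

Definition dtime {R : realType} (b : bool) (x : R -> 'rV[R]_3)
    (t : R) (y : 'rV[R]_3) : R :=
  t + pm b * delay b x t y.

Definition nhat {R : realType} (b : bool) (x : R -> 'rV[R]_3)
    (t : R) (y : 'rV[R]_3) : 'rV[R]_3 :=
  let d := y - x (dtime b x t y) in (enorm d)^-1 *: d.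

Definition grad_delay {R : realType} (b : bool) (x : R -> 'rV[R]_3)
    (t : R) (y : 'rV[R]_3) : 'rV[R]_3 :=
  let n := nhat b x t y in
  let v := derive1 x (dtime b x t y) in
  (1 + pm b * dot n v)^-1 *: n.

(** * Piecewise C^2 trajectories *)

Definition C2_at {R : realType} (x : R -> 'rV[R]_3) (t : R) : Prop :=
  \forall s \near t,
    [/\ derivable x s 1, derivable (derive1 x) s 1 &
        {for s, continuous (derive1 (derive1 x))}].

Definition piecewise_C2 {R : realType} (x : R -> 'rV[R]_3) : Prop :=
  (forall a b : R, finite_set ([set t | ~ C2_at x t] `&` `[a, b])) /\
  forall t : R,
    [/\ cvg (derive1 x s @[s --> t^'-]), cvg (derive1 x s @[s --> t^'+]),
        cvg (derive1 (derive1 x) s @[s --> t^'-]) &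
        cvg (derive1 (derive1 x) s @[s --> t^'+])].

Definition lvel {R : realType} (x : R -> 'rV[R]_3) (t : R) : 'rV[R]_3 :=
  lim (derive1 x s @[s --> t^'-]).

Definition rvel {R : realType} (x : R -> 'rV[R]_3) (t : R) : 'rV[R]_3 :=
  lim (derive1 x s @[s --> t^'+]).

Definition breaking {R : realType} (x : R -> 'rV[R]_3) : set R :=
  [set t | lvel x t <> rvel x t].

(** * Wheeler-Feynman equations *)

Definition Jvec {R : realType} (b : bool) (x : R -> 'rV[R]_3)
    (t : R) (y : 'rV[R]_3) : 'rV[R]_3 :=
  let n := nhat b x t y in
  let v := derive1 x (dtime b x t y) in
  let a := derive1 (derive1 x) (dtime b x t y) in
  enorm (grad_delay b x t y) ^+ 3 *: (a - pm b *: cross n (cross v a)).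

(* Half-field of a source with charge [e] and trajectory [x]. *)
Definition Efield {R : realType} (b : bool) (e : R) (x : R -> 'rV[R]_3)
    (t : R) (y : 'rV[R]_3) : 'rV[R]_3 :=
  let phi := delay b x t y in
  let n := nhat b x t y in
  let v := derive1 x (dtime b x t y) in
  (e * (1 - enorm v ^+ 2) * (enorm (grad_delay b x t y) ^+ 3 / phi ^+ 2))
    *: (n + pm b *: v)
  + (e / phi) *: cross n (cross n (Jvec b x t y)).

Definition Bfield {R : realType} (b : bool) (e : R) (x : R -> 'rV[R]_3)
    (t : R) (y : 'rV[R]_3) : 'rV[R]_3 :=
  - pm b *: cross (nhat b x t y) (Efield b e x t y).

Definition Emean {R : realType} (e : R) (x : R -> 'rV[R]_3)
    (t : R) (y : 'rV[R]_3) : 'rV[R]_3 :=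
  2^-1 *: (Efield true e x t y + Efield false e x t y).

Definition Bmean {R : realType} (e : R) (x : R -> 'rV[R]_3)
    (t : R) (y : 'rV[R]_3) : 'rV[R]_3 :=
  2^-1 *: (Bfield true e x t y + Bfield false e x t y).

(* The equation of motion of particle [i] is required wherever the
   accelerations in it exist; there the denominators must not vanish. *)
Definition wheeler_feynman {R : realType} (mi ei ej : R)
    (xi xj : R -> 'rV[R]_3) : Prop :=
  forall t, C2_at xi t ->
    (forall b, C2_at xj (dtime b xj t (xi t))) ->
    let v := derive1 xi t in
    let E := Emean ej xj t (xi t) in
    let B := Bmean ej xj t (xi t) in
    (forall b, 0 < delay b xj t (xi t)) /\
    (mi / Num.sqrt (1 - enorm v ^+ 2)) *: derive1 (derive1 xi) t =
      ei *: (E - dot v E *: v + cross v B).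

(** * Weierstrass-Erdmann conditions *)

(* [rD] is r_ji D_ji. *)
Definition rD {R : realType} (b : bool) (xi xj : R -> 'rV[R]_3) (t : R) : R :=
  delay b xj t (xi t) * (1 / enorm (grad_delay b xj t (xi t))).

Definition momentum {R : realType} (mi : R) (xi xj : R -> 'rV[R]_3)
    (t : R) : 'rV[R]_3 :=
  let v := derive1 xi t in
  let vj b := derive1 xj (dtime b xj t (xi t)) in
  (mi / Num.sqrt (1 - enorm v ^+ 2)) *: v
  - ((2 * rD false xi xj t)^-1 *: vj false
     + (2 * rD true xi xj t)^-1 *: vj true).

Definition energy {R : realType} (mi : R) (xi xj : R -> 'rV[R]_3)
    (t : R) : R :=
  mi / Num.sqrt (1 - enorm (derive1 xi t) ^+ 2)
  - ((2 * rD false xi xj t)^-1 + (2 * rD true xi xj t)^-1).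

Definition weierstrass_erdmann {R : realType} (mi : R)
    (xi xj : R -> 'rV[R]_3) : Prop :=
  forall t, breaking xi t ->
    [/\ forall b, 0 < delay b xj t (xi t),
        exists P : 'rV[R]_3,
          momentum mi xi xj s @[s --> t^'-] --> P /\
          momentum mi xi xj s @[s --> t^'+] --> P &
        exists E : R,
          energy mi xi xj s @[s --> t^'-] --> E /\
          energy mi xi xj s @[s --> t^'+] --> E].

(** * Orbits *)

(* The electron has mass 1 and charge -1, the proton mass [Mp] and charge 1. *)
Record orbit {R : realType} (Mp : R) (xe xp : R -> 'rV[R]_3) : Prop := {
  orbit_bounded_e : bounded_trajectory xe;
  orbit_bounded_p : bounded_trajectory xp;
  orbit_piecewise_e : piecewise_C2 xe;
  orbit_piecewise_p : piecewise_C2 xp;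
  orbit_wf_e : wheeler_feynman 1 (-1) 1 xe xp;
  orbit_wf_p : wheeler_feynman Mp 1 (-1) xp xe;
  orbit_we_e : weierstrass_erdmann 1 xe xp;
  orbit_we_p : weierstrass_erdmann Mp xp xe }.

Definition periodic {R : realType} (T : R) (x : R -> 'rV[R]_3) : Prop :=
  forall t, x (t + T) = x t.

(* One-sided velocities count as velocities: they enter the momenta and
   energies at the breaking times. *)
Definition velocities_lt1 {R : realType} (x : R -> 'rV[R]_3) : Prop :=
  forall t, [/\ derivable x t 1 -> enorm (derive1 x t) < 1,
                enorm (lvel x t) < 1 & enorm (rvel x t) < 1].

Record type_ii_orbit {R : realType} (Mp T : R) (xe xp : R -> 'rV[R]_3) :
    Prop := {
  type_ii_is_orbit : orbit Mp xe xp;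
  type_ii_period_gt0 : 0 < T;
  type_ii_periodic_e : periodic T xe;
  type_ii_periodic_p : periodic T xp;
  type_ii_velocities_e : velocities_lt1 xe;
  type_ii_velocities_p : velocities_lt1 xp;
  type_ii_countable_e : countable (breaking xe);
  type_ii_countable_p : countable (breaking xp) }.

Definition image_trajectory {R : realType} (mu : R) (G xe : R -> 'rV[R]_3) :
    R -> 'rV[R]_3 :=
  fun t => - G t + mu *: xe t.

Record musical_orbit {R : realType} (Mp T : R) (xe xp : R -> 'rV[R]_3)
    (mu : R) (G : R -> 'rV[R]_3) (tau : R) : Prop := {
  musical_type_ii : type_ii_orbit Mp T xe xp;
  musical_breaking_number : exists N : nat, forall t0 : R,
    (breaking xe `&` [set t | t0 <= t < t0 + T] #= `I_(2 * N)%N)%card /\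
    (breaking xp `&` [set t | t0 <= t < t0 + T] #= `I_(2 * N)%N)%card;
  musical_G_bounded : bounded_set (range G);
  musical_G_C2 : forall t, C2_at G t;
  musical_tau : tau = 0 \/ tau = T / 2;
  musical_sub_luminal : sub_luminal (image_trajectory mu G xe);
  musical_bijection :
    set_bij (breaking xp) (breaking (image_trajectory mu G xe))
      (fun t => t + tau);
  musical_breaking_e : breaking (image_trajectory mu G xe) = breaking xe;
  musical_position : forall t, breaking xp t ->
    xp t = image_trajectory mu G xe (t + tau);
  musical_image_periodic : periodic T (image_trajectory mu G xe);
  musical_lvel : forall t, breaking xp t ->
    lvel xp t = lvel (image_trajectory mu G xe) (t + tau);
  musical_rvel : forall t, breaking xp t ->
    rvel xp t = rvel (image_trajectory mu G xe) (t + tau) }.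

(* The function Delta_s. *)
Definition natural_function {R : realType} (b : bool)
    (xp X : R -> 'rV[R]_3) (tau t : R) (y : 'rV[R]_3) : R :=
  delay b xp t y - delay b X (t + tau) y.

(* Main.v *)
Require Import Defs.
From mathcomp Require Import all_boot all_order all_algebra.
From mathcomp Require Import all_classical all_reals all_analysis.
From mathcomp Require Import measurable_realfun ring lra.

Import Order.TTheory GRing.Theory Num.Theory.
Import numFieldNormedType.Exports.
Local Open Scope classical_set_scope.
Local Open Scope ring_scope.

(* The gradient of the delay [phi_p] of a trajectory [p] is [d / (|d| + d . v)],
   with [d = x - p (phi_p x)] and [v] the velocity at [phi_p x] (the advanced
   and retarded cases differ by a reversal of time).  At a breaking time the
   proton and the image trajectory have the same position and the same one-sided
   velocities, so the two delays agree on the light cone of the breaking point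
   and the jumps of their gradients across it cancel: the difference of the
   gradients is Lipschitz away from the two trajectories at time [t], with a
   local constant of the order of one over the distance to them.  Its difference
   quotients are thus dominated by a function that is square integrable in
   dimension three.  They converge off a null set: the velocities are
   differentiable off a countable set of times, whose light cones (level sets
   of the delay) are null.  Dominated convergence in the discrete integration
   by parts formula then identifies the pointwise limits as weak derivatives. *)

(** * Delay functions *)

(** The estimates need one bound [k < 1] on all speeds, while velocities are only assumed below 1
    time by time; periodicity and the existence of one-sided limits make the bound uniform. Then
    [s - enorm (y - p s)] increases with slope at least [1 - k], and the estimates on delays are
    read off from this slope; the factor [(1 - k)^-1] that recurs everywhere is its inverse. The
    obstacle is that a velocity is Lipschitz only between breaking times, while two nearby points
    may have delays on opposite sides of one. Since both one-sided velocities match, the difference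
    [v \- u] of the two velocities is Lipschitz across the breaking times and zero on them. Near a
    light cone the comparison is therefore made between the two curves at one point, instead of
    between two points on one curve. The right velocity serves as velocity at every time: it exists
    everywhere, it is measurable, and it is the derivative at regular times. *)

Section Euclid.
Context {R : realType}.
Implicit Types u v w : 'rV[R]_3.

Lemma dotE u v : dot u v = u 0 0 * v 0 0 + u 0 1 * v 0 1 + u 0 2 * v 0 2.
Proof.
rewrite /dot !big_ord_recl big_ord0 addr0 addrA.
by congr (_ + u _ _ * v _ _ + u _ _ * v _ _); apply/val_inj.
Qed.

Lemma dotC u v : dot u v = dot v u.
Proof. by rewrite !dotE; ring. Qed.

Lemma dotDl u v w : dot (u + v) w = dot u w + dot v w.
Proof. by rewrite !dotE !mxE; ring. Qed.

Lemma dotNl u v : dot (- u) v = - dot u v.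
Proof. by rewrite !dotE !mxE; ring. Qed.

Lemma dotZl a u v : dot (a *: u) v = a * dot u v.
Proof. by rewrite !dotE !mxE; ring. Qed.

Lemma dotDr u v w : dot w (u + v) = dot w u + dot w v.
Proof. by rewrite dotC dotDl !(dotC w). Qed.

Lemma dotNr u v : dot v (- u) = - dot v u.
Proof. by rewrite dotC dotNl dotC. Qed.

Lemma dotZr a u v : dot v (a *: u) = a * dot v u.
Proof. by rewrite dotC dotZl dotC. Qed.

Lemma dot_ge0 u : 0 <= dot u u.
Proof. by apply: sumr_ge0 => i _; rewrite -expr2 sqr_ge0. Qed.

Lemma enorm_ge0 u : 0 <= enorm u.
Proof. exact: sqrtr_ge0. Qed.

Lemma enorm_sqr u : enorm u ^+ 2 = dot u u.
Proof. by rewrite sqr_sqrtr// dot_ge0. Qed.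

Lemma ler_norm_dot u v : `|dot u v| <= enorm u * enorm v.
Proof.
rewrite -ler_sqr ?nnegrE ?mulr_ge0 ?enorm_ge0// real_normK ?num_real//.
rewrite exprMn !enorm_sqr -subr_ge0.
rewrite (_ : _ - _ = (u 0 0 * v 0 1 - u 0 1 * v 0 0) ^+ 2 +
  (u 0 0 * v 0 2 - u 0 2 * v 0 0) ^+ 2 +
  (u 0 1 * v 0 2 - u 0 2 * v 0 1) ^+ 2); first by rewrite !addr_ge0 ?sqr_ge0.
by rewrite !dotE; ring.
Qed.

Lemma ler_dot u v : dot u v <= enorm u * enorm v.
Proof. exact: le_trans (ler_norm _) (ler_norm_dot _ _). Qed.

Lemma enormZ a u : enorm (a *: u) = `|a| * enorm u.
Proof.
by rewrite /enorm dotZl dotZr mulrA -expr2 sqrtrM ?sqr_ge0// sqrtr_sqr.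
Qed.

Lemma enormN u : enorm (- u) = enorm u.
Proof. by rewrite /enorm dotNl dotNr opprK. Qed.

Lemma enorm0 : enorm (0 : 'rV[R]_3) = 0.
Proof. by rewrite -(scale0r 0) enormZ normr0 mul0r. Qed.

Lemma enormBC u v : enorm (u - v) = enorm (v - u).
Proof. by rewrite -enormN opprB. Qed.

Lemma ler_enormD u v : enorm (u + v) <= enorm u + enorm v.
Proof.
rewrite -ler_sqr ?nnegrE ?addr_ge0 ?enorm_ge0//.
rewrite sqrrD !enorm_sqr dotDl !dotDr (dotC v u) -mulr_natr.
have := ler_dot u v; lra.
Qed.

Lemma ler_enormB u v : enorm (u - v) <= enorm u + enorm v.
Proof. by rewrite (le_trans (ler_enormD _ _))// enormN. Qed.

Lemma ler_dist_enorm u v : `|enorm u - enorm v| <= enorm (u - v).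
Proof.
have := ler_enormD (u - v) v; have := ler_enormD (v - u) u.
by rewrite !subrK (enormBC v u) ler_norml => ? ?; apply/andP; split; lra.
Qed.

Lemma ler_coord_enorm u i : `|u 0 i| <= enorm u.
Proof.
rewrite -ler_sqr ?nnegrE ?enorm_ge0// real_normK ?num_real// enorm_sqr.
by rewrite /dot (bigD1 i)//= -expr2 lerDl sumr_ge0// => j _; rewrite -expr2 sqr_ge0.
Qed.

Lemma enorm_eq0 u : enorm u = 0 -> u = 0.
Proof.
move=> u0; apply/rowP => i; rewrite mxE; apply/eqP; rewrite -normr_le0 -u0.
exact: ler_coord_enorm.
Qed.

End Euclid.

Lemma subBB (V : zmodType) (a b c : V) : (a - b) - (a - c) = c - b.
Proof. by rewrite opprB addrC addrA subrK. Qed.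

Definition lipschitz3 {R : realType} (k : R) (p : R -> 'rV[R]_3) : Prop :=
  forall s s', enorm (p s - p s') <= k * `|s - s'|.

(* [delay b x t] is the [dly] of the curve [s |-> x (t + pm b * s)]. *)
Definition dly {R : realType} (p : R -> 'rV[R]_3) (y : 'rV[R]_3) : R :=
  xget 0 [set phi | 0 <= phi /\ phi = enorm (y - p phi)].

(** The velocity [u] is a separate argument so that a one-sided velocity can stand in at breaking
    times. The vector [d] is not normalised: dividing by [dly p y] recovers the form
    [n / (1 + n . u)], and at delay 0, where [d = 0], the value is 0. *)
Definition dgrad {R : realType} (p u : R -> 'rV[R]_3) (y : 'rV[R]_3) :
    'rV[R]_3 :=
  let d := y - p (dly p y) in (dly p y + dot d (u (dly p y)))^-1 *: d.

Section Delay.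
Context {R : realType} (k : R) (p : R -> 'rV[R]_3).
Hypothesis k0 : 0 <= k.
Hypothesis k1 : k < 1.
Hypothesis plip : lipschitz3 k p.
Implicit Types y z : 'rV[R]_3.

Let c := (1 - k)^-1.

Lemma inv1Bk_ge1 : 1 <= c.
Proof.
have kk0 := k0; have kk1 := k1.
by rewrite /c invf_ge1; lra.
Qed.

Let cP (a b : R) : (1 - k) * a <= b -> a <= c * b.
Proof.
have kk0 := k0; have kk1 := k1.
by rewrite /c ler_pdivlMl; lra.
Qed.

(** The norm changes at rate at most [k], so the residual [s - enorm (y - p s)] has slope at least
    [1 - k]. Its zero is the delay, and its sign tells on which side of the delay a time lies. *)
Lemma dly_lip_mono y s s' : s <= s' ->
  (1 - k) * (s' - s) <=
  (s' - enorm (y - p s')) - (s - enorm (y - p s)).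
Proof.
have kk0 := k0; have kk1 := k1.
move=> ss'; have := ler_dist_enorm (y - p s') (y - p s).
rewrite subBB => /le_trans /(_ (plip s s')).
rewrite ler_norml distrC ger0_norm ?subr_ge0// => /andP[_]; lra.
Qed.

Lemma dlyP y : 0 <= dly p y /\ dly p y = enorm (y - p (dly p y)).
Proof.
have kk0 := k0; have kk1 := k1.
suff [s sP] : exists s, 0 <= s /\ s = enorm (y - p s) by exact: (@xgetI _ 0 [set a | 0 <= a /\ a = enorm (y - p a)] _ sP).
pose f s := s - enorm (y - p s).
have f0E : f 0 = - enorm (y - p 0) by rewrite /f sub0r.
have f0 : f 0 <= 0 by rewrite f0E oppr_le0 enorm_ge0.
(* Starting from [- enorm (y - p 0)] and rising with slope at least [1 - k], [f] has reached 0 by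
   time [S]. *)
pose S := c * enorm (y - p 0).
have c1 := inv1Bk_ge1.
have S0 : 0 <= S by rewrite mulr_ge0 ?enorm_ge0//; lra.
have fS : 0 <= f S.
  have := dly_lip_mono y _ _ S0; rewrite -/(f S) -/(f 0) subr0 {1}/S mulrA mulfV; last by rewrite subr_eq0 gt_eqF.
  rewrite mul1r f0E; lra.
have flip s s' : `|f s - f s'| <= 2 * `|s - s'|.
  have := ler_dist_enorm (y - p s') (y - p s).
  rewrite subBB => /le_trans /(_ (plip s s')) h.
  have -> : f s - f s' = (s - s') + (enorm (y - p s') - enorm (y - p s)).
    by rewrite /f; ring.
  rewrite (le_trans (ler_normD _ _))//.
  have : k * `|s - s'| <= 1 * `|s - s'| by rewrite ler_wpM2r// ltW.
  lra.
have cf : continuous f.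
  move=> s; apply/cvgrPdist_lt => e e0; near=> s'.
  rewrite (le_lt_trans (flip _ _))// -ltr_pdivlMl//; near: s'.
  by apply: (@cvgr_dist_lt _ _ _ _ _ id) => //; rewrite mulr_gt0.
have [|s + fs] := @IVT R f 0 S 0 S0 (continuous_subspaceT cf).
  by rewrite min_l ?(le_trans f0)// max_r ?(le_trans f0)// f0 fS.
rewrite in_itv/= => /andP[s0 _]; exists s; split => //.
by apply/eqP; rewrite -subr_eq0; apply/eqP.
Unshelve. all: by end_near. Qed.

Lemma dly_ge0 y : 0 <= dly p y. Proof. by have [] := dlyP y. Qed.

Lemma dlyE y : enorm (y - p (dly p y)) = dly p y.
Proof. by have [_ <-] := dlyP y. Qed.

(** The residual at [s] is at least [1 - k] times the distance from [s] to its zero. With the delay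
    at another point for [s], this becomes the Lipschitz bound on delays. *)
Lemma dly_err y s : `|s - dly p y| <= c * `|s - enorm (y - p s)|.
Proof.
have kk0 := k0; have kk1 := k1.
have e := dlyE y; have := ler_norm (s - enorm (y - p s)).
have := ler_norm (- (s - enorm (y - p s))); rewrite normrN => h1 h2.
apply: cP; have [sd|ds] := leP s (dly p y).
  have := dly_lip_mono y _ _ sd; rewrite e subrr.
  rewrite distrC ger0_norm ?subr_ge0//; lra.
have := dly_lip_mono y _ _ (ltW ds); rewrite e subrr.
rewrite gtr0_norm ?subr_gt0//; lra.
Qed.

(** The sign of the increasing residual at [s] decides the comparison, and it involves the curve
    only through its position [p s]. *)
Lemma dly_leE y s : (dly p y <= s) = (enorm (y - p s) <= s).
Proof.
have kk0 := k0; have kk1 := k1.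
have e := dlyE y; apply/idP/idP => [ds|].
  have := dly_lip_mono y _ _ ds; rewrite e.
  have : 0 <= (1 - k) * (s - dly p y) by rewrite mulr_ge0 ?subr_ge0// ltW.
  lra.
move=> h; rewrite leNgt; apply/negP => sd.
have := dly_lip_mono y _ _ (ltW sd); rewrite e.
have : 0 < (1 - k) * (dly p y - s) by rewrite mulr_gt0 ?subr_gt0.
lra.
Qed.

Lemma dly_geE y s : (s <= dly p y) = (s <= enorm (y - p s)).
Proof.
have kk0 := k0; have kk1 := k1.
have e := dlyE y; apply/idP/idP => [sd|].
  have := dly_lip_mono y _ _ sd; rewrite e.
  have : 0 <= (1 - k) * (dly p y - s) by rewrite mulr_ge0 ?subr_ge0// ltW.
  lra.
move=> h; rewrite leNgt; apply/negP => sd.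
have := dly_lip_mono y _ _ (ltW sd); rewrite e.
have : 0 < (1 - k) * (s - dly p y) by rewrite mulr_gt0 ?subr_gt0.
lra.
Qed.

Lemma dly_lip y z : `|dly p y - dly p z| <= c * enorm (y - z).
Proof.
have kk0 := k0; have kk1 := k1.
rewrite (le_trans (dly_err z _))// ler_wpM2l//; first by have := inv1Bk_ge1; lra.
rewrite -{1}dlyE (le_trans (ler_dist_enorm _ _))//.
by rewrite opprB addrA subrK.
Qed.

(** Between the times 0 and [dly p y] the curve moves by at most [k * dly p y], and [1 + k <= 2].
    This trades the singular factor [(dly p y)^-1] for the inverse distance to the fixed point
    [p 0]. *)
Lemma dly_ge_dist y : enorm (y - p 0) <= 2 * dly p y.
Proof.
have kk0 := k0; have kk1 := k1.
have -> : y - p 0 = (y - p (dly p y)) + (p (dly p y) - p 0).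
  by rewrite addrA subrK.
rewrite (le_trans (ler_enormD _ _))// dlyE.
have := plip (dly p y) 0; rewrite subr0 ger0_norm ?dly_ge0// => h.
have : k * dly p y <= 1 * dly p y by rewrite ler_wpM2r ?dly_ge0// ltW.
lra.
Qed.

End Delay.

Lemma denom_ge {R : realType} (k : R) (d u : 'rV[R]_3) : enorm u <= k ->
  (1 - k) * enorm d <= enorm d + dot d u.
Proof.
move=> uk; have := ler_norm_dot d u; rewrite ler_norml => /andP[h _].
have : enorm d * enorm u <= enorm d * k by rewrite ler_wpM2l ?enorm_ge0.
lra.
Qed.

Lemma enorm_normalized_le {R : realType} (k : R) (d u : 'rV[R]_3) : k < 1 ->
  enorm u <= k -> enorm ((enorm d + dot d u)^-1 *: d) <= (1 - k)^-1.
Proof.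
move=> k1 uk; have h := denom_ge k d u uk.
have := enorm_ge0 d; rewrite le_eqVlt => /orP[/eqP d0|d0].
  rewrite (enorm_eq0 d)// scaler0 enorm0 invr_ge0; lra.
have k1' : 0 < 1 - k by lra.
have N0 : 0 < enorm d + dot d u by rewrite (lt_le_trans _ h)// mulr_gt0.
by rewrite enormZ gtr0_norm ?invr_gt0// mulrC ler_pdivrMr// mulrC ler_pdivlMr// mulrC.
Qed.

(** Only [d] is assumed nonzero and the bound is singular in [enorm d] alone, so the second point
    may lie arbitrarily close to its trajectory, or on it. *)
Lemma enorm_normalized_diff {R : realType} (k : R) (d d' u u' : 'rV[R]_3) :
  0 <= k -> k < 1 -> enorm u <= k -> enorm u' <= k -> 0 < enorm d ->
  enorm ((enorm d + dot d u)^-1 *: d - (enorm d' + dot d' u')^-1 *: d') <=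
  (1 - k)^-1 ^+ 2 * (3 * enorm (d - d') / enorm d + enorm (u - u')).
Proof.
move=> k0 k1 uk u'k d0; set c := (1 - k)^-1.
have k1' : 0 < 1 - k by lra.
have c1 : 1 <= c by rewrite /c invf_ge1; lra.
have c2 : c <= c ^+ 2 by rewrite expr2 ler_peMr//; lra.
have h := denom_ge k d u uk; have h' := denom_ge k d' u' u'k.
have := enorm_normalized_le k d u k1 uk; have := enorm_normalized_le k d' u' k1 u'k.
rewrite -/c.
set N := enorm d + dot d u in h *; set N' := enorm d' + dot d' u' in h' *.
have N0 : 0 < N by rewrite (lt_le_trans _ h)// mulr_gt0.
have iN : N^-1 <= c / enorm d.
  by rewrite ler_pdivlMr// mulrC ler_pdivrMr// /c mulrC ler_pdivlMr// mulrC.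
move=> b' b; have := enorm_ge0 d'; rewrite le_eqVlt => /orP[/eqP d'0|d'0].
  (* With [d' = 0] the quotient [enorm (d - d') / enorm d] is 1, and the bound [c] on the first
     vector is enough. *)
  have d'E : d' = 0 by exact: enorm_eq0.
  rewrite d'E scaler0 !subr0 -mulrA mulfV ?gt_eqF// (le_trans b)//.
  have := enorm_ge0 (u - u'); have : 0 <= c ^+ 2 by rewrite sqr_ge0.
  move=> ? ?; have : 0 <= c ^+ 2 * enorm (u - u') by rewrite mulr_ge0.
  lra.
have N'0 : 0 < N' by rewrite (lt_le_trans _ h')// mulr_gt0.
(* The error of the denominator multiplies the normalised vector [N'^-1 *: d'], of norm at most [c],
   so that no inverse of [enorm d'] appears. In the final factor 3, the first term accounts for 1
   and the denominator for 2. *)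
have -> : N^-1 *: d - N'^-1 *: d' =
    N^-1 *: (d - d') + (N^-1 * (N' - N)) *: (N'^-1 *: d').
  rewrite scalerA scalerBr -addrA; congr (_ + _).
  rewrite -!scaleNr -scalerDl; congr (_ *: _).
  by field; rewrite !gt_eqF.
have dN : `|N' - N| <= 2 * enorm (d - d') + enorm d * enorm (u - u').
  have -> : N' - N = (enorm d' - enorm d) + (dot (d' - d) u' + dot d (u' - u)).
    by rewrite /N /N' !dotDl !dotDr !dotNl !dotNr; ring.
  have := ler_dist_enorm d' d; have := ler_norm_dot (d' - d) u'.
  have := ler_norm_dot d (u' - u).
  have : enorm (d' - d) * enorm u' <= enorm (d' - d) * 1.
    by rewrite ler_wpM2l ?enorm_ge0// (le_trans u'k)// ltW.
  rewrite (enormBC u') (enormBC d') !ler_norml.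
  by move=> ? /andP[? ?] /andP[? ?] /andP[? ?]; apply/andP; split; lra.
rewrite (le_trans (ler_enormD _ _))// !(enormZ (N^-1)) enormZ normrM.
rewrite gtr0_norm ?invr_gt0//.
have e0 := enorm_ge0 (d - d').
have h1 : N^-1 * enorm (d - d') <= c / enorm d * enorm (d - d') by rewrite ler_wpM2r.
have h2 : N^-1 * `|N' - N| * enorm (N'^-1 *: d') <=
   c / enorm d * (2 * enorm (d - d') + enorm d * enorm (u - u')) * c.
  rewrite ler_pM ?enorm_ge0 ?mulr_ge0 ?invr_ge0// ?(ltW N0)//.
  by rewrite ler_pM// ?invr_ge0 ?ltW.
rewrite (le_trans (lerD h1 h2))//.
have -> : c / enorm d * (2 * enorm (d - d') + enorm d * enorm (u - u')) * c =
  c ^+ 2 * (2 * (enorm (d - d') / enorm d) + enorm (u - u')).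
  by field; rewrite gt_eqF.
have : c * (enorm (d - d') / enorm d) <= c ^+ 2 * (enorm (d - d') / enorm d).
  by rewrite ler_wpM2r// divr_ge0// ltW.
lra.
Qed.

(** * Gradients of the delays of two curves that agree to first order on a set of times *)

Section Matching.
Context {R : realType} (k L : R) (p q u v : R -> 'rV[R]_3) (Z : set R).
Hypothesis k0 : 0 <= k.
Hypothesis k1 : k < 1.
Hypothesis L0 : 0 <= L.
Hypothesis plip : lipschitz3 k p.
Hypothesis qlip : lipschitz3 k q.
Hypothesis uk : forall s, enorm (u s) <= k.
Hypothesis vk : forall s, enorm (v s) <= k.
Hypothesis ulip : forall s s', s <= s' -> (forall z, Z z -> ~ s <= z <= s') ->
  enorm (u s - u s') <= L * `|s - s'|.
Hypothesis wlip : lipschitz3 L (v \- u).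
Hypothesis Zpos : forall s, Z s -> p s = q s.
Hypothesis Zvel : forall s, Z s -> u s = v s.
Implicit Types y : 'rV[R]_3.

Let c := (1 - k)^-1.
Let c1 : 1 <= c. Proof. exact: inv1Bk_ge1. Qed.

Definition between (s s' z : R) := (s <= z <= s') \/ (s' <= z <= s).

Lemma between_dist s s' z : between s s' z ->
  `|s - z| <= `|s - s'| /\ `|s' - z| <= `|s - s'|.
Proof.
move=> [] /andP[a b].
  have -> : `|s - s'| = s' - s by rewrite distrC ger0_norm//; lra.
  by split; rewrite ler_norml; apply/andP; split; lra.
have -> : `|s - s'| = s - s' by rewrite ger0_norm//; lra.
by split; rewrite ler_norml; apply/andP; split; lra.
Qed.

Lemma ulip_between s s' : (forall z, Z z -> ~ between s s' z) ->
  enorm (u s - u s') <= L * `|s - s'|.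
Proof.
move=> h; have [ss'|/ltW ss'] := leP s s'.
  by apply: ulip => // z Zz zs; apply: (h z Zz); left.
by rewrite enormBC distrC; apply: ulip => // z Zz zs; apply: (h z Zz); right.
Qed.

(** Writing [v] as [(v - u) + u] costs one constant [L] for each part. *)
Lemma vlip_between s s' : (forall z, Z z -> ~ between s s' z) ->
  enorm (v s - v s') <= 2 * L * `|s - s'|.
Proof.
move=> /ulip_between h; have := wlip s s' => /=.
have -> : v s - v s' = (v s - u s - (v s' - u s')) + (u s - u s').
  by apply/rowP => i; rewrite !mxE; ring.
have := ler_enormD (v s - u s - (v s' - u s')) (u s - u s').
lra.
Qed.

Lemma dgradE (f w : R -> 'rV[R]_3) y : lipschitz3 k f ->
  dgrad f w y = (enorm (y - f (dly f y)) + dot (y - f (dly f y)) (w (dly f y)))^-1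
     *: (y - f (dly f y)).
Proof. by move=> fl; rewrite /dgrad (dlyE k). Qed.

Lemma dgrad_bound (f w : R -> 'rV[R]_3) y : lipschitz3 k f ->
  (forall s, enorm (w s) <= k) -> enorm (dgrad f w y) <= c.
Proof. by move=> fl wk; rewrite dgradE//; exact: enorm_normalized_le. Qed.

(** The delays differ by at most [c * enorm (y - z)], hence the vectors [d] by at most twice that
    and the velocities by at most [M] times it; 6 is the 3 of [enorm_normalized_diff] times this
    2. *)
Lemma dgrad_same (f w : R -> 'rV[R]_3) (M : R) y z : lipschitz3 k f -> 0 <= M ->
  (forall s, enorm (w s) <= k) ->
  enorm (w (dly f y) - w (dly f z)) <= M * `|dly f y - dly f z| ->
  0 < dly f y ->
  enorm (dgrad f w y - dgrad f w z) <=
  c ^+ 3 * enorm (y - z) * (6 / dly f y + M).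
Proof.
move=> fl M0 wk wM fy; rewrite !dgradE//.
have ey := dlyE k f k0 k1 fl y.
have dy0 : 0 < enorm (y - f (dly f y)) by rewrite ey.
rewrite (le_trans (enorm_normalized_diff k _ _ _ _ k0 k1 (wk _) (wk _) dy0))// ey -/c.
have hd := dly_lip k f k0 k1 fl y z; rewrite -/c in hd *.
set D := enorm (y - z) in hd *.
have D0 : 0 <= D by exact: enorm_ge0.
have h1 : enorm (y - f (dly f y) - (z - f (dly f z))) <= 2 * (c * D).
  have -> : y - f (dly f y) - (z - f (dly f z)) =
      (y - z) - (f (dly f y) - f (dly f z)).
    by apply/rowP => i; rewrite !mxE; ring.
  rewrite (le_trans (ler_enormB _ _))//.
  have := fl (dly f y) (dly f z).
  have : k * `|dly f y - dly f z| <= 1 * (c * D) by rewrite ler_pM// ltW.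
  have : 1 * D <= c * D by rewrite ler_wpM2r.
  rewrite -/D; lra.
have h2 : enorm (w (dly f y) - w (dly f z)) <= M * (c * D).
  by rewrite (le_trans wM)// ler_wpM2l.
have -> : c ^+ 3 * D * (6 / dly f y + M) =
  c ^+ 2 * (3 * (2 * (c * D)) / dly f y + M * (c * D)).
  by field; rewrite gt_eqF.
apply: ler_wpM2l; first exact: sqr_ge0.
apply: lerD => //; apply: ler_wpM2r; first by rewrite invr_ge0 ltW.
exact: ler_wpM2l.
Qed.

(** Both comparisons with [z'] see only the common position at [z']. Hence a time of [Z] lies
    between two delays of [p] exactly when it lies between the corresponding delays of [q]. *)
Lemma dly_sides y z' : Z z' -> (dly p y <= z') = (dly q y <= z').
Proof. by move=> /Zpos e; rewrite (dly_leE k)// (dly_leE k q)// e. Qed.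

Lemma dly_sides' y z' : Z z' -> (z' <= dly p y) = (z' <= dly q y).
Proof. by move=> /Zpos e; rewrite (dly_geE k)// (dly_geE k q)// e. Qed.

(** Both delays of [y] are within [c * D] of the time [z'], where the two curves have the same
    position and velocity; each quantity at the two delays therefore differs by a multiple of
    [c * D]. *)
Lemma dgrad_near_break y z' (D : R) : Z z' -> 0 < dly p y -> 0 <= D ->
  `|dly p y - z'| <= c * D -> `|dly q y - z'| <= c * D ->
  enorm (dgrad p u y - dgrad q v y) <= c ^+ 3 * D * (6 / dly p y + 3 * L).
Proof.
move=> Zz' py D0 hp hq; rewrite !dgradE//.
have ey := dlyE k p k0 k1 plip y.
have dy0 : 0 < enorm (y - p (dly p y)) by rewrite ey.
rewrite (le_trans (enorm_normalized_diff k _ _ _ _ k0 k1 (uk _) (vk _) dy0))// ey.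
rewrite subBB -/c.
have h1 : enorm (q (dly q y) - p (dly p y)) <= 2 * (c * D).
  have -> : q (dly q y) - p (dly p y) = (q (dly q y) - q z') - (p (dly p y) - p z').
    by rewrite opprB addrA (Zpos z')// subrK.
  rewrite (le_trans (ler_enormB _ _))//.
  have := plip (dly p y) z'; have := qlip (dly q y) z'.
  have : k * `|dly p y - z'| <= 1 * (c * D) by rewrite ler_pM// ltW.
  have : k * `|dly q y - z'| <= 1 * (c * D) by rewrite ler_pM// ltW.
  lra.
have h2 : enorm (u (dly p y) - v (dly q y)) <= 3 * L * (c * D).
  (* The difference [v - u] vanishes at [z'] and is Lipschitz across it, which contributes 1 to the
     factor 3; what remains is [u] at the two delays of the same point, at most [2 * (c * D)]
     apart. *)
  have -> : u (dly p y) - v (dly q y) = (u (dly p y) - u (dly q y)) -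
     ((v (dly q y) - u (dly q y)) - (v z' - u z')).
    by rewrite (Zvel z')// subrr subr0 opprB addrA subrK.
  rewrite (le_trans (ler_enormB _ _))//.
  have h3 := wlip (dly q y) z'; rewrite /= in h3.
  have h4 : L * `|dly q y - z'| <= L * (c * D) by rewrite ler_wpM2l.
  suff h5 : enorm (u (dly p y) - u (dly q y)) <= L * `|dly p y - dly q y|.
    have : L * `|dly p y - dly q y| <= L * (2 * (c * D)).
      rewrite ler_wpM2l// (_ : _ - _ = (dly p y - z') - (dly q y - z')); last by ring.
      rewrite (le_trans (ler_normB _ _))//; lra.
    lra.
  (* The two delays of [y] are on the same side of every time of [Z], so such a time can lie between
     them only if it equals both. *)
  have [[x [Zx xb]]|nb] := pselect (exists x, Z x /\ between (dly p y) (dly q y) x).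
    have {xb}[e1 e2] : dly p y = x /\ dly q y = x.
      case: xb => /andP[a b].
        move: (a); rewrite dly_sides// => a'; move: (b); rewrite -dly_sides'// => b'.
        by split; apply/eqP; rewrite eq_le ?a ?b ?a' ?b'.
      move: (a); rewrite -dly_sides// => a'; move: (b); rewrite dly_sides'// => b'.
      by split; apply/eqP; rewrite eq_le ?a ?b ?a' ?b'.
    by rewrite e1 e2 !subrr enorm0 normr0 mulr0.
  by apply: ulip_between => x Zx xb; apply: nb; exists x.
have -> : c ^+ 3 * D * (6 / dly p y + 3 * L) =
  c ^+ 2 * (3 * (2 * (c * D)) / dly p y + 3 * L * (c * D)).
  by field; rewrite gt_eqF.
apply: ler_wpM2l; first exact: sqr_ge0.
apply: lerD => //; apply: ler_wpM2r; first by rewrite invr_ge0 ltW.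
exact: ler_wpM2l.
Qed.

Let jump_bound_le (a b : R) : 0 <= a -> 0 <= b ->
  6 * a + 3 * L + (12 * a + 3 * L) <= (22 + 6 * L) * (1 + a + b).
Proof.
move=> a0 b0; have LL0 := L0.
have := mulr_ge0 L0 a0; have := mulr_ge0 L0 b0; lra.
Qed.

(* Across a sphere [dly p = z], with [z] in [Z], the jumps of the two gradients cancel. *)
Lemma dgrad_diff_lip : exists2 C, 0 <= C & forall y z,
  0 < dly p y -> 0 < dly q y ->
  enorm ((dgrad p u y - dgrad q v y) - (dgrad p u z - dgrad q v z)) <=
  C * (1 + (dly p y)^-1 + (dly q y)^-1) * enorm (y - z).
Proof.
have cc1 := c1; have LL0 := L0.
have c3 : c ^+ 2 <= c ^+ 3 by rewrite (exprS c 2) ler_peMl// sqr_ge0.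
have c30 : 0 <= c ^+ 2 by rewrite sqr_ge0.
(* In units of [c ^+ 3 * D], the jump case adds up to at most [18 / dly p y + 6 * L], the case
   without jump to 6 over each delay plus [3 * L]; one coefficient covers both. *)
exists (c ^+ 3 * (22 + 6 * L)) => [|y z py qy].
  by rewrite mulr_ge0//; lra.
set D := enorm (y - z).
have D0 : 0 <= D by exact: enorm_ge0.
have hp := dly_lip k p k0 k1 plip y z; have hq := dly_lip k q k0 k1 qlip y z.
rewrite -/c -/D in hp hq.
have cD : 0 <= c ^+ 3 * D by rewrite mulr_ge0// (le_trans c30).
have ipy : 0 < (dly p y)^-1 by rewrite invr_gt0.
have iqy : 0 < (dly q y)^-1 by rewrite invr_gt0.
(* If a time [x] of [Z] separates the delays at [y] and [z], all four delays are within [c * D] of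
   [x], and the gradient differences at [y] and at [z] are estimated separately. *)
have [[x [Zx xb]]|nb] := pselect (exists x, Z x /\ between (dly p y) (dly p z) x).
  have xb' : between (dly q y) (dly q z) x.
    by case: xb => /andP[a b]; [left|right]; rewrite -dly_sides// -dly_sides'// a b.
  have [p1 p2] := between_dist _ _ _ xb; have [q1 q2] := between_dist _ _ _ xb'.
  have g1 := dgrad_near_break y x D Zx py D0 (le_trans p1 hp) (le_trans q1 hq).
  rewrite (le_trans (ler_enormB _ _))//.
  have h2 : enorm (dgrad p u z - dgrad q v z) <=
      c ^+ 3 * D * (12 / dly p y + 3 * L).
    (* If the delay at [z] is at least half of that at [y], the estimate at [z] holds with 6 doubled
       to 12. Otherwise [dly p y <= 2 * (c * D)], and the crude bound [2 * c] is already small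
       enough; this case includes a [z] of delay 0. *)
    have [yz|zy] := leP (dly p y / 2) (dly p z).
      have pz : 0 < dly p z by lra.
      rewrite (le_trans (dgrad_near_break z x D Zx pz D0 (le_trans p2 hp) (le_trans q2 hq)))//.
      apply: ler_wpM2l; first by apply: mulr_ge0 => //; lra.
      rewrite lerD2r ler_pdivrMr// mulrAC ler_pdivlMr//; lra.
    have b1 := dgrad_bound p u z plip uk; have b2 := dgrad_bound q v z qlip vk.
    rewrite (le_trans (ler_enormB _ _))//.
    have yD : dly p y <= 2 * (c * D).
      by move: hp; rewrite ler_norml => /andP[_]; lra.
    have : 0 <= c ^+ 3 * D * (3 * L) by rewrite (mulr_ge0 cD)// mulr_ge0.
    have : 2 * c <= 2 * c ^+ 2 * (2 * (c * D) / dly p y).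
      have : 1 <= 2 * (c * D) / dly p y by rewrite ler_pdivlMr// mul1r.
      move=> h; rewrite -[leLHS]mulr1; apply: ler_pM => //; first lra.
      by apply: ler_wpM2l => //; rewrite expr2 ler_peMr//; lra.
    have : 0 <= c ^+ 3 * D * (dly p y)^-1 := mulr_ge0 cD (ltW ipy).
    rewrite exprS -/c; lra.
  rewrite -/D.
  rewrite (le_trans (lerD g1 h2))//.
  have -> : c ^+ 3 * (22 + 6 * L) * (1 + (dly p y)^-1 + (dly q y)^-1) * D =
    c ^+ 3 * D * ((22 + 6 * L) * (1 + (dly p y)^-1 + (dly q y)^-1)) by ring.
  by rewrite -mulrDr; apply: ler_wpM2l => //; exact: jump_bound_le (ltW ipy) (ltW iqy).
have nbq x : Z x -> ~ between (dly q y) (dly q z) x.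
  move=> Zx xb; apply: nb; exists x; split => //.
  by case: xb => /andP[a b]; [left|right]; rewrite dly_sides// dly_sides'// a b.
have nbp x : Z x -> ~ between (dly p y) (dly p z) x.
  by move=> Zx xb; apply: nb; exists x.
have g1 := dgrad_same p u L y z plip L0 uk (ulip_between _ _ nbp) py.
have L20 : 0 <= 2 * L by lra.
have g2 := dgrad_same q v _ y z qlip L20 vk (vlip_between _ _ nbq) qy.
rewrite -/D in g1 g2.
have -> : (dgrad p u y - dgrad q v y) - (dgrad p u z - dgrad q v z) =
  (dgrad p u y - dgrad p u z) - (dgrad q v y - dgrad q v z) by apply/rowP => i; rewrite !mxE; ring.
rewrite (le_trans (ler_enormB _ _))//.
have : 0 <= c ^+ 3 * D by rewrite mulr_ge0//; lra.
set A := c ^+ 3 * D in g1 g2 * => A0.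
have -> : c ^+ 3 * (22 + 6 * L) * (1 + (dly p y)^-1 + (dly q y)^-1) * D =
  A * (22 + 6 * L) * (1 + (dly p y)^-1 + (dly q y)^-1) by rewrite /A; ring.
have Ap : 0 <= A * (dly p y)^-1 by rewrite mulr_ge0// ltW.
have Aq : 0 <= A * (dly q y)^-1 by rewrite mulr_ge0// ltW.
have ApL : 0 <= A * (dly p y)^-1 * L by rewrite mulr_ge0.
have AqL : 0 <= A * (dly q y)^-1 * L by rewrite mulr_ge0.
have AL : 0 <= A * L by rewrite mulr_ge0.
rewrite (le_trans (lerD g1 g2))// -subr_ge0.
lra.
Qed.

End Matching.

(** Caratheodory's form of the derivative avoids dividing by the increment, because the increment of
    the delay that will stand for [s - a] may vanish. *)
Lemma caratheodory_quotient {R : realType} (f : R -> R) (a l : R) :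
  is_derive a 1 f l -> exists2 Q : R -> R, Q x @[x --> (0 : R)] --> l &
    forall s, f s - f a = (s - a) * Q (s - a).
Proof.
move=> [fa fl]; pose Q x := if x == 0 then l else x^-1 * (f (x + a) - f a).
exists Q => [|s]; last first.
  rewrite /Q; case: eqP => [/eqP|/eqP s0]; last by rewrite mulrA mulfV// mul1r subrK.
  by rewrite subr_eq0 => /eqP ->; rewrite !subrr mul0r.
apply/cvgrPdist_lt => e e0.
have : (fun h => h^-1 *: (f (h *: 1 + a) - f a)) @ 0^' --> l by rewrite -fl.
move/cvgrPdist_lt => /(_ _ e0); rewrite !near_withinE near_simpl.
apply: filterS => x h; rewrite /Q; case: eqP => [_|/eqP x0].
  by rewrite subrr normr0.
by have := h x0; rewrite /= [x *: 1]mulr1.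
Qed.

Lemma enorm_combination_sqr {R : realType} (h s : R) (d e v : 'rV[R]_3) :
  enorm (h *: e + d - s *: v) ^+ 2 = enorm d ^+ 2 + 2 * h * dot d e +
  h ^+ 2 * dot e e - 2 * s * dot d v - 2 * h * s * dot e v + s ^+ 2 * dot v v.
Proof. by rewrite !enorm_sqr !dotE !mxE; ring. Qed.

Section DelayDerivative.
Context {R : realType} (k : R) (p u : R -> 'rV[R]_3).
Hypothesis k0 : 0 <= k.
Hypothesis k1 : k < 1.
Hypothesis plip : lipschitz3 k p.
Hypothesis uk : forall s, enorm (u s) <= k.

Lemma dly_line_cvg (y e : 'rV[R]_3) :
  dly p ((h : R) *: e + y) @[h --> (0 : R)] --> dly p y.
Proof.
have kk := k1; have c1 := inv1Bk_ge1 k k0 k1.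
apply/cvgrPdist_lt => eps eps0.
have e1 : 0 < enorm e + 1 by have := enorm_ge0 e; lra.
have r0 : 0 < (1 - k)^-1^-1 * eps / (enorm e + 1).
  by rewrite divr_gt0// mulr_gt0// !invr_gt0 subr_gt0.
suff : \forall h \near (0 : R), `|dly p y - dly p ((h : R) *: e + y)| < eps by [].
apply: filterS (nbhs0_lt r0) => h hr.
rewrite (le_lt_trans (dly_lip k p k0 k1 plip _ _))//.
rewrite opprD addrCA subrr addr0 enormN enormZ.
rewrite -ltr_pdivlMl; last lra.
rewrite (le_lt_trans (_ : _ <= `|h| * (enorm e + 1)))//.
  by rewrite ler_wpM2l// lerDl.
by rewrite -ltr_pdivlMr.
Qed.

(** Implicit differentiation of the squared delay equation. With the increment [D h] of the delay
    and the quotient vector [V h] of the curve, the equation factors as [D h * Den h = h * (2 * dot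
    d e + h * dot e e)], and [Den h] tends to [2 * (a + dot d (u a))], which is positive because
    [enorm (u a) <= k < 1]. *)
Lemma dly_is_derive (y e : 'rV[R]_3) : 0 < dly p y ->
  (forall i, is_derive (dly p y) 1 (fun s => p s 0 i) (u (dly p y) 0 i)) ->
  is_derive y e (dly p) (dot (dgrad p u y) e).
Proof.
move=> a0 dp; have kk := k1; have kk0 := k0.
set a := dly p y in a0 dp *.
pose d := y - p a.
have da : enorm d = a by exact: (dlyE k p k0 k1 plip).
have N0 : 0 < a + dot d (u a).
  have := denom_ge k d (u a) (uk a); rewrite da.
  apply: lt_le_trans; rewrite mulr_gt0//; lra.
have /choice[Q QP] : forall i, exists Q : R -> R, Q x @[x --> (0 : R)] --> u a 0 i /\
    forall s, p s 0 i - p a 0 i = (s - a) * Q (s - a).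
  by move=> i; have [Q] := caratheodory_quotient _ _ _ (dp i); exists Q.
pose D (h : R) : R := dly p (h *: e + y) - a.
have dly0 : D @ (0 : R) --> (0 : R).
  by have := cvgB (dly_line_cvg y e) (cvg_cst a); rewrite -/a subrr; apply.
pose V (h : R) : 'rV[R]_3 := \row_i Q i (D h).
have Vcvg i : (fun h : R => V h 0 i) @ (0 : R) --> u a 0 i.
  have -> : (fun h : R => V h 0 i) = Q i \o D by apply/funext => h; rewrite mxE.
  by apply: (cvg_comp _ _ dly0); have [] := QP i.
have VE (h : R) : p (dly p (h *: e + y)) - p a = D h *: V h.
  by apply/rowP => i; rewrite !mxE; have [_ ->] := QP i.
pose Den (h : R) := 2 * a + D h + 2 * dot d (V h) + 2 * h * dot e (V h)
  - D h * dot (V h) (V h).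
have keyE (h : R) : D h * Den h = h * (2 * dot d e + h * dot e e).
  have := enorm_sqr (h *: e + y - p (dly p (h *: e + y))).
  rewrite (dlyE k)//.
  have -> : h *: e + y - p (dly p (h *: e + y)) = h *: e + d - D h *: V h.
    by rewrite -VE; apply/rowP => i; rewrite !mxE; ring.
  have -> : dly p (h *: e + y) = D h + a by rewrite /D subrK.
  rewrite -enorm_sqr enorm_combination_sqr da /Den => H.
  by move: H; move: (dot _ _) (dot e (V h)) => ? ?; lra.
have dotV w : (fun h : R => dot w (V h)) @ (0 : R) --> dot w (u a).
  rewrite dotE; under eq_fun do rewrite dotE.
  by apply: cvgD; [apply: cvgD|]; apply: cvgM; (exact: cvg_cst || exact: Vcvg).
have dotVV : (fun h : R => dot (V h) (V h)) @ (0 : R) --> dot (u a) (u a).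
  rewrite dotE; under eq_fun do rewrite dotE.
  by apply: cvgD; [apply: cvgD|]; apply: cvgM; exact: Vcvg.
have cid0 : (fun h : R => h) @ (0 : R) --> (0 : R) by exact: cvg_id.
have Dencvg : Den @ (0 : R) --> 2 * (a + dot d (u a)).
  have -> : 2 * (a + dot d (u a)) = 2 * a + 0 + 2 * dot d (u a) + 2 * 0 * dot e (u a) -
     0 * dot (u a) (u a) by ring.
  apply: cvgB; last by apply: cvgM.
  apply: cvgD; last first.
    by apply: cvgM => //; apply: cvgM => //; exact: cvg_cst.
  apply: cvgD; last by apply: cvgM => //; exact: cvg_cst.
  by apply: cvgD => //; exact: cvg_cst.
have D0 : 2 * (a + dot d (u a)) != 0 by rewrite gt_eqF// mulr_gt0.
have H : (fun h : R => h^-1 *: D h) @ (0 : R)^' --> dot (dgrad p u y) e.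
  have : (fun h : R => (2 * dot d e + h * dot e e) / Den h) @ (0 : R)^' --> dot (dgrad p u y) e.
    apply: cvg_within_filter.
    have -> : dot (dgrad p u y) e =
        (2 * dot d e + 0 * dot e e) / (2 * (a + dot d (u a))).
      rewrite /dgrad dotZl -/a -/d; field.
      by rewrite gt_eqF.
    apply: cvgM; last by apply: cvgV.
    by apply: cvgD; [exact: cvg_cst|apply: cvgM => //; exact: cvg_cst].
  apply: cvg_trans; apply: near_eq_cvg; near=> h.
  have h0 : h != 0 by near: h; exact: nbhs_dnbhs_neq.
  have Dh : Den h != 0.
    by near: h; apply: nbhs_dnbhs; exact: (cvgr_neq0 _ Dencvg).
  rewrite /= [_ *: _]mulrC.
  apply: (mulIf Dh); rewrite divfK// mulrAC keyE.
  by field.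
by split; [apply/cvg_ex; eexists; exact: H|exact: cvg_lim H].
Unshelve. all: by end_near. Qed.

(** Along a line the gradient is a rational expression in the delay, the curve and the velocity at
    the delay, all derivable by the chain rule, with a denominator bounded below by
    [(1 - k) * dly p y]. *)
Lemma dgrad_derivable (y e : 'rV[R]_3) j : 0 < dly p y ->
  (forall i, is_derive (dly p y) 1 (fun s => p s 0 i) (u (dly p y) 0 i)) ->
  (forall i, derivable (fun s => u s 0 i) (dly p y) 1) ->
  derivable (fun z => dgrad p u z 0 j) y e.
Proof.
move=> a0 dp du; have kk := k1.
have [dl _] := dly_is_derive y e a0 dp.
apply/derivable1P => /=.
pose phi (h : R) := dly p (h *: e + y).
have phi0 : phi 0 = dly p y by rewrite /phi scale0r add0r.
have dphi : derivable phi 0 1 by exact: (derivable1P (dly p) y e).1 dl.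
have dpphi i : derivable (fun h => p (phi h) 0 i) 0 1.
  apply/derivable1_diffP; apply: (@differentiable_comp _ _ _ _ phi (fun s => p s 0 i)).
    exact/derivable1_diffP.
  by rewrite phi0; apply/derivable1_diffP; case: (dp i).
have duphi i : derivable (fun h => u (phi h) 0 i) 0 1.
  apply/derivable1_diffP; apply: (@differentiable_comp _ _ _ _ phi (fun s => u s 0 i)).
    exact/derivable1_diffP.
  by rewrite phi0; apply/derivable1_diffP.
have dd i : derivable (fun h : R => (h *: e + y - p (phi h)) 0 i) 0 1.
  have -> : (fun h : R => (h *: e + y - p (phi h)) 0 i) =
      (id * cst (e 0 i) + cst (y 0 i)) - (fun h => p (phi h) 0 i).
    by apply/funext => h; rewrite !mxE.
  apply: derivableB (dpphi i); apply: derivableD (derivable_cst _ _ _).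
  by apply: derivableM; [exact: derivable_id|exact: derivable_cst].
have dM i : derivable (fun h : R => (h *: e + y - p (phi h)) 0 i * u (phi h) 0 i) 0 1.
  exact: derivableM (dd i) (duphi i).
have -> : (fun h : R => dgrad p u (h *: e + y) 0 j) =
  (fun h => (phi h + ((h *: e + y - p (phi h)) 0 0 * u (phi h) 0 0 +
     (h *: e + y - p (phi h)) 0 1 * u (phi h) 0 1 +
     (h *: e + y - p (phi h)) 0 2 * u (phi h) 0 2))^-1 *
     (h *: e + y - p (phi h)) 0 j).
  by apply/funext => h; rewrite /dgrad mxE dotE.
apply: (derivableM _ (dd j)); apply: derivableV.
  rewrite phi0 scale0r add0r -dotE gt_eqF//.
  have := denom_ge k (y - p (dly p y)) (u (dly p y)) (uk _).
  rewrite (dlyE k)//; apply: lt_le_trans; rewrite mulr_gt0//; lra.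
exact: derivableD dphi (derivableD (derivableD (dM 0) (dM 1)) (dM 2)).
Qed.

End DelayDerivative.

(** * Lebesgue measure on Euclidean space *)

Notation R3 R := (measurableTypeR R * measurableTypeR R * measurableTypeR R)%type.

Lemma forall_ord3 (P : 'I_3 -> Prop) : P 0 -> P 1 -> P 2 -> forall i, P i.
Proof.
move=> p0 p1 p2 [[|[|[|//]]] i3].
- by rewrite (_ : Ordinal i3 = 0)//; exact/val_inj.
- by rewrite (_ : Ordinal i3 = 1)//; exact/val_inj.
- by rewrite (_ : Ordinal i3 = 2)//; exact/val_inj.
Qed.

Section Space.
Context {R : realType}.

Lemma measurable_coord1 : measurable_fun [set: R3 R] (fun p : R3 R => p.1.1 : R).
Proof. by apply: measurableT_comp; [exact: measurable_fst|exact: measurable_fst]. Qed.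

Lemma measurable_coord2 : measurable_fun [set: R3 R] (fun p : R3 R => p.1.2 : R).
Proof. by apply: measurableT_comp; [exact: measurable_snd|exact: measurable_fst]. Qed.

Lemma measurable_coord3 : measurable_fun [set: R3 R] (fun p : R3 R => p.2 : R).
Proof. exact: measurable_snd. Qed.

Lemma measurable_rv3 i : measurable_fun [set: R3 R] (fun p : R3 R => rv3 p 0 i : R).
Proof.
move: i; apply: forall_ord3; under eq_fun do rewrite mxE /=.
- exact: measurable_coord1.
- exact: measurable_coord2.
- exact: measurable_coord3.
Qed.

Definition grid (n : nat) (x : R) : R := (Num.floor (n.+1%:R * x))%:~R / n.+1%:R.

Lemma grid_dist n x : `|x - grid n x| <= n.+1%:R^-1.
Proof.
have n0 : 0 < n.+1%:R :> R by rewrite ltr0n.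
have /andP[h1 h2] := floor_itv (n.+1%:R * x).
have -> : x - grid n x = (n.+1%:R * x - (Num.floor (n.+1%:R * x))%:~R) / n.+1%:R.
  by rewrite /grid; field; rewrite gt_eqF.
rewrite normrM normfV (gtr0_norm n0) ler_pdivrMr// mulVf ?gt_eqF//.
by rewrite intrD in h2; rewrite ger0_norm; lra.
Qed.

Lemma measurable_floor_eq n (z : int) (g : R3 R -> R) :
  measurable_fun setT g ->
  measurable [set p : R3 R | Num.floor (n.+1%:R * g p) = z].
Proof.
move=> mg.
have -> : [set p : R3 R | Num.floor (n.+1%:R * g p) = z] =
   (fun p => n.+1%:R * g p) @^-1` `[z%:~R, (z + 1)%:~R[.
  apply/seteqP; split => p /=; rewrite in_itv/= -floor_eq; first by move=> ->.
  by move/eqP.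
rewrite -[X in measurable X]setTI; apply: measurable_funM => //.
Qed.

(** Evaluated at the lattice point obtained by rounding each coordinate down, the function factors
    through a triple of integers, so its preimages are countable unions of boxes; by continuity
    these step functions converge as the mesh [n.+1%:R^-1] tends to 0. *)
Lemma continuous_measurable_rv3 (f : 'rV[R]_3 -> R) : continuous f ->
  measurable_fun [set: R3 R] (f \o rv3).
Proof.
move=> cf.
pose F n (t : int * int * int) := f (rv3 (t.1.1%:~R / n.+1%:R, t.1.2%:~R / n.+1%:R,
  t.2%:~R / n.+1%:R)).
pose fl n (p : R3 R) := (Num.floor (n.+1%:R * (p.1.1 : R)),
  Num.floor (n.+1%:R * (p.1.2 : R)), Num.floor (n.+1%:R * (p.2 : R))).
apply: (@measurable_fun_cvg _ _ _ setT (fun n p => F n (fl n p))) => [n _ Y mY|p _].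
  rewrite setTI.
  have -> : (fun p => F n (fl n p)) @^-1` Y =
      \bigcup_t (if F n t \in Y then [set p | fl n p = t] else set0).
    apply/seteqP; split => [p Yp|p [t _]] /=.
      by exists (fl n p) => //; rewrite mem_set.
    by case: ifPn => //; rewrite inE => + /= -> .
  apply: countable_bigcupT_measurable => [|t]; first exact: countableP.
  case: ifP => // _.
  have -> : [set p | fl n p = t] = [set p : R3 R | Num.floor (n.+1%:R * (p.1.1 : R)) = t.1.1]
    `&` [set p : R3 R | Num.floor (n.+1%:R * (p.1.2 : R)) = t.1.2]
    `&` [set p : R3 R | Num.floor (n.+1%:R * (p.2 : R)) = t.2].
    by apply/seteqP; split => [p /= <-|p /= [[h1 h2] h3]]//;
       rewrite /fl h1 h2 h3; case: (t) => -[].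
  by apply: measurableI; [apply: measurableI|]; apply: measurable_floor_eq;
    [exact: measurable_coord1|exact: measurable_coord2|exact: measurable_coord3].
have -> : (fun n => F n (fl n p)) =
    f \o (fun n => rv3 (grid n p.1.1, grid n p.1.2, grid n p.2)) by [].
apply: (cvg_comp _ _ _ (cf (rv3 p))) => A /nbhs_ballP[e /= e0 eA].
have : \forall n \near \oo, (n.+1%:R^-1 : R) < e.
  by apply: near_infty_natSinv_lt (PosNum e0).
apply: filterS => n ne; apply: eA; split => // i j; rewrite ord1.
rewrite -ball_normE /ball_/=; apply: le_lt_trans ne.
rewrite !mxE; case: j => -[|[|[|//]]] _ /=; exact: grid_dist.
Qed.

Lemma enorm_continuous : continuous (@enorm R).
Proof.
move=> y; apply: (@continuous_comp _ _ _ (fun u : 'rV[R]_3 => dot u u)); last first.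
  exact: sqrt_continuous.
have cM i : continuous (fun u : 'rV[R]_3 => u 0 i * u 0 i).
  by move=> u; apply: continuousM; exact: coord_continuous.
rewrite (_ : (fun u : 'rV[R]_3 => dot u u) =
  (fun u => u 0 0 * u 0 0 + u 0 1 * u 0 1 + u 0 2 * u 0 2)); last first.
  by apply/funext => u; rewrite dotE.
by apply: continuousD; [apply: continuousD|]; exact: cM.
Qed.

Lemma enorm_sub_continuous (c : 'rV[R]_3) :
  continuous (fun y : 'rV[R]_3 => enorm (y - c)).
Proof.
move=> y.
apply: (@continuous_comp _ _ _ (fun u : 'rV[R]_3 => u - c)); last exact: enorm_continuous.
by apply: (@continuousB _ _ _ id (cst c)); [by move=> ?|exact: cst_continuous].
Qed.

Lemma measurable_enorm_sub (c : 'rV[R]_3) :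
  measurable_fun [set: R3 R] (fun p => enorm (rv3 p - c)).
Proof. exact: (continuous_measurable_rv3 _ (enorm_sub_continuous c)). Qed.

Lemma eball_measurable (r : R) : measurable ((rv3 : R3 R -> _) @^-1` eball r).
Proof.
have -> : (rv3 : R3 R -> _) @^-1` eball r =
    (fun p => enorm (rv3 p - 0)) @^-1` `]-oo, r[.
  by apply/seteqP; split => p /=; rewrite in_itv/= subr0.
by rewrite -[X in measurable X]setTI; exact: measurable_enorm_sub.
Qed.

Lemma leb3X (A B C : set (measurableTypeR R)) :
  measurable A -> measurable B -> measurable C ->
  leb3 (A `*` B `*` C) = (lebesgue_measure A * lebesgue_measure B * lebesgue_measure C)%E.
Proof.
move=> mA mB mC; rewrite /leb3 [LHS]product_measure1E//; last exact: measurableX.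
by congr (_ * _)%E; exact: product_measure1E.
Qed.

Definition cube (c : 'rV[R]_3) (h : R) : set (R3 R) :=
  `[c 0 0 - h, c 0 0 + h] `*` `[c 0 1 - h, c 0 1 + h] `*` `[c 0 2 - h, c 0 2 + h].

Lemma cube_measurable c h : measurable (cube c h).
Proof. by apply: measurableX => //; exact: measurableX. Qed.

Lemma leb3_cube c h : 0 <= h -> leb3 (cube c h) = (8 * h ^+ 3)%:E.
Proof.
move=> h0; rewrite leb3X// !lebesgue_measure_itv/= !lte_fin.
have [<-|hn0] := eqVneq 0 h.
  by rewrite !subr0 !addr0 !ltxx !mul0e expr0n mulr0.
have hp : 0 < h by rewrite lt_def eq_sym hn0.
have clt i : c 0 i - h < c 0 i + h by lra.
rewrite !clt.
rewrite -!EFinB -!EFinM; congr (_%:E); ring.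
Qed.

Lemma cubeP c h p : cube c h p <-> forall i, `|(rv3 p - c) 0 i| <= h.
Proof.
have H (x a : R) : (x \in `[a - h, a + h]) = (`|x - a| <= h).
  by rewrite in_itv/= distrC ler_distlC.
rewrite /cube; split => [[[/= h1 h2] h3] i|h1].
  move: h1 h2 h3; rewrite !H => h1 h2 h3.
  by move: i; apply: forall_ord3; rewrite !mxE.
by split; [split|] => /=; rewrite H; [have := h1 0|have := h1 1|have := h1 2]; rewrite !mxE.
Qed.

Lemma sub_ball_cube c h : [set p : R3 R | enorm (rv3 p - c) <= h] `<=` cube c h.
Proof.
by move=> p /= ph; apply/cubeP => i; rewrite (le_trans (ler_coord_enorm _ _)).
Qed.

Lemma leb3_eball_lty (r : R) : (leb3 ((rv3 : R3 R -> _) @^-1` eball r) < +oo)%E.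
Proof.
have [r0|r0] := leP 0 r.
  apply: (@le_lt_trans _ _ (leb3 (cube 0 r))); last by rewrite leb3_cube// ltry.
  apply: le_measure; rewrite ?inE; [exact: eball_measurable|exact: cube_measurable|].
  by move=> p /= pr; apply: sub_ball_cube; rewrite /= subr0 ltW.
have -> : (rv3 : R3 R -> _) @^-1` eball r = set0.
  apply/seteqP; split => p //=; have := enorm_ge0 (rv3 p); rewrite /eball/=; lra.
by rewrite measure0 ltry.
Qed.

(** Integration over the first two coordinates: a line parallel to the third axis meets the sphere
    in at most two points. *)
Lemma leb3_sphere (c : 'rV[R]_3) (r : R) :
  measurable [set p : R3 R | enorm (rv3 p - c) = r] /\
  leb3 [set p : R3 R | enorm (rv3 p - c) = r] = 0%E.
Proof.
set S := [set p | _].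
have mS : measurable S.
  have -> : S = (fun p => enorm (rv3 p - c)) @^-1` [set r] by [].
  by rewrite -[X in measurable X]setTI; exact: measurable_enorm_sub.
split => //; rewrite /leb3 /product_measure1.
apply: integral0_eq => /= q _.
apply: countable_lebesgue_measure0.
pose s := Num.sqrt (r ^+ 2 - (q.1 - c 0 0) ^+ 2 - (q.2 - c 0 1) ^+ 2).
apply: (@sub_countable _ _ _ [set c 0 2 + s; c 0 2 - s]); last first.
  by apply: finite_set_countable; exact: finite_set2.
apply: subset_card_le => z; rewrite /xsection/= inE /S/= => qz.
have := enorm_sqr (rv3 (q, z) - c); rewrite qz dotE !mxE/= => h.
have e : (z - c 0 2) ^+ 2 = r ^+ 2 - (q.1 - c 0 0) ^+ 2 - (q.2 - c 0 1) ^+ 2.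
  by rewrite h; ring.
have : `|z - c 0 2| = s by rewrite /s -e sqrtr_sqr.
have [zc|zc] := leP 0 (z - c 0 2).
  by rewrite ger0_norm// => e'; left; rewrite -e' addrC subrK.
by rewrite ltr0_norm// => e'; right; rewrite -e' opprK addrC subrK.
Qed.

End Space.

(** Cavalieri's principle: a section of the preimage is the [s2]-preimage of a section and has the
    same [m2] measure; [s1] then transforms the outer integral. *)
Lemma product_measure_invariant d1 d2 (T1 : measurableType d1)
    (T2 : measurableType d2) (R : realType) (m1 : {measure set T1 -> \bar R})
    (m2 : {sigma_finite_measure set T2 -> \bar R}) (s1 : T1 -> T1) (s2 : T2 -> T2) :
  measurable_fun setT s1 -> measurable_fun setT s2 ->
  (forall A, measurable A -> pushforward m1 s1 A = m1 A) ->
  (forall A, measurable A -> pushforward m2 s2 A = m2 A) ->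
  forall A, measurable A ->
    pushforward (m1 \x m2)%E (fun p => (s1 p.1, s2 p.2)) A = (m1 \x m2)%E A.
Proof.
move=> ms1 ms2 i1 i2 A mA; rewrite /pushforward /product_measure1.
have mx := measurable_fun_xsection m2 mA.
transitivity (\int[m1]_x (m2 \o xsection A) (s1 x))%E.
  apply: eq_integral => x _ /=.
  rewrite -[RHS]i2; last exact: measurable_xsection.
  rewrite /pushforward; apply: congr1.
  by apply/seteqP; split => y; rewrite /xsection/= !inE.
rewrite -[X in (\int[_]_(_ in X) _)%E = _](preimage_setT s1).
rewrite -(@ge0_integral_pushforward _ _ _ _ _ _ ms1 m1 setT (m2 \o xsection A))//.
by apply: eq_measure_integral => B mB _; exact: i1.
Qed.

Section InvariantIntegral.
Context d (T : measurableType d) (R : realType) (m : {measure set T -> \bar R}).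
Variable s : T -> T.
Hypothesis ms : measurable_fun setT s.
Hypothesis ims : forall A, measurable A -> pushforward m s A = m A.

Lemma invariant_integrable (F : T -> \bar R) :
  m.-integrable setT F -> m.-integrable setT (F \o s).
Proof.
move=> /integrableP[mF iF]; apply/integrableP; split; first exact: measurableT_comp.
apply: le_lt_trans iF.
rewrite -[X in (\int[_]_(_ in X) _ <= _)%E](preimage_setT s).
rewrite -(@ge0_integral_pushforward _ _ _ _ _ _ ms m setT (fun x => `|F x|%E))//.
  rewrite le_eqVlt; apply/orP; left; apply/eqP.
  by apply: eq_measure_integral => A mA _; exact: ims.
exact: measurableT_comp.
Qed.

Lemma invariant_integral (F : T -> \bar R) : m.-integrable setT F ->
  (\int[m]_p F (s p) = \int[m]_p F p)%E.
Proof.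
move=> iF; have iFs := invariant_integrable _ iF.
rewrite -[X in (\int[_]_(_ in X) _)%E = _](preimage_setT s).
rewrite -[LHS](@integral_pushforward _ _ _ _ _ _ ms m setT F)//.
  by apply: eq_measure_integral => A mA _; exact: ims.
by case/integrableP : iF.
Qed.

End InvariantIntegral.

Section Translation.
Context {R : realType}.
Local Notation mu := (@lebesgue_measure R).

Definition shift1 (a : R) (x : measurableTypeR R) : measurableTypeR R := x + a.

Lemma measurable_shift1 a : measurable_fun setT (shift1 a).
Proof. exact: measurable_funD. Qed.

(** Lebesgue measure is determined by its values on half-open intervals, and translation keeps their
    lengths. *)
Lemma lebesgue_measure_shift a (A : set (measurableTypeR R)) : measurable A ->
  pushforward mu (shift1 a) A = mu A.
Proof.
have ms := measurable_shift1 a.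
move=> mA; apply/esym/lebesgue_measure_unique => //= _ [[x y]] _ <-.
rewrite /pushforward.
have -> : shift1 a @^-1` `]x, y] = `]x - a, y - a]%classic.
  by apply/seteqP; split => z /=; rewrite !in_itv/= /shift1 ltrBlDr lerBrDr.
rewrite !lebesgue_measure_itv/= !lte_fin ltrD2r.
by case: ifP => // _; rewrite -!EFinB; congr (_%:E); ring.
Qed.

Local Notation mu2 := (mu \x mu)%E.

Definition shift2 (a b : R) (p : measurableTypeR R * measurableTypeR R) :
  measurableTypeR R * measurableTypeR R := (shift1 a p.1, shift1 b p.2).

Lemma measurable_shift2 a b : measurable_fun setT (shift2 a b).
Proof.
apply: measurable_fun_pair.
  by apply: (measurableT_comp (measurable_shift1 a)); exact: measurable_fst.
by apply: (measurableT_comp (measurable_shift1 b)); exact: measurable_snd.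
Qed.

Lemma leb2_shift a b (A : set (measurableTypeR R * measurableTypeR R)) :
  measurable A -> pushforward mu2 (shift2 a b) A = mu2 A.
Proof.
apply: product_measure_invariant.
- exact: measurable_shift1.
- exact: measurable_shift1.
- exact: lebesgue_measure_shift.
- exact: lebesgue_measure_shift.
Qed.

Definition shift3 (v : 'rV[R]_3) (p : R3 R) : R3 R :=
  (shift2 (v 0 0) (v 0 1) p.1, shift1 (v 0 2) p.2).

Lemma rv3_shift3 v p : rv3 (shift3 v p) = rv3 p + v.
Proof.
by apply/rowP; apply: forall_ord3; rewrite !mxE.
Qed.

Lemma measurable_shift3 v : measurable_fun setT (shift3 v).
Proof.
apply: measurable_fun_pair.
  by apply: (measurableT_comp (measurable_shift2 _ _)); exact: measurable_fst.
by apply: (measurableT_comp (measurable_shift1 _)); exact: measurable_snd.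
Qed.

Lemma leb3_shift v (A : set (R3 R)) :
  measurable A -> pushforward leb3 (shift3 v) A = leb3 A.
Proof.
apply: product_measure_invariant.
- exact: measurable_shift2.
- exact: measurable_shift1.
- exact: leb2_shift.
- exact: lebesgue_measure_shift.
Qed.

End Translation.

Lemma measurable_invr (R : realType) : measurable_fun [set: R] (@GRing.inv R).
Proof.
rewrite -(setvU [set 0]); apply/measurable_funU => //; first exact: measurableC.
split; last exact: measurable_fun_set1.
apply: open_continuous_measurable_fun.
  by apply: closed_openC; exact: closed_eq.
by move=> x; rewrite inE/= => /eqP x0; exact: inv_continuous.
Qed.

(** * Local integrability of the inverse squared distance in dimension three *)

Section InverseSquare.
Context {R : realType}.

Let h (c : 'rV[R]_3) (p : R3 R) : R := (enorm (rv3 p - c))^-1 ^+ 2.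

(** A dyadic majorant: off the cube of half-side [rho / 2 ^+ n.+1] the inverse squared distance is
    at most [4 ^+ n.+1 / rho ^+ 2]. The indicator is that of the whole [n]-th cube instead of the
    shell, which still gives a geometric series: the cube has volume [8 * (rho / 2 ^+ n) ^+ 3], so
    the term integrates to at most [32 * rho / 2 ^+ n]. *)
Let term (c : 'rV[R]_3) (rho : R) (n : nat) (p : R3 R) : \bar R :=
  ((4 ^+ n.+1 / rho ^+ 2)%:E * (\1_(cube c (rho / 2 ^+ n)) p)%:E)%E.

Lemma measurable_inv_dist (c : 'rV[R]_3) :
  measurable_fun [set: R3 R] (fun p => (enorm (rv3 p - c))^-1).
Proof. by apply: (measurableT_comp (measurable_invr R)); exact: measurable_enorm_sub. Qed.

Lemma inverse_square_le_series c rho p : 0 < rho -> cube c rho p ->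
  ((h c p)%:E <= \sum_(0 <= n <oo) term c rho n p)%E.
Proof.
move=> rho0 cp.
have t0 n : (0 <= term c rho n p)%E.
  by rewrite mule_ge0// lee_fin ?divr_ge0 ?exprn_ge0// ltW.
(* At the centre the convention [0^-1 = 0] makes the left side 0. *)
have [pc|pc] := eqVneq (enorm (rv3 p - c)) 0.
  by rewrite /h pc invr0 expr0n/=; exact: nneseries_ge0.
have d0 : 0 < enorm (rv3 p - c) by rewrite lt_def pc enorm_ge0.
have pos2 n : 0 < 2 ^+ n :> R by rewrite exprn_gt0.
(* The least index whose cube misses [p] identifies the shell of [p]. It exists because [2 ^+ m > m]
   eventually exceeds [rho] divided by a nonzero coordinate. *)
have ex : exists n, ~~ `[<cube c (rho / 2 ^+ n) p>].
  have [i di] : exists i, 0 < `|(rv3 p - c) 0 i|.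
    apply: contrapT => /forallNP H; move: d0; rewrite (_ : rv3 p - c = 0) ?enorm0 ?ltxx//.
    by apply/rowP => i; rewrite [RHS]mxE; apply/eqP; rewrite -normr_le0 leNgt; apply/negP.
  exists (Num.truncn (rho / `|(rv3 p - c) 0 i|)).+1.
  apply/asboolPn => /cubeP /(_ i); apply/negP; rewrite -ltNge.
  rewrite ltr_pdivrMr// mulrC -ltr_pdivrMr//.
  apply: lt_trans (truncnS_gt _) _.
  by rewrite -natrX ltr_nat ltn_expl.
have := ex_minnP ex => -[[|n]].
  by rewrite expr0 divr1 => /asboolPn.
move=> /asboolPn nP nmin.
have cn : cube c (rho / 2 ^+ n) p.
  by apply: contrapT => /asboolPn /nmin; rewrite ltnn.
apply: (@le_trans _ _ (term c rho n p)).
  rewrite /term indicE mem_set// mule1 lee_fin /h.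
  have : rho / 2 ^+ n.+1 < enorm (rv3 p - c).
    rewrite ltNge; apply/negP => le; apply: nP; exact: sub_ball_cube.
  move=> lt.
  have -> : 4 ^+ n.+1 / rho ^+ 2 = (rho / 2 ^+ n.+1)^-1 ^+ 2.
    have -> : 4 = 2 ^+ 2 :> R by ring.
    by rewrite -exprM mulnC exprM invf_div expr_div_n.
  rewrite ler_sqr ?nnegrE ?invr_ge0 ?enorm_ge0//; last by rewrite divr_ge0 ?ltW.
  by rewrite lef_pV2 ?posrE ?divr_gt0// ltW.
apply: le_trans (nneseries_lim_ge n.+1 _) => [|k _ _]; last exact: t0.
by rewrite big_nat_recr//= leeDr// sume_ge0.
Qed.

Lemma inverse_square_integral c rho : 0 < rho ->
  (\int[leb3]_(p in cube c rho) (h c p)%:E < +oo)%E.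
Proof.
move=> rho0.
have pos2 n : 0 < 2 ^+ n :> R by rewrite exprn_gt0.
have mh : measurable_fun setT (h c) by apply: measurable_funX; exact: measurable_inv_dist.
have mt n : measurable_fun setT (term c rho n).
  apply: measurable_funeM; apply/measurable_EFinP; apply: measurable_indic.
  exact: cube_measurable.
have t0 n p : (0 <= term c rho n p)%E.
  by rewrite mule_ge0// lee_fin ?divr_ge0 ?exprn_ge0// ltW.
apply: (@le_lt_trans _ _ (\int[leb3]_(p in cube c rho) \sum_(0 <= n <oo) term c rho n p)%E).
  apply: ge0_le_integral => //.
  - exact: cube_measurable.
  - by move=> p _; rewrite lee_fin sqr_ge0.
  - by apply/measurable_EFinP; apply: measurable_funTS.
  - apply: measurable_funTS; exact: (@ge0_emeasurable_sum _ _ _ setT (term c rho) xpredT).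
  - by move=> p cp; exact: inverse_square_le_series.
rewrite integral_nneseries//; last 2 first.
- exact: cube_measurable.
- by move=> n; exact: measurable_funTS.
(* This is [32 * rho / 2 ^+ n] written as a term of the halving series of sum [64 * rho]. *)
apply: (@le_lt_trans _ _ (\sum_(0 <= n <oo) ((64 * rho) / (2 ^ (n + 0).+1)%:R)%:E)%E).
  apply: lee_nneseries => [n _ _|n _]; first exact: integral_ge0.
  rewrite ge0_integralZl_EFin//; last 3 first.
  - exact: cube_measurable.
  - apply/measurable_EFinP; apply: measurable_indic; exact: cube_measurable.
  - by rewrite divr_ge0 ?exprn_ge0// ltW.
  rewrite integral_indic; [|exact: cube_measurable|exact: cube_measurable].
  rewrite (@le_trans _ _ ((4 ^+ n.+1 / rho ^+ 2)%:E * leb3 (cube c (rho / 2 ^+ n)))%E)//.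
    rewrite lee_pmul2l//; last by rewrite lte_fin divr_gt0 ?exprn_gt0.
    rewrite le_measure ?inE//; [|exact: cube_measurable].
    by apply: measurableI; exact: cube_measurable.
  rewrite leb3_cube; last by rewrite divr_ge0// ltW.
  rewrite -EFinM lee_fin addn0 natrX le_eqVlt; apply/orP; left; apply/eqP.
  have -> : 4 ^+ n.+1 = 4 * 2 ^+ n * 2 ^+ n :> R.
    by rewrite exprS -mulrA -exprMn; congr (4 * _ ^+ n); ring.
  rewrite (exprS 2 n); move: (pos2 n); move: (2 ^+ n) => a a0.
  by field; rewrite !gt_eqF.
have := @cvg_geometric_eseries_half R (64 * rho) 0 => /cvg_lim.
move=> e; rewrite (_ : limn _ = ((64 * rho) / 2 ^+ 0)%:E) ?ltry//.
rewrite -e//; apply: congr_lim; apply/funext => n.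
by rewrite /eseries/=; apply: eq_bigr => i _; rewrite addn0 addn1.
Qed.

End InverseSquare.

(** * Weak derivatives *)

Section DifferenceQuotients.
Context d (T : measurableType d) (R : realType) (m : {measure set T -> \bar R}).
Variables (s t : nat -> T -> T) (a : nat -> R) (f g psi dpsi : T -> R).
Variables (D1 D2 : T -> R) (N : set T).
Hypothesis ms : forall n, measurable_fun setT (s n).
Hypothesis ims : forall n A, measurable A -> pushforward m (s n) A = m A.
Hypothesis mt : forall n, measurable_fun setT (t n).
Hypothesis tsK : forall n, cancel (s n) (t n).
Hypothesis mf : measurable_fun setT f.
Hypothesis mg : measurable_fun setT g.
Hypothesis mpsi : measurable_fun setT psi.
Hypothesis mdpsi : measurable_fun setT dpsi.
Hypothesis ifpsi : m.-integrable setT (EFin \o (f \* psi)).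
Hypothesis ifpsit : forall n, m.-integrable setT (EFin \o (f \* (psi \o t n))).
Hypothesis iD1 : m.-integrable setT (EFin \o D1).
Hypothesis iD2 : m.-integrable setT (EFin \o D2).
Hypothesis dom1 : forall n x, `|f x * (a n * (psi x - psi (t n x)))| <= D1 x.
Hypothesis cvg1 : forall x, a n * (psi x - psi (t n x)) @[n --> \oo] --> dpsi x.
Hypothesis mN : measurable N.
Hypothesis N0 : m N = 0%E.
Hypothesis dom2 : forall n x, ~ N x -> `|a n * (f (s n x) - f x) * psi x| <= D2 x.
Hypothesis cvg2 : forall x, ~ N x ->
  a n * (f (s n x) - f x) * psi x @[n --> \oo] --> g x * psi x.

(** In use, [s n] and [t n] are the translations forth and back by a step [1 / a n]. On one side the
    quotients bear on [psi] and converge everywhere under the majorant [D1]; on the other they bear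
    on [f], under [D2], and converge off [N]. *)
Lemma difference_quotient_by_parts :
  \int[m]_x (f x * dpsi x) = - \int[m]_x (g x * psi x).
Proof.
pose F n x : \bar R := (f x * (a n * (psi x - psi (t n x))))%:E.
pose G n x : \bar R := (- (a n * (f (s n x) - f x) * psi x))%:E.
have mpt n : measurable_fun setT (psi \o t n) by exact: measurableT_comp.
have mfs n : measurable_fun setT (f \o s n) by exact: measurableT_comp.
have FG n : (\int[m]_x F n x = \int[m]_x G n x)%E.
  pose F1 x : \bar R := ((a n)%:E * (f x * psi x)%:E)%E.
  pose F2 x : \bar R := ((a n)%:E * (f x * psi (t n x))%:E)%E.
  have i1 : m.-integrable setT F1 by exact: (integrableZl measurableT _ ifpsi).
  have i2 : m.-integrable setT F2 by exact: (integrableZl measurableT _ (ifpsit n)).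
  transitivity (\int[m]_x F1 x - \int[m]_x F2 x)%E.
    rewrite -integralB//; apply: eq_integral => x _; rewrite /F /F1 /F2 /= -!EFinM -EFinB.
    by congr (_%:E); ring.
  (* Only the integral that contains [psi \o t n] is transformed: composition with [s n] moves the
     shift from [psi] to [f]. *)
  rewrite -(@invariant_integral _ _ _ m (s n) (ms n) (ims n) _ i2).
  rewrite -integralB//; last exact: (@invariant_integrable _ _ _ m (s n) (ms n) (ims n) _ i2).
  apply: eq_integral => x _; rewrite /G /F1 /F2 /= tsK -!EFinM -EFinB.
  by congr (_%:E); ring.
have [_ _ cF] : [/\ m.-integrable setT (fun x => (f x * dpsi x)%:E),
    [sequence \int[m]_x `|F n x - (f x * dpsi x)%:E|]_n%E @ \oo --> 0%E &
    [sequence \int[m]_x F n x]_n%E @ \oo --> (\int[m]_x (f x * dpsi x)%:E)%E].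
  apply: (@dominated_convergence _ _ _ m setT _ F _ (EFin \o D1)) => //.
  - move=> n; apply/measurable_EFinP; apply: measurable_funM => //.
    by apply: measurable_funM => //; exact: (measurable_funB mpsi (mpt n)).
  - by apply/measurable_EFinP; exact: measurable_funM.
  - apply: aeW => x _; apply: cvg_EFin; first exact: nearW.
    by apply: cvgM; [exact: cvg_cst|exact: cvg1].
  - by apply: aeW => x n _; rewrite /= lee_fin; exact: dom1.
have [iG _ cG] : [/\ m.-integrable setT (fun x => (- (g x * psi x))%:E),
    [sequence \int[m]_x `|G n x - (- (g x * psi x))%:E|]_n%E @ \oo --> 0%E &
    [sequence \int[m]_x G n x]_n%E @ \oo --> (\int[m]_x (- (g x * psi x))%:E)%E].
  apply: (@dominated_convergence _ _ _ m setT _ G _ (EFin \o D2)) => //.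
  - move=> n; apply/measurable_EFinP; apply: measurableT_comp => //.
    apply: measurable_funM => //.
    by apply: measurable_funM => //; exact: (measurable_funB (mfs n) mf).
  - by apply/measurable_EFinP; apply: measurableT_comp => //; exact: measurable_funM.
  - exists N; split => // x /= H; apply: contrapT => Nx; apply: H => _.
    by apply: cvg_EFin; [exact: nearW|apply: cvgN; exact: cvg2].
  - exists N; split => // x /= H; apply: contrapT => Nx; apply: H => n _.
    by rewrite /= lee_fin normrN; exact: dom2.
have e : (\int[m]_x (f x * dpsi x)%:E = \int[m]_x (- (g x * psi x))%:E)%E.
  apply: cvg_unique cF _; first exact: ereal_hausdorff.
  suff -> : ([sequence \int[m]_x F n x]_n = [sequence \int[m]_x G n x]_n)%E by [].
  by apply/funext => n; exact: FG.
have iH : m.-integrable setT (EFin \o (fun x => g x * psi x)).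
  have := integrableN iG; apply: eq_integrable => // x _.
  by rewrite /= opprK.
transitivity (\int[m]_x (-1 * (g x * psi x))); last by rewrite RintegralZl// mulN1r.
by rewrite /Rintegral e; congr fine; apply: eq_integral => x _; rewrite mulN1r.
Qed.

End DifferenceQuotients.

Section TestFunctions.
Context {R : realType}.
Implicit Types (B : set 'rV[R]_3) (psi : 'rV[R]_3 -> R).

Lemma test_function_continuous B psi : test_function B psi -> continuous psi.
Proof.
by move=> [/(_ [::]) d _ _] y; apply: differentiable_continuous; exact: d.
Qed.

Lemma test_function_derivable B psi y v : test_function B psi -> derivable psi y v.
Proof. by move=> [/(_ [::] y) d _ _]; exact: diff_derivable. Qed.

Lemma test_function_out B psi y : test_function B psi -> ~ B y -> psi y = 0.
Proof.
move=> [_ _ sB] By; apply/eqP; apply: contrapT => /negP y0; apply/By/sB.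
exact: subset_closure.
Qed.

Lemma line_cvg (e y : 'rV[R]_3) : (fun h : R => h *: e + y) @ (0 : R) --> y.
Proof.
have ce : continuous (fun h : R => h *: e + y).
  move=> h; apply: (@continuousD _ _ _ (fun h : R => h *: e) (cst y)).
    exact: scalel_continuous.
  exact: cst_continuous.
by have := ce 0; rewrite /continuous_at scale0r add0r.
Qed.

(** Off its closed support [psi] vanishes on a ball, so the derivative vanishes there too;
    smoothness is inherited by appending [i] to the list of indices. This stability is what lets
    weak derivatives be composed. *)
Lemma test_function_derive B psi i : test_function B psi ->
  test_function B (fun y => 'D_(delta_mx 0 i) psi y).
Proof.
move=> [d c sB].
have sub : closure [set y | 'D_(delta_mx 0 i) psi y != 0] `<=`
    closure [set y | psi y != 0].
  have cl := @closed_closure _ [set y | psi y != 0].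
  rewrite [X in _ `<=` X](closure_id _).1//; apply: closureS => y /= Dy.
  apply: contrapT => ny; move: Dy; apply/negP; rewrite negbK; apply/eqP.
  have [_ /nbhs_ballP [e e0 eP]] :
      ~ closure [set y | psi y != 0] y /\ nbhs y (~` closure [set y | psi y != 0]).
    by split => //; apply: open_nbhs_nbhs; split => //; exact: closed_openC.
  have psi0 z : ball y e z -> psi z = 0.
    move=> /eP/= zn; apply/eqP; apply: contrapT => /negP z0; apply: zn.
    exact: subset_closure.
  rewrite /derive; apply: lim_near_cst => //.
  have nb : \forall h \near (0 : R)^', ball y e (h *: delta_mx 0 i + y).
    apply: nbhs_dnbhs.
    by apply: (line_cvg (delta_mx 0 i) y); exact: nbhsx_ballx.
  apply: filterS nb => h hb /=.
  by rewrite psi0// psi0 ?subrr ?scaler0//; exact: ballxx.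
split.
- move=> s y; have := d (rcons s i) y.
  by rewrite /partials foldr_rcons.
- exact: (subclosed_compact (@closed_closure _ _) c sub).
- exact: subset_trans sub sB.
Qed.

Lemma test_function_bounded B psi : test_function B psi ->
  exists2 K, 0 <= K & forall y, `|psi y| <= K.
Proof.
move=> tf; have cpsi := test_function_continuous _ _ tf; have [_ c _] := tf.
have : compact (psi @` closure [set y | psi y != 0]).
  by apply: continuous_compact c; exact: continuous_subspaceT.
move/compact_bounded => [M [_ MP]].
exists (`|M| + 1) => [|y]; first by rewrite addr_ge0.
have [->|y0] := eqVneq (psi y) 0; first by rewrite normr0 addr_ge0.
apply: MP; first by rewrite (le_lt_trans (ler_norm M))// ltrDl.
by exists y => //; exact: subset_closure.
Qed.

Lemma is_derive_line psi (y e : 'rV[R]_3) (s : R) :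
  derivable psi (s *: e + y) e ->
  is_derive s 1 (fun h : R => psi (h *: e + y)) ('D_e psi (s *: e + y)).
Proof.
move=> d.
have E : (fun h : R => h^-1 *: (((fun h : R => psi (h *: e + y)) \o shift s) (h *: 1) -
      psi (s *: e + y))) =
   (fun h : R => h^-1 *: ((psi \o shift (s *: e + y)) (h *: e) - psi (s *: e + y))).
  by apply/funext => h /=; rewrite [h *: 1]mulr1 scalerDl addrA.
by split; rewrite /derivable /derive E.
Qed.

(** The mean value theorem on lines, with the bound on the partial derivative, itself a test
    function. It dominates all difference quotients of [psi] at once. *)
Lemma test_function_lip B psi i : test_function B psi ->
  exists2 K, 0 <= K & forall (y : 'rV[R]_3) (h : R),
    `|psi (h *: delta_mx 0 i + y) - psi y| <= K * `|h|.
Proof.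
move=> tf; have [K K0 KP] := test_function_bounded _ _ (test_function_derive _ _ i tf).
exists K => // y h; set e := delta_mx 0 i.
pose w (s : R) := psi (s *: e + y).
have dw (s : R) : is_derive s 1 w ('D_e psi (s *: e + y)).
  by apply: is_derive_line; exact: test_function_derivable tf.
have cw (a b : R) : {within `[a, b], continuous w}.
  apply: derivable_within_continuous => s _.
  by have [] := dw s.
have w0 : psi y = w 0 by rewrite /w scale0r add0r.
rewrite w0 -/(w h).
have [h0|h0] := leP 0 h.
  have [x _ ->] := MVT_segment h0 (fun s _ => dw s) (cw _ _).
  by rewrite subr0 normrM ler_wpM2r// KP.
have [x _] := MVT_segment (ltW h0) (fun s _ => dw s) (cw _ _).
by rewrite distrC => ->; rewrite sub0r normrM normrN ler_wpM2r// KP.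
Qed.

End TestFunctions.

Section L2.
Context {R : realType}.

Lemma in_L2_sqr (r : R) (f : 'rV[R]_3 -> R) :
  measurable_fun [set: R3 R] (f \o rv3) ->
  leb3.-integrable (rv3 @^-1` eball r) (EFin \o (fun p : R3 R => f (rv3 p) ^+ 2)) ->
  in_L2 (eball r) f.
Proof.
move=> mf iF; rewrite /in_L2.
have mB := @eball_measurable R r.
have -> : (f \_ (eball r)) \o rv3 = ((f \o rv3) \_ (rv3 @^-1` eball r)) :> (R3 R -> R).
  apply/funext => p; rewrite /patch/=.
  suff -> : (rv3 p \in eball r) = (p \in rv3 @^-1` eball r) by [].
  by apply/idP/idP; rewrite !inE.
have mF : measurable_fun [set: R3 R] ((f \o rv3) \_ (rv3 @^-1` eball r)).
  by apply: (measurable_restrictT _ mB).1; exact: measurable_funTS.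
apply/andP; split; first by rewrite inE.
rewrite inE/= /finite_norm unlock; apply: poweR_lty.
move/(integrable_mkcond _ mB) : iF => /integrableP[_].
apply: le_lt_trans; rewrite le_eqVlt; apply/orP; left; apply/eqP.
apply: eq_integral => p _; rewrite /patch/=.
case: ifPn => _ /=.
  by rewrite powR_mulrn// real_normK ?num_real// ger0_norm ?sqr_ge0.
by rewrite normr0 powR0.
Qed.

Lemma in_L2_le (r : R) (f H : 'rV[R]_3 -> R) :
  measurable_fun [set: R3 R] (f \o rv3) ->
  leb3.-integrable (rv3 @^-1` eball r) (EFin \o (fun p : R3 R => H (rv3 p))) ->
  (forall y, eball r y -> f y ^+ 2 <= H y) -> in_L2 (eball r) f.
Proof.
move=> mf iH fH; apply: in_L2_sqr => //; apply: le_integrable iH => //.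
- exact: eball_measurable.
- by apply/measurable_EFinP; apply: measurable_funTS; exact: measurable_funX.
- move=> p Bp /=; rewrite lee_fin ger0_norm ?sqr_ge0//.
  by rewrite (le_trans (fH _ Bp))// ler_norm.
Qed.

End L2.

Lemma Rintegral_support d (T : measurableType d) (R : realType)
    (m : {measure set T -> \bar R}) (D : set T) (F : T -> R) :
  (forall x, ~ D x -> F x = 0) -> \int[m]_(x in D) F x = \int[m]_x F x.
Proof.
move=> F0; rewrite Rintegral_mkcond; congr Rintegral; apply/funext => x.
by rewrite /patch; case: ifPn => //; rewrite notin_setE => /F0.
Qed.

Section WeakDerivative.
Context {R : realType}.

Lemma cube_indic_integrable (C h : R) : 0 <= h ->
  leb3.-integrable setT (EFin \o (fun p : R3 R => C * \1_(cube 0 h) p)).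
Proof.
move=> h0; have mc := @cube_measurable R 0 h.
have i1 : leb3.-integrable setT (fun p : R3 R => (\1_(cube 0 h) p)%:E).
  apply/integrableP; split; first by apply/measurable_EFinP; exact: measurable_indic.
  rewrite (eq_integral (fun p : R3 R => (\1_(cube 0 h) p)%:E)).
    by rewrite integral_indic// setIT leb3_cube// ltry.
  by move=> p _; rewrite gee0_abs// lee_fin.
exact: (integrableZl measurableT C i1).
Qed.

Lemma bounded_support_integrable (C h : R) (F : R3 R -> R) : 0 <= h ->
  measurable_fun setT F -> (forall p, `|F p| <= C) ->
  (forall p, ~ cube 0 h p -> F p = 0) -> leb3.-integrable setT (EFin \o F).
Proof.
move=> h0 mF FC F0; apply: le_integrable (cube_indic_integrable C h h0) => //.
  exact/measurable_EFinP.
move=> p _; rewrite /= lee_fin indicE.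
have [pc|pc] := boolP (p \in cube 0 h).
  by rewrite mulr1 (le_trans (FC p))// ler_norm.
by rewrite F0 ?normr0 ?normr_ge0//; move: pc; rewrite notin_setE.
Qed.

(** The absolute value allows for a negative radius, and the margin 1 for steps [n.+1%:R^-1 <= 1]: a
    function supported in the ball and its translates all vanish off one cube. *)
Lemma out_cube (r : R) (p : R3 R) : ~ cube 0 (`|r| + 1) p -> r + 1 < enorm (rv3 p).
Proof.
move=> pc; rewrite ltNge; apply/negP => pr; apply: pc; apply: sub_ball_cube.
by rewrite /= subr0 (le_trans pr)// lerD2r ler_norm.
Qed.

Lemma enorm_delta (i : 'I_3) : enorm (delta_mx 0 i : 'rV[R]_3) = 1.
Proof.
rewrite /enorm (_ : dot _ _ = 1) ?sqrtr1// /dot (bigD1 i)//= big1 ?addr0.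
  by rewrite !mxE !eqxx mulr1.
by move=> j ji; rewrite !mxE (negbTE ji) mulr0.
Qed.

(** Domination by [H] and convergence to [g] are asked on the ball only, because [psi] vanishes
    elsewhere. The bound [M] is asked everywhere, because the translates of [psi] leave the ball. *)
Lemma weak_derivative_difference_quotient (r : R) (i : 'I_3)
    (f g H : 'rV[R]_3 -> R) (M : R) (N : set (R3 R)) :
  measurable_fun [set: R3 R] (f \o rv3) ->
  measurable_fun [set: R3 R] (g \o rv3) ->
  (forall y, `|f y| <= M) ->
  leb3.-integrable (rv3 @^-1` eball r) (EFin \o (fun p : R3 R => H (rv3 p))) ->
  measurable N -> leb3 N = 0%E ->
  (forall (p : R3 R) n, ~ N p -> eball r (rv3 p) ->
    `|n.+1%:R * (f (n.+1%:R^-1 *: delta_mx 0 i + rv3 p) - f (rv3 p))| <= H (rv3 p)) ->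
  (forall p : R3 R, ~ N p -> eball r (rv3 p) ->
    n.+1%:R * (f (n.+1%:R^-1 *: delta_mx 0 i + rv3 p) - f (rv3 p)) @[n --> \oo]
      --> g (rv3 p)) ->
  weak_derivative (eball r) [:: i] f g.
Proof.
move=> mf mg fM iH mN N0 dom cvg psi tf.
set e : 'rV[R]_3 := delta_mx 0 i.
have tf' := test_function_derive _ _ i tf.
have [K K0 psiK] := test_function_lip _ _ i tf.
have [K' K'0 psiK'] := test_function_bounded _ _ tf.
have M0 : 0 <= M := le_trans (normr_ge0 _) (fM 0).
have mpsi := continuous_measurable_rv3 _ (test_function_continuous _ _ tf).
have mdpsi := continuous_measurable_rv3 _ (test_function_continuous _ _ tf').
pose B : set (R3 R) := rv3 @^-1` eball r.
have mB : measurable B := @eball_measurable R r.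
have r1 : 0 <= `|r| + 1 by rewrite addr_ge0.
have psi0 y : r <= enorm y -> psi y = 0.
  by move=> ry; apply: test_function_out tf _; rewrite /eball/= ltNge ry.
have h1 n : n.+1%:R^-1 <= 1 :> R by rewrite invf_le1 ?ler1n.
have hn n : n.+1%:R * n.+1%:R^-1 = 1 :> R by rewrite mulfV.
pose v n : 'rV[R]_3 := n.+1%:R^-1 *: e.
have vn n : enorm (v n) <= 1.
  by rewrite enormZ enorm_delta mulr1 ger0_norm.
(* A forward shift of [f] goes with a backward shift of [psi], so the derivative of [psi] is reached
   through the negative steps [- n.+1%:R^-1]. *)
pose s n := shift3 (v n); pose t n := shift3 (- v n).
have sE n p : rv3 (s n p) = n.+1%:R^-1 *: delta_mx 0 i + rv3 p.
  by rewrite rv3_shift3 addrC.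
have ms n : measurable_fun setT (s n) by exact: measurable_shift3.
have mt n : measurable_fun setT (t n) by exact: measurable_shift3.
have psit0 n p : ~ cube 0 (`|r| + 1) p -> psi (rv3 (t n p)) = 0.
  move=> /out_cube pr; rewrite psi0// rv3_shift3.
  have := ler_enormD (rv3 p - v n) (v n); rewrite subrK; have := vn n; lra.
have psip0 p : ~ cube 0 (`|r| + 1) p -> psi (rv3 p) = 0.
  by move=> /out_cube pr; rewrite psi0//; lra.
have mpsit n : measurable_fun setT ((psi \o rv3) \o t n) by exact: (measurableT_comp mpsi (mt n)).
have key : \int[leb3]_p (f (rv3 p) * 'D_e psi (rv3 p)) =
    - \int[leb3]_p (g (rv3 p) * psi (rv3 p)).
  apply: (@difference_quotient_by_parts _ _ _ _ s t (fun n => n.+1%:R) (f \o rv3)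
    (g \o rv3) (psi \o rv3) (fun p => 'D_e psi (rv3 p))
    (fun p => M * K * \1_(cube 0 (`|r| + 1)) p)
    ((fun p => H (rv3 p) * K') \_ B) N) => //.
  - by move=> n A mA; exact: leb3_shift.
  - move=> n p; rewrite /t /s /shift3/= /shift2 /shift1/= !mxE.
    by case: p => -[p1 p2] p3 /=; rewrite !addrK.
  - apply: (bounded_support_integrable (M * K') _ _ r1).
    + exact: measurable_funM.
    + by move=> p /=; rewrite normrM ler_pM.
    + by move=> p pc /=; rewrite psip0// mulr0.
  - move=> n; apply: (bounded_support_integrable (M * K') _ _ r1).
    + exact: measurable_funM.
    + by move=> p /=; rewrite normrM ler_pM.
    + by move=> p pc /=; rewrite psit0// mulr0.
  - exact: cube_indic_integrable.
  - rewrite -restrict_EFin; apply: (integrable_mkcond _ mB).1.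
    have := integrableZr mB K' iH; apply: eq_integrable => //.
  - move=> n p /=; rewrite indicE; have [pc|pc] := boolP (p \in cube 0 (`|r| + 1)).
      rewrite mulr1 normrM ler_pM// normrM.
      have := psiK (rv3 (t n p)) n.+1%:R^-1.
      have -> : n.+1%:R^-1 *: delta_mx 0 i + rv3 (t n p) = rv3 p.
        by rewrite rv3_shift3 addrC subrK.
      rewrite (gtr0_norm (_ : 0 < n.+1%:R^-1)) ?invr_gt0//.
      by rewrite ler_pdivlMr// mulrC normr_nat.
    have pc' : ~ cube 0 (`|r| + 1) p by move: pc; rewrite notin_setE.
    by rewrite psip0// psit0// subrr !mulr0 normr0.
  - move=> p /=.
    have [cv ->] : derivable psi (rv3 p) e /\ 'D_e psi (rv3 p) =
       lim ((fun h => h^-1 *: ((psi \o shift (rv3 p)) (h *: e) - psi (rv3 p))) @ 0^').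
      by split => //; exact: test_function_derivable tf.
    have -> : (fun n => n.+1%:R * (psi (rv3 p) - psi (rv3 (t n p)))) =
       (fun h : R => h^-1 *: ((psi \o shift (rv3 p)) (h *: e) - psi (rv3 p))) \o
       (fun n => - n.+1%:R^-1).
      apply/funext => n /=; rewrite invrN invrK.
      have -> : - n.+1%:R^-1 *: e + rv3 p = rv3 (t n p).
        by rewrite rv3_shift3 scaleNr addrC.
      by rewrite /GRing.scale/=; ring.
    apply: (cvg_comp _ _ _ cv) => A; rewrite /= => -[eps /= eps0 epsA].
    have : \forall n \near \oo, (n.+1%:R^-1 : R) < eps.
      exact: near_infty_natSinv_lt (PosNum eps0).
    apply: filterS => n ne; apply: epsA => /=.
      by rewrite sub0r opprK ger0_norm.
    by rewrite oppr_eq0 invr_eq0.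
  - move=> n p Np /=; rewrite /patch; case: ifPn => [|/negP]; rewrite inE => pB.
      by rewrite normrM ler_pM// sE; exact: dom.
    rewrite psi0 ?mulr0 ?normr0// leNgt; apply/negP; exact: pB.
  - move=> p Np /=; have [pB|pB] := pselect (B p).
      apply: cvgM; last exact: cvg_cst.
      have -> : (fun n => n.+1%:R * (f (rv3 (s n p)) - f (rv3 p))) =
        (fun n => n.+1%:R * (f (n.+1%:R^-1 *: delta_mx 0 i + rv3 p) - f (rv3 p))).
        by apply/funext => n; rewrite sE.
      exact: cvg.
    rewrite psi0 ?leNgt; last by apply/negP; exact: pB.
    by rewrite mulr0; under eq_fun do rewrite mulr0; exact: cvg_cst.
rewrite expr1 mulN1r.
rewrite (Rintegral_support _ _ _ leb3 B (fun p => f (rv3 p) * 'D_e psi (rv3 p))).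
  rewrite (Rintegral_support _ _ _ leb3 B (fun p => g (rv3 p) * psi (rv3 p))).
    exact: key.
  by move=> p pB; rewrite (test_function_out _ _ _ tf pB) mulr0.
by move=> p pB; rewrite (test_function_out _ _ _ tf' pB) mulr0.
Qed.

End WeakDerivative.

Section Auxiliary.
Context {R : realType}.

Lemma is_derive_quotient_cvg (f : 'rV[R]_3 -> R) (y e : 'rV[R]_3) (l : R) :
  is_derive y e f l ->
  n.+1%:R * (f (n.+1%:R^-1 *: e + y) - f y) @[n --> \oo] --> l.
Proof.
move=> [cv <-].
have -> : (fun n => n.+1%:R * (f (n.+1%:R^-1 *: e + y) - f y)) =
   (fun h : R => h^-1 *: ((f \o shift y) (h *: e) - f y)) \o (fun n => n.+1%:R^-1).
  by apply/funext => n /=; rewrite invrK.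
apply: (cvg_comp _ _ _ cv) => A; rewrite /= => -[eps /= eps0 epsA].
have : \forall n \near \oo, (n.+1%:R^-1 : R) < eps.
  exact: near_infty_natSinv_lt (PosNum eps0).
apply: filterS => n ne; apply: epsA => /=.
  by rewrite sub0r normrN ger0_norm.
by rewrite invr_eq0.
Qed.

(** In [partials [:: k; j] psi] the derivative in [j] is taken first. The hypothesis on [f] is
    applied to the test function so obtained, the one on [g] to [psi], and the two signs cancel. *)
Lemma weak_derivative_trans (B : set 'rV[R]_3) k j (f g h : 'rV[R]_3 -> R) :
  weak_derivative B [:: k] f g -> weak_derivative B [:: j] g h ->
  weak_derivative B [:: k; j] f h.
Proof.
move=> fg gh psi tf.
have := fg _ (test_function_derive _ _ j tf); rewrite /partials/= => ->.
have := gh _ tf; rewrite /partials/= => ->.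
by rewrite !expr1 mulN1r mulN1r opprK sqrrN expr1n mul1r.
Qed.

Lemma weak_derivative_nil (B : set 'rV[R]_3) (f : 'rV[R]_3 -> R) :
  weak_derivative B [::] f f.
Proof. by move=> psi tf; rewrite expr0 mul1r. Qed.

Lemma cst_ball_integrable (r C : R) :
  leb3.-integrable (rv3 @^-1` eball r) (EFin \o (fun _ : R3 R => C)).
Proof.
apply: measurable_bounded_integrable => //.
- exact: eball_measurable.
- exact: leb3_eball_lty.
- by exists `|C|; split => // M CM p _ /=; rewrite ltW.
Qed.

Lemma inverse_square_ball_integrable (r : R) (c : 'rV[R]_3) :
  leb3.-integrable (rv3 @^-1` eball r)
    (EFin \o (fun p : R3 R => (enorm (rv3 p - c))^-1 ^+ 2)).
Proof.
have mB := @eball_measurable R r.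
pose rho := `|r| + enorm c + 1.
have rho0 : 0 < rho by rewrite ltr_wpDl// addr_ge0// enorm_ge0.
have mc := @cube_measurable R c rho.
have mh : measurable_fun [set: R3 R] (fun p => (enorm (rv3 p - c))^-1 ^+ 2).
  by apply: measurable_funX; exact: measurable_inv_dist.
apply: (@integrableS _ _ _ _ (cube c rho)) => //.
  move=> p; rewrite /eball/= => pr; apply: sub_ball_cube => /=.
  rewrite (le_trans (ler_enormB _ _))// /rho.
  by have := ler_norm r; lra.
apply/integrableP; split; first by apply/measurable_EFinP; exact: measurable_funTS.
apply: le_lt_trans (inverse_square_integral c rho rho0).
rewrite le_eqVlt; apply/orP; left; apply/eqP; apply: eq_integral => p _.
by rewrite gee0_abs// lee_fin sqr_ge0.
Qed.

(** The extra point puts the delay 0 on the same footing as the exceptional times. Indices outside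
    the range of the injection take the default value 0, which is harmless since the sequence only
    has to cover. *)
Lemma countable_sequence (A : set R) (x : R) : countable A ->
  exists a : nat -> R, A `|` [set x] `<=` range a.
Proof.
move=> /countable_injP[f finj].
exists (fun n => if n is m.+1 then xget 0 [set s | A s /\ f s = m] else x).
move=> s [As|->]; last by exists 0%N.
exists (f s).+1 => //.
have [As' fs'] := @xgetI _ 0 [set s' | A s' /\ f s' = f s] s (conj As erefl).
by apply: finj; rewrite ?inE.
Qed.

End Auxiliary.

Section DelayMeasurable.
Context {R : realType} (k : R) (p u : R -> 'rV[R]_3).
Hypothesis k0 : 0 <= k.
Hypothesis k1 : k < 1.
Hypothesis plip : lipschitz3 k p.
Hypothesis mu : forall i, measurable_fun [set: R] (fun s => u s 0 i).

Lemma lipschitz3_coord_continuous i : continuous (fun s => p s 0 i).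
Proof.
move=> s; apply/cvgrPdist_lt => e e0.
have : nbhs s (ball s e) by exact: nbhsx_ballx.
apply: filterS => s'; rewrite -ball_normE /ball_/=; apply: le_lt_trans.
have -> : p s 0 i - p s' 0 i = (p s - p s') 0 i by rewrite !mxE.
rewrite (le_trans (ler_coord_enorm _ _))// (le_trans (plip _ _))//.
by rewrite ler_piMl// ltW.
Qed.

Lemma dly_continuous : continuous (dly p).
Proof.
have kk := k1; have c1 := inv1Bk_ge1 k k0 k1.
move=> y A /nbhs_ballP[e /= e0 eA].
have h := enorm_sub_continuous y y.
have r0 : 0 < e / (1 - k)^-1 by rewrite divr_gt0//; lra.
have /nbhs_ballP[d d0 dP] := h _ (nbhsx_ballx (enorm (y - y)) _ r0).
apply/nbhs_ballP; exists d => // z /dP /=.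
rewrite -ball_normE /ball_/= subrr enorm0 sub0r normrN ger0_norm ?enorm_ge0//.
rewrite ltr_pdivlMr; last lra.
move=> zr; apply: eA; rewrite -ball_normE /ball_/=; apply: le_lt_trans zr.
by rewrite mulrC enormBC; exact: (dly_lip k p k0 k1 plip).
Qed.

Lemma measurable_dly : measurable_fun [set: R3 R] (dly p \o rv3).
Proof. exact: (continuous_measurable_rv3 _ dly_continuous). Qed.

Lemma measurable_dgrad j : measurable_fun [set: R3 R] (fun x : R3 R => dgrad p u (rv3 x) 0 j).
Proof.
have md := measurable_dly.
have mdu i : measurable_fun [set: R3 R] (fun x : R3 R => u (dly p (rv3 x)) 0 i).
  exact: (measurableT_comp (mu i) md).
have mdp i : measurable_fun [set: R3 R] (fun x : R3 R => p (dly p (rv3 x)) 0 i).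
  exact: (measurableT_comp (continuous_measurable_fun (lipschitz3_coord_continuous i)) md).
have mdd i : measurable_fun [set: R3 R] (fun x : R3 R => (rv3 x - p (dly p (rv3 x))) 0 i).
  have -> : (fun x : R3 R => (rv3 x - p (dly p (rv3 x))) 0 i) =
      (fun x => rv3 x 0 i - p (dly p (rv3 x)) 0 i) by apply/funext => x; rewrite !mxE.
  by apply: measurable_funB => //; exact: measurable_rv3.
have mM i : measurable_fun [set: R3 R]
    (fun x : R3 R => (rv3 x - p (dly p (rv3 x))) 0 i * u (dly p (rv3 x)) 0 i).
  exact: measurable_funM.
have -> : (fun x : R3 R => dgrad p u (rv3 x) 0 j) =
  (fun x => (dly p (rv3 x) + ((rv3 x - p (dly p (rv3 x))) 0 0 * u (dly p (rv3 x)) 0 0 +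
     (rv3 x - p (dly p (rv3 x))) 0 1 * u (dly p (rv3 x)) 0 1 +
     (rv3 x - p (dly p (rv3 x))) 0 2 * u (dly p (rv3 x)) 0 2))^-1 *
     (rv3 x - p (dly p (rv3 x))) 0 j).
  by apply/funext => x; rewrite /dgrad mxE dotE.
apply: measurable_funM => //; apply: (measurableT_comp (measurable_invr R)).
by apply: measurable_funD => //; apply: measurable_funD => //; exact: measurable_funD.
Qed.

(** Reading the comparison lemmas in both directions, the level set is the Euclidean sphere of
    centre [p s] and radius [s]. *)
Lemma level_set_null s :
  measurable [set x : R3 R | dly p (rv3 x) = s] /\
  leb3 [set x : R3 R | dly p (rv3 x) = s] = 0%E.
Proof.
suff -> : [set x : R3 R | dly p (rv3 x) = s] = [set x | enorm (rv3 x - p s) = s].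
  exact: leb3_sphere.
apply/seteqP; split => x /=; first by move=> <-; rewrite (dlyE k).
move=> e; apply/eqP; rewrite eq_le (dly_leE k)// (dly_geE k)//.
by rewrite e lexx.
Qed.

End DelayMeasurable.

(** * Differences of delays *)

Lemma measure_bigcup_null d (T : measurableType d) (R : realType)
    (m : {measure set T -> \bar R}) (F : (set T)^nat) :
  (forall n, measurable (F n)) -> (forall n, m (F n) = 0%E) ->
  m (\bigcup_n F n) = 0%E.
Proof.
move=> mF F0; apply: measure_negligible; first exact: bigcupT_measurable.
by apply: negligible_bigcup => n; apply: (negligibleP _ (mF n)).2; exact: F0.
Qed.

Definition regular_at {R : realType} (p u : R -> 'rV[R]_3) (s : R) : Prop :=
  forall i, is_derive s 1 (fun x => p x 0 i) (u s 0 i) /\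
            derivable (fun x => u x 0 i) s 1.

Section Sobolev.
Context {R : realType} (k L M r : R) (p q u v : R -> 'rV[R]_3) (Z A : set R).
Hypothesis k0 : 0 <= k.
Hypothesis k1 : k < 1.
Hypothesis L0 : 0 <= L.
Hypothesis plip : lipschitz3 k p.
Hypothesis qlip : lipschitz3 k q.
Hypothesis uk : forall s, enorm (u s) <= k.
Hypothesis vk : forall s, enorm (v s) <= k.
Hypothesis ulip : forall s s', s <= s' -> (forall z, Z z -> ~ s <= z <= s') ->
  enorm (u s - u s') <= L * `|s - s'|.
Hypothesis wlip : lipschitz3 L (v \- u).
Hypothesis Zpos : forall s, Z s -> p s = q s.
Hypothesis Zvel : forall s, Z s -> u s = v s.
Hypothesis mu : forall i, measurable_fun [set: R] (fun s => u s 0 i).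
Hypothesis mv : forall i, measurable_fun [set: R] (fun s => v s 0 i).
Hypothesis cA : countable A.
Hypothesis pA : forall s, ~ A s -> regular_at p u s.
Hypothesis qA : forall s, ~ A s -> regular_at q v s.
Hypothesis pqM : forall s s', enorm (p s - q s') <= M.
Implicit Types y : 'rV[R]_3.

Let c := (1 - k)^-1.
Let c1 : 1 <= c. Proof. exact: inv1Bk_ge1. Qed.

Let Delta y := dly p y - dly q y.
Let G i y := (dgrad p u y - dgrad q v y) 0 i.
Let e i : 'rV[R]_3 := delta_mx 0 i.

Let GE i y : G i y = dgrad p u y 0 i - dgrad q v y 0 i.
Proof. by rewrite /G !mxE. Qed.

(** A countable union of level sets of the two delays, over a sequence of values that covers [A] and
    also 0, where the gradient formula is singular. *)
Lemma exists_null_set : exists N : set 'rV[R]_3,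
  [/\ measurable ((rv3 : R3 R -> _) @^-1` N), leb3 ((rv3 : R3 R -> _) @^-1` N) = 0%E &
      forall y, ~ N y ->
        [/\ 0 < dly p y, 0 < dly q y, ~ A (dly p y) & ~ A (dly q y)]].
Proof.
have [a Aa] : exists a : nat -> R, A `|` [set 0] `<=` range a.
  exact: countable_sequence.
pose N n := [set y | dly p y = a n] `|` [set y | dly q y = a n].
have np n := level_set_null k p k0 k1 plip (a n).
have nq n := level_set_null k q k0 k1 qlip (a n).
have mN n : measurable ((rv3 : R3 R -> _) @^-1` N n).
  exact: measurableU (np n).1 (nq n).1.
have N0 n : leb3 ((rv3 : R3 R -> _) @^-1` N n) = 0%E.
  exact: null_set_setU (np n).1 (nq n).1 (np n).2 (nq n).2.
exists (\bigcup_n N n); rewrite preimage_bigcup; split.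
- exact: bigcupT_measurable.
- exact: measure_bigcup_null mN N0.
move=> y Ny.
have AN s : (A `|` [set 0]) s -> dly p y <> s /\ dly q y <> s.
  by move=> /Aa [n _ <-]; split => h; apply: Ny; exists n => //; [left|right].
have [p0 q0] := AN 0 (or_intror erefl).
split; first by rewrite lt_def (dly_ge0 k)// andbT; apply/eqP.
- by rewrite lt_def (dly_ge0 k)// andbT; apply/eqP.
- by move=> h; have [] := AN _ (or_introl h).
- by move=> h; have [] := AN _ (or_introl h).
Qed.

Lemma Delta_is_derive y i : 0 < dly p y -> 0 < dly q y ->
  ~ A (dly p y) -> ~ A (dly q y) -> is_derive y (e i) Delta (G i y).
Proof.
move=> py qy pAy qAy.
have dotw (w : 'rV[R]_3) : dot w (e i) = w 0 i.
  rewrite /dot (bigD1 i)//= big1 ?addr0; first by rewrite mxE !eqxx mulr1.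
  by move=> j ji; rewrite mxE (negbTE ji) andbF mulr0.
have dp := dly_is_derive k p u k0 k1 plip uk y (e i) py (fun j => (pA _ pAy j).1).
have dq := dly_is_derive k q v k0 k1 qlip vk y (e i) qy (fun j => (qA _ qAy j).1).
by have := is_deriveB dp dq; rewrite !dotw GE.
Qed.

Lemma G_derivable y i j : 0 < dly p y -> 0 < dly q y ->
  ~ A (dly p y) -> ~ A (dly q y) -> derivable (G i) y (e j).
Proof.
move=> py qy pAy qAy.
have dp := dgrad_derivable k p u k0 k1 plip uk y (e j) i py
   (fun l => (pA _ pAy l).1) (fun l => (pA _ pAy l).2).
have dq := dgrad_derivable k q v k0 k1 qlip vk y (e j) i qy
   (fun l => (qA _ qAy l).1) (fun l => (qA _ qAy l).2).
rewrite (_ : G i = (fun z => dgrad p u z 0 i) - (fun z => dgrad q v z 0 i)).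
  exact: derivableB.
by apply/funext => z; rewrite GE.
Qed.

(** Each delay is the distance from [y] to a delayed position, so the two differ by at most the
    distance between these positions, however large the delays are. *)
Lemma Delta_bound y : `|Delta y| <= M.
Proof.
have ep := dlyE k p k0 k1 plip y; have eq := dlyE k q k0 k1 qlip y.
rewrite /Delta -{1}ep -{1}eq (le_trans (ler_dist_enorm _ _))// subBB enormBC.
exact: pqM.
Qed.

Lemma G_bound y i : `|G i y| <= 2 * c.
Proof.
rewrite (le_trans (ler_coord_enorm _ _))// (le_trans (ler_enormB _ _))//.
have := dgrad_bound k k0 k1 p u y plip uk; have := dgrad_bound k k0 k1 q v y qlip vk.
rewrite -/c; lra.
Qed.

Lemma measurable_Delta : measurable_fun [set: R3 R] (Delta \o rv3).
Proof.
by apply: measurable_funB; [exact: (measurable_dly k)|exact: (measurable_dly k)].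
Qed.

Lemma measurable_G i : measurable_fun [set: R3 R] (G i \o rv3).
Proof.
have -> : G i \o rv3 = (fun x => dgrad p u (rv3 x) 0 i) \- (fun x => dgrad q v (rv3 x) 0 i).
  by apply/funext => x; rewrite /= GE.
by apply: measurable_funB; [exact: (measurable_dgrad k)|exact: (measurable_dgrad k)].
Qed.

Lemma Delta_quotient_le y i n :
  `|n.+1%:R * (Delta (n.+1%:R^-1 *: e i + y) - Delta y)| <= 2 * c.
Proof.
set z := _ + y.
have zy : enorm (z - y) = n.+1%:R^-1.
  by rewrite /z addrK enormZ enorm_delta mulr1 ger0_norm.
have hp := dly_lip k p k0 k1 plip z y; have hq := dly_lip k q k0 k1 qlip z y.
rewrite zy -/c in hp hq.
have n0 : 0 < n.+1%:R :> R by rewrite ltr0n.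
rewrite normrM (gtr0_norm n0) mulrC -ler_pdivlMr//.
have -> : Delta z - Delta y = (dly p z - dly p y) - (dly q z - dly q y).
  by rewrite /Delta; ring.
rewrite (le_trans (ler_normB _ _))//.
by move: hp hq; move: (n.+1%:R^-1 : R) => m; lra.
Qed.

Lemma Delta_weak_derivative i : weak_derivative (eball r) [:: i] Delta (G i).
Proof.
have [N [mN N0 NP]] := exists_null_set.
apply: (@weak_derivative_difference_quotient _ r i Delta (G i) (fun=> 2 * c) M
    (rv3 @^-1` N)) => //.
- exact: measurable_Delta.
- exact: measurable_G.
- exact: Delta_bound.
- exact: cst_ball_integrable.
- by move=> x n _ _; exact: Delta_quotient_le.
- move=> x Nx _; have [p0 q0 Ap Aq] := NP _ Nx.
  by apply: is_derive_quotient_cvg; exact: Delta_is_derive.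
Qed.

Lemma second_weak_derivative i j : exists2 g, in_L2 (eball r) g &
  weak_derivative (eball r) [:: j] (G i) g.
Proof.
have [N [mN N0 NP]] := exists_null_set.
have [C C0 GC] := dgrad_diff_lip k L p q u v Z k0 k1 L0 plip qlip uk vk ulip wlip Zpos Zvel.
(* [H] dominates the difference quotients: it is the local Lipschitz constant of the gradients with
   [2 / enorm (y - p 0)] in place of [1 / dly p y]. [H2] bounds its square; 12 is 3, for a sum of
   three terms, times the 4 from squaring the 2. *)
pose H y := C * (1 + 2 * (enorm (y - p 0))^-1 + 2 * (enorm (y - q 0))^-1).
pose H2 y := 12 * C ^+ 2 * (1 + (enorm (y - p 0))^-1 ^+ 2 + (enorm (y - q 0))^-1 ^+ 2).
(* With the value 0 on [N], [g] is bounded by [H] everywhere and is everywhere a limit of measurable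
   functions, namely the quotients cut off on [N]. *)
pose g y : R := if y \in N then 0 else 'D_(e j) (G i) y.
have i0 y z : 0 <= (enorm (y - z))^-1 :> R by rewrite invr_ge0 enorm_ge0.
have H0 y : 0 <= H y by rewrite /H mulr_ge0// !addr_ge0// mulr_ge0.
have quot y n : ~ N y ->
    `|n.+1%:R * (G i (n.+1%:R^-1 *: e j + y) - G i y)| <= H y.
  move=> Ny; have [p0 q0 Ap Aq] := NP _ Ny.
  set z := _ + y.
  have zy : enorm (y - z) = n.+1%:R^-1.
    by rewrite enormBC /z addrK enormZ enorm_delta mulr1 ger0_norm.
  have n0 : 0 < n.+1%:R :> R by rewrite ltr0n.
  rewrite normrM (gtr0_norm n0) mulrC -ler_pdivlMr// -zy.
  have -> : `|G i z - G i y| = `|((dgrad p u y - dgrad q v y) -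
      (dgrad p u z - dgrad q v z)) 0 i|.
    by rewrite distrC /G !mxE.
  rewrite (le_trans (ler_coord_enorm _ _))// (le_trans (GC y z p0 q0))//.
  apply: ler_wpM2r; first exact: enorm_ge0.
  have inv2 (f : R -> 'rV[R]_3) : lipschitz3 k f -> 0 < dly f y ->
      enorm (y - f 0) != 0 -> (dly f y)^-1 <= 2 * (enorm (y - f 0))^-1.
    move=> fl fy f0; have := dly_ge_dist k f k0 k1 fl y => h.
    have f00 : 0 < enorm (y - f 0) by rewrite lt_def f0 enorm_ge0.
    rewrite -ler_pdivrMl//; last first.
    rewrite -invfM lef_pV2 ?posrE ?mulr_gt0//.
  (* A positive delay keeps [y] away from [f 0], where the convention [0^-1 = 0] would falsify the
     comparison of inverses. *)
  have dist0 (f : R -> 'rV[R]_3) : lipschitz3 k f -> 0 < dly f y -> enorm (y - f 0) != 0.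
    move=> fl fy; apply/eqP => h; move: fy; apply/negP; rewrite -leNgt.
    by rewrite (dly_leE k)// h.
  rewrite /H; apply: ler_wpM2l => //.
  have h1 := inv2 p plip p0 (dist0 p plip p0); have h2 := inv2 q qlip q0 (dist0 q qlip q0).
  lra.
have cvgq y : ~ N y ->
    n.+1%:R * (G i (n.+1%:R^-1 *: e j + y) - G i y) @[n --> \oo] --> g y.
  move=> Ny; have [p0 q0 Ap Aq] := NP _ Ny.
  rewrite /g memNset//; apply: is_derive_quotient_cvg.
  by split => //; exact: G_derivable.
have gH y : `|g y| <= H y.
  have [Ny|Ny] := pselect (N y); first by rewrite /g mem_set// normr0.
  have cn : `|n.+1%:R * (G i (n.+1%:R^-1 *: e j + y) - G i y)| @[n --> \oo] --> `|g y|.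
    by apply: cvg_norm; exact: cvgq.
  by apply: (cvgr_to_le cn); apply: nearW => n; exact: quot.
have mg : measurable_fun [set: R3 R] (g \o rv3).
  apply: (@measurable_fun_cvg _ _ _ setT (fun n (x : R3 R) =>
    \1_(~` (rv3 @^-1` N)) x * (n.+1%:R * ((G i \o rv3) (shift3 (n.+1%:R^-1 *: e j) x) - (G i \o rv3) x)))).
    move=> n; apply: measurable_funM.
      by apply: measurable_indic; exact: measurableC.
    apply: measurable_funM => //; apply: measurable_funB; last exact: measurable_G.
    by apply: (measurableT_comp (measurable_G i)); exact: measurable_shift3.
  move=> x _; rewrite /= indicE.
  have [Nx|Nx] := pselect (N (rv3 x)).
    rewrite memNset; last by move=> /(_ Nx).
    by under eq_fun do rewrite mul0r; rewrite /g mem_set//; exact: cvg_cst.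
  rewrite mem_set//; under eq_fun do rewrite mul1r rv3_shift3 (addrC (rv3 x)).
  exact: cvgq.
have iH2 : leb3.-integrable (rv3 @^-1` eball r) (EFin \o (fun x : R3 R => H2 (rv3 x))).
  have mB := @eball_measurable R r.
  have i1 := cst_ball_integrable r 1.
  have ip := inverse_square_ball_integrable r (p 0).
  have iq := inverse_square_ball_integrable r (q 0).
  exact: (integrableZl mB (12 * C ^+ 2) (integrableD mB (integrableD mB i1 ip) iq)).
have HH2 y : H y ^+ 2 <= H2 y.
  rewrite /H /H2; move: (i0 y (p 0)) (i0 y (q 0)).
  move: (enorm (y - p 0))^-1 (enorm (y - q 0))^-1 => a b a0 b0.
  suff h : (1 + 2 * a + 2 * b) ^+ 2 <= 12 * (1 + a ^+ 2 + b ^+ 2).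
    by have := ler_wpM2l (sqr_ge0 C) h; rewrite -exprMn mulrCA mulrA.
  have := sqr_ge0 (1 - 2 * a); have := sqr_ge0 (1 - 2 * b); have := sqr_ge0 (a - b); lra.
exists g.
  apply: (@in_L2_le _ r g H2) => // y _.
  by rewrite (le_trans _ (HH2 y))// -[g y ^+ 2]real_normK ?num_real// ler_sqr ?nnegrE.
apply: (@weak_derivative_difference_quotient _ r j (G i) g H (2 * c)
    (rv3 @^-1` N)) => //.
- exact: measurable_G.
- by move=> y; exact: G_bound.
- have mB := @eball_measurable R r.
  (* The inequalities [H <= 1 + H ^+ 2 <= 1 + H2] make [H] itself integrable on the ball. *)
  have i3 := integrableD mB (cst_ball_integrable r 1) iH2.
  apply: le_integrable i3 => //.
    apply/measurable_EFinP; apply: measurable_funTS.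
    apply: measurable_funM => //; apply: measurable_funD; [apply: measurable_funD|] => //;
      by apply: measurable_funM => //; exact: measurable_inv_dist.
  move=> x _ /=; rewrite lee_fin ger0_norm// ger0_norm; last first.
    by rewrite addr_ge0// (le_trans _ (HH2 _))// sqr_ge0.
  have := HH2 (rv3 x); have := sqr_ge0 (1 - H (rv3 x)); have := sqr_ge0 (H (rv3 x)); lra.
- by move=> x n Nx _; exact: quot.
- by move=> x Nx _; exact: cvgq.
Qed.

(** Orders 0 and 1 are bounded, hence square integrable on the ball; the inverse square enters at
    order 2 only. *)
Lemma delay_difference_sobolev : sobolev2 2 (eball r) Delta.
Proof.
have L2D : in_L2 (eball r) Delta.
  apply: (@in_L2_le _ r Delta (fun=> M ^+ 2)); [exact: measurable_Delta|
    exact: cst_ball_integrable|move=> y _].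
  have M0 : 0 <= M := le_trans (enorm_ge0 _) (pqM 0 0).
  by rewrite -[Delta y ^+ 2]real_normK ?num_real// ler_sqr ?nnegrE//; exact: Delta_bound.
split => // -[|i [|j [|//]]] _.
- by exists Delta => //; exact: weak_derivative_nil.
- exists (G i); last exact: Delta_weak_derivative.
  apply: (@in_L2_le _ r (G i) (fun=> (2 * c) ^+ 2)); [exact: measurable_G|
    exact: cst_ball_integrable|move=> y _].
  rewrite -[G i y ^+ 2]real_normK ?num_real// ler_sqr ?nnegrE//; first exact: G_bound.
  by rewrite mulr_ge0// (le_trans _ c1).
have [g gL2 wg] := second_weak_derivative i j.
by exists g => //; apply: weak_derivative_trans wg; exact: Delta_weak_derivative.
Qed.

End Sobolev.

(** * Piecewise smooth trajectories *)

Section OneSided.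
Context {R : realType}.
Implicit Types (P : R -> Prop) (t : R).

Lemma at_right_delta P t : (\forall s \near t^'+, P s) ->
  exists2 d, 0 < d & forall s, t < s -> s < t + d -> P s.
Proof.
move=> [d /= d0 dP]; exists d => // s ts sd; apply: dP => //=.
by rewrite distrC gtr0_norm ?subr_gt0// ltrBlDr addrC.
Qed.

Lemma at_left_delta P t : (\forall s \near t^'-, P s) ->
  exists2 d, 0 < d & forall s, s < t -> t - d < s -> P s.
Proof.
move=> [d /= d0 dP]; exists d => // s ts sd; apply: dP => //=.
by rewrite gtr0_norm ?subr_gt0// ltrBlDr addrC -ltrBlDr.
Qed.

Lemma near_right P t (d : R) : 0 < d -> (forall s, t < s -> s < t + d -> P s) ->
  \forall s \near t^'+, P s.
Proof.
move=> d0 dP; exists d => // s /=; rewrite distrC => sd ts; apply: dP => //.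
by move: sd; rewrite gtr0_norm ?subr_gt0// ltrBlDr addrC.
Qed.

Lemma near_left P t (d : R) : 0 < d -> (forall s, s < t -> t - d < s -> P s) ->
  \forall s \near t^'-, P s.
Proof.
move=> d0 dP; exists d => // s /= sd ts; apply: dP => //.
by move: sd; rewrite gtr0_norm ?subr_gt0// ltrBlDr addrC -ltrBlDr.
Qed.

Lemma near_dnbhs_sides P t : (\forall s \near t^', P s) ->
  (\forall s \near t^'-, P s) /\ (\forall s \near t^'+, P s).
Proof.
move=> [d /= d0 dP]; split; exists d => //= s sd st; apply: dP => //=.
  by rewrite lt_eqF.
by rewrite gt_eqF.
Qed.

Lemma near_sides P t : P t -> (\forall s \near t^'-, P s) ->
  (\forall s \near t^'+, P s) -> \forall s \near t, P s.
Proof.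
move=> Pt [d1 /= d10 P1] [d2 /= d20 P2].
apply/nbhs_ballP; exists (Num.min d1 d2) => /=; first by rewrite lt_min d10.
move=> s; rewrite -ball_normE /ball_/= lt_min => /andP[s1 s2].
by have [st|ts|->//] := ltgtP s t; [apply: P1|apply: P2].
Qed.

Lemma finite_near_dnbhs (F : set R) t : finite_set F -> \forall s \near t^', ~ F s.
Proof.
move=> fF; have : nbhs t (~` (F `\ t)).
  apply: open_nbhs_nbhs; split; last by move=> [_]; apply.
  apply: closed_openC; apply: (accessible_finite_set_closed.1 _ _ (finite_setD _ fF)).
  by apply: hausdorff_accessible; exact: Rhausdorff.
rewrite near_withinE; apply: filterS => s h st Fs.
by apply: h; split => // e; move: st; rewrite e eqxx.
Qed.

End OneSided.

(** * Mean value inequalities for curves in space *)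

Section VectorCurves.
Context {R : realType}.
Implicit Types (f x : R -> 'rV[R]_3).

Lemma coord_cvg {T} {F : set_system T} {FF : Filter F} (g : T -> 'rV[R]_3) (l : 'rV[R]_3) i :
  g @ F --> l -> (fun s => g s 0 i) @ F --> l 0 i.
Proof.
move=> gl.
have h := @coord_continuous R 1 3 0 i l.
exact: (cvg_comp _ _ gl h).
Qed.

Lemma rv3_cvg {T} {F : set_system T} {FF : Filter F} (g : T -> 'rV[R]_3) (l : 'rV[R]_3) :
  (forall e, 0 < e -> \forall s \near F, enorm (g s - l) <= e) -> g @ F --> l.
Proof.
move=> h; apply/cvgrPdist_lt => e e0.
have e2 : 0 < e / 2 by rewrite divr_gt0.
apply: filterS (h _ e2) => s se.
rewrite [ltLHS]/Num.norm/= mx_normrE; apply/bigmax_ltP; split => // -[i j] _ /=.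
rewrite (ord1 i) -normrN; have := ler_coord_enorm (g s - l) j; rewrite !mxE => h'.
by rewrite opprB; lra.
Qed.

Lemma enorm_cvg {T} {F : set_system T} {FF : Filter F} (g : T -> 'rV[R]_3) (l : 'rV[R]_3) :
  g @ F --> l -> (fun s => enorm (g s - l)) @ F --> 0.
Proof.
move=> gl; have := @cvg_comp _ _ _ g (fun y : 'rV[R]_3 => enorm (y - l)) F (nbhs l) _ gl
  (enorm_sub_continuous l l).
by rewrite subrr enorm0.
Qed.

Lemma enorm_near {T} {F : set_system T} {FF : Filter F} (g : T -> 'rV[R]_3) (l : 'rV[R]_3) e :
  g @ F --> l -> 0 < e -> \forall s \near F, enorm (g s - l) <= e.
Proof.
move=> /enorm_cvg /cvgrPdist_le h e0; apply: filterS (h _ e0) => s.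
by rewrite sub0r normrN ger0_norm ?enorm_ge0.
Qed.

Lemma coord_is_derive x s i : derivable x s 1 ->
  is_derive s 1 (fun r => x r 0 i) (derive1 x s 0 i).
Proof.
move=> dx; have cx : (fun h : R => h^-1 *: ((x \o shift s) (h *: 1) - x s)) @ (0 : R)^' -->
    derive1 x s by rewrite derive1E; exact: dx.
have := @coord_cvg _ _ (dnbhs_filter (0 : R)) _ _ i cx.
have -> : (fun h : R => (h^-1 *: ((x \o shift s) (h *: 1) - x s)) 0 i) =
   (fun h : R => h^-1 *: (((fun r => x r 0 i) \o shift s) (h *: 1) - x s 0 i)).
  by apply/funext => h; rewrite !mxE.
move=> h; split; first by apply/cvg_ex; eexists; exact: h.
exact: (cvg_lim (@Rhausdorff R) h).
Qed.

Lemma derivable1_continuous x s : derivable x s 1 -> {for s, continuous x}.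
Proof. by move/derivable1_diffP; exact: differentiable_continuous. Qed.

(** The scalar mean value theorem is applied to the product of [f] with [w], the very vector to be
    bounded; Cauchy-Schwarz and division by [enorm w] conclude. The reference slope [l] will be 0
    for Lipschitz bounds and a one-sided velocity for differentiability. *)
Lemma vector_mvt f (a b K : R) (l : 'rV[R]_3) : a <= b ->
  (forall s, a < s < b -> derivable f s 1) ->
  (forall s, a < s < b -> enorm (derive1 f s - l) <= K) ->
  (forall i, {within `[a, b], continuous (fun s => f s 0 i)}) ->
  enorm (f b - f a - (b - a) *: l) <= K * (b - a).
Proof.
move=> ab df fK cf; have [ab'|lab] := eqVneq a b.
  by rewrite ab' !subrr scale0r subrr enorm0 mulr0.
have {}ab : a < b by rewrite lt_def eq_sym lab.
set w := f b - f a - (b - a) *: l.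
pose g s := w 0 0 * f s 0 0 + w 0 1 * f s 0 1 + w 0 2 * f s 0 2.
have dg s : s \in `]a, b[ -> is_derive s 1 g (dot w (derive1 f s)).
  rewrite in_itv/= => /df dfs.
  have h i := is_deriveZ (w 0 i) (coord_is_derive f s i dfs).
  have := is_deriveD (is_deriveD (h 0) (h 1)) (h 2).
  by rewrite dotE.
have cg : {within `[a, b], continuous g}.
  have cM i : {within `[a, b], continuous (fun s => w 0 i * f s 0 i)}.
    by move=> s; apply: continuousM; [exact: cst_continuous|exact: cf].
  have cD (f1 f2 : R -> R) : {within `[a, b], continuous f1} ->
      {within `[a, b], continuous f2} -> {within `[a, b], continuous (f1 \+ f2)}.
    by move=> h1 h2 s; apply: continuousD; [exact: h1|exact: h2].
  exact: (cD _ _ (cD _ _ (cM 0) (cM 1)) (cM 2)).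
have [c cab gc] := MVT ab dg cg.
have K0 : enorm (derive1 f c - l) <= K by apply: fK; move: cab; rewrite in_itv.
have wE : enorm w ^+ 2 = g b - g a - (b - a) * dot w l.
  by rewrite enorm_sqr !dotE /g /w !mxE; ring.
have h : enorm w ^+ 2 <= enorm w * (K * (b - a)).
  have -> : enorm w ^+ 2 = dot w (derive1 f c - l) * (b - a).
    by rewrite wE gc dotDr dotNr; ring.
  rewrite mulrA ler_wpM2r ?subr_ge0 ?(ltW ab)//.
  by rewrite (le_trans (ler_dot _ _))// ler_wpM2l// enorm_ge0.
have [w0|w0] := eqVneq (enorm w) 0.
  rewrite w0 mulr_ge0 ?subr_ge0 ?(ltW ab)//.
  exact: le_trans (enorm_ge0 _) K0.
by move: h; rewrite expr2 ler_pM2l// lt_def w0 enorm_ge0.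
Qed.

(** Continuous induction on the supremum [c] of the points where the bound from [a] holds: the local
    estimate at [c] used to the left puts [c] in the set, and used to the right it goes beyond [c]
    unless [c = b]. *)
Lemma local_lipschitz_global f (a b K : R) : a <= b -> 0 <= K ->
  (forall t, a <= t <= b -> exists2 d, 0 < d & forall s, a <= s <= b ->
     `|s - t| < d -> enorm (f s - f t) <= K * `|s - t|) ->
  enorm (f b - f a) <= K * (b - a).
Proof.
move=> ab K0 loc.
pose S := [set s | a <= s <= b /\ enorm (f s - f a) <= K * (s - a)].
have Sa : S a by rewrite /S/= lexx ab !subrr enorm0 mulr0.
have Sub : ubound S b by move=> s [/andP[]].
have hS : has_sup S by split; [exists a|exists b].
pose c := sup S.
have ac : a <= c by exact: (ub_le_sup hS.2).
have cb : c <= b by exact: (ge_sup hS.1).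
have [d d0 dP] := loc c (introT andP (conj ac cb)).
have Sc : S c.
  split; first by rewrite ac.
  have [s Ss sc] := sup_adherent d0 hS.
  have sc' : s <= c by exact: (ub_le_sup hS.2).
  have := dP s Ss.1; rewrite ler0_norm ?subr_le0// opprB ltrBlDr -ltrBlDl => /(_ sc) h.
  have := ler_enormD (f c - f s) (f s - f a); rewrite addrA subrK.
  by rewrite enormBC in h; have := Ss.2; lra.
have [->//|cnb] := eqVneq b c; first by case: Sc.
have {cnb} cb' : c < b by rewrite lt_def cnb.
pose s := Num.min b (c + d / 2).
have cs : c < s by rewrite lt_min cb' ltrDl divr_gt0.
have sb : s <= b by rewrite ge_min lexx.
have sd : s <= c + d / 2 by rewrite ge_min lexx orbT.
have asb : a <= s <= b by rewrite sb (le_trans ac)// ltW.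
have Ss : S s.
  split => //; have := dP s asb; rewrite gtr0_norm ?subr_gt0// => h.
  have {}h := h ltac:(lra).
  have := ler_enormD (f s - f c) (f c - f a); rewrite addrA subrK.
  by have := Sc.2; lra.
by have := ub_le_sup hS.2 Ss; rewrite leNgt -/c cs.
Qed.

End VectorCurves.

Definition D2_at {R : realType} (x : R -> 'rV[R]_3) (t : R) : Prop :=
  \forall s \near t, derivable x s 1 /\ derivable (derive1 x) s 1.

Section Periodic.
Context {R : realType} (T : R).
Hypothesis T0 : 0 < T.

Lemma periodic_derive1 (f : R -> 'rV[R]_3) : Defs.periodic T f ->
  Defs.periodic T (derive1 f) /\
  forall s, derivable f (s + T) 1 = derivable f s 1.
Proof.
move=> per; split => s.
  rewrite /derive1; congr (lim (_ @ 0^')); apply/funext => h.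
  by rewrite addrA !per.
have e : (fun h : R => h^-1 *: ((f \o shift (s + T)) (h *: 1) - f (s + T))) =
    (fun h : R => h^-1 *: ((f \o shift s) (h *: 1) - f s)).
  by apply/funext => h /=; rewrite addrA !per.
by rewrite /derivable e.
Qed.

(** Compactness of one period, then translation by whole periods. The filter [F] runs over candidate
    bounds [K]: left neighbourhoods of 1 for speeds, [+oo] for accelerations. *)
Lemma periodic_covering (F : set_system R) (FF : ProperFilter F) (P : R -> R -> Prop) :
  (forall K t, P K (t + T) = P K t) ->
  (forall t : R, exists Q : R -> Prop, (\forall s \near t, Q s) /\
     \forall K \near F, forall s, Q s -> P K s) ->
  \forall K \near F, forall t, P K t.
Proof.
move=> per loc.
have H := (compact_near_coveringP `[0, T]).1 (@segment_compact R 0 T) R F P _.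
have : \forall K \near F, `[0, T]%classic `<=` P K.
apply: H => t _; have [Q [Qt QK]] := loc t.
  exists (Q, [set K | forall s, Q s -> P K s]); first by split.
  by move=> [s K] [/= Qs]; apply.
apply: filterS => K KP t.
have pern n s : P K (s + n%:R * T) = P K s.
  elim: n s => [|n IH] s; first by rewrite mul0r addr0.
  by rewrite -natr1 mulrDl mul1r addrA per IH.
have [t0|t0] := leP 0 t.
  have /andP[h1 h2] := truncn_itv (divr_ge0 t0 (ltW T0)).
  rewrite -(subrK ((Num.truncn (t / T))%:R * T) t) pern; apply: KP => /=.
  rewrite in_itv/= subr_ge0 -ler_pdivlMr// h1/= lerBlDr.
  move: h2; rewrite ltr_pdivrMr// -natr1 mulrDl mul1r addrC; exact: ltW.
have t0' : 0 <= - t / T by rewrite divr_ge0// ?ltW// oppr_gt0.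
have /andP[h1 h2] := truncn_itv t0'.
rewrite -(pern (Num.truncn (- t / T)).+1 t); apply: KP => /=; rewrite in_itv/=.
move: h1 h2; rewrite ler_pdivlMr// ltr_pdivrMr// -natr1 mulrDl mul1r => h1 h2.
by apply/andP; split; lra.
Qed.

End Periodic.

(** The common ground of the proton and its image trajectory. By [sp_near] every time has a
    punctured neighbourhood of regular times; the last three fields together yield a uniform bound
    on the speed. *)
Record smooth_pieces {R : realType} (T : R) (x : R -> 'rV[R]_3) : Prop := {
  sp_period : 0 < T;
  sp_periodic : Defs.periodic T x;
  sp_continuous : continuous x;
  sp_countable : countable [set t | ~ D2_at x t];
  sp_near : forall t, \forall s \near t^', D2_at x s;
  sp_lvel : forall t, cvg (derive1 x s @[s --> t^'-]);
  sp_rvel : forall t, cvg (derive1 x s @[s --> t^'+]);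
  sp_lacc : forall t, cvg (derive1 (derive1 x) s @[s --> t^'-]);
  sp_racc : forall t, cvg (derive1 (derive1 x) s @[s --> t^'+]);
  sp_vel_lt1 : forall t, derivable x t 1 -> enorm (derive1 x t) < 1;
  sp_lvel_lt1 : forall t, enorm (lvel x t) < 1;
  sp_rvel_lt1 : forall t, enorm (rvel x t) < 1 }.

Section OneSidedDerivative.
Context {R : realType} (x : R -> 'rV[R]_3).
Hypothesis cx : continuous x.
Hypothesis nx : forall t, \forall s \near t^', D2_at x s.
Hypothesis lx : forall t, cvg (derive1 x s @[s --> t^'-]).
Hypothesis rx : forall t, cvg (derive1 x s @[s --> t^'+]).

Lemma D2_derivable s : D2_at x s -> derivable x s 1 /\ derivable (derive1 x) s 1.
Proof. exact: nbhs_singleton. Qed.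

Lemma D2_rvel s : D2_at x s -> rvel x s = derive1 x s.
Proof.
move=> /D2_derivable[_ /derivable1_continuous c]; rewrite /rvel.
by apply: cvg_lim; [exact: norm_hausdorff|exact: cvg_at_right_filter].
Qed.

Lemma lvelP t : derive1 x s @[s --> t^'-] --> lvel x t.
Proof. exact: lx. Qed.

Lemma rvelP t : derive1 x s @[s --> t^'+] --> rvel x t.
Proof. exact: rx. Qed.

Lemma coord_within f (a b : R) i : continuous f ->
  {within `[a, b], continuous (fun s => (f : R -> 'rV[R]_3) s 0 i)}.
Proof.
move=> cf; apply: continuous_subspaceT => s.
exact: (coord_cvg _ _ i (cf s)).
Qed.

Lemma right_difference t e : 0 < e -> exists2 d, 0 < d & forall s, t < s -> s < t + d ->
  enorm (x s - x t - (s - t) *: rvel x t) <= e * (s - t).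
Proof.
move=> e0; have [_ n1] := near_dnbhs_sides _ _ (nx t).
have [d d0 dP] := at_right_delta _ _ (filterI n1 (enorm_near _ _ _ (rvelP t) e0)).
exists d => // s ts sd; apply: vector_mvt; first exact: ltW.
- by move=> r /andP[tr rs]; have [/D2_derivable[]] := dP r tr (lt_trans rs sd).
- by move=> r /andP[tr rs]; have [] := dP r tr (lt_trans rs sd).
- by move=> i; exact: coord_within.
Qed.

Lemma left_difference t e : 0 < e -> exists2 d, 0 < d & forall s, s < t -> t - d < s ->
  enorm (x t - x s - (t - s) *: lvel x t) <= e * (t - s).
Proof.
move=> e0; have [n1 _] := near_dnbhs_sides _ _ (nx t).
have [d d0 dP] := at_left_delta _ _ (filterI n1 (enorm_near _ _ _ (lvelP t) e0)).
exists d => // s ts sd; apply: vector_mvt; first exact: ltW.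
- by move=> r /andP[sr rt]; have [/D2_derivable[]] := dP r rt (lt_trans sd sr).
- by move=> r /andP[sr rt]; have [] := dP r rt (lt_trans sd sr).
- by move=> i; exact: coord_within.
Qed.

(** The mean value inequality on each side of [t] identifies the limit of the difference quotients
    with the common one-sided velocity. For the image trajectory, this brings every non-breaking
    time under the sub-luminal hypothesis. *)
Lemma not_breaking_derivable t : lvel x t = rvel x t ->
  derivable x t 1 /\ derive1 x t = rvel x t.
Proof.
move=> lr.
have H : (fun h : R => h^-1 *: ((x \o shift t) (h *: 1) - x t)) @ (0 : R)^' --> rvel x t.
  apply: rv3_cvg => e e0.
  have [d1 d10 P1] := right_difference t e e0; have [d2 d20 P2] := left_difference t e e0.
  have : \forall h \near (0 : R)^', `|h| < Num.min d1 d2.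
    by apply: dnbhs0_lt; rewrite lt_min d10.
  have := nbhs_dnbhs_neq (0 : R).
  apply: filterS2 => h h0; rewrite lt_min => /andP[h1 h2].
  rewrite /= [h *: 1]mulr1.
  have -> : h^-1 *: (x (h + t) - x t) - rvel x t = h^-1 *: (x (h + t) - x t - h *: rvel x t).
    by rewrite [RHS]scalerBr scalerA mulVf// scale1r.
  rewrite enormZ normfV mulrC ler_pdivrMr ?normr_gt0//.
  have [hp|hn|/eqP] := ltgtP h 0; last by rewrite (negbTE h0).
    have := P2 (h + t); rewrite lr => H; have {}H := H ltac:(lra) ltac:(by move: h2; rewrite ltr0_norm//; lra).
    rewrite -enormN (_ : - _ = x t - x (h + t) - (t - (h + t)) *: rvel x t).
      by rewrite ltr0_norm//; move: H; rewrite (_ : t - (h + t) = - h)//; ring.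
    by apply/rowP => i; rewrite !mxE; ring.
  have := P1 (h + t) ltac:(lra) ltac:(by move: h1; rewrite gtr0_norm//; lra).
  by rewrite addrK gtr0_norm.
split; first by apply/cvg_ex; eexists; exact: H.
by rewrite derive1E; apply: cvg_lim H; exact: norm_hausdorff.
Qed.

Lemma rvel_quotient_cvg t i :
  n.+1%:R * (x (t + n.+1%:R^-1) 0 i - x t 0 i) @[n --> \oo] --> rvel x t 0 i.
Proof.
apply/cvgrPdist_le => e e0; have [d d0 dP] := right_difference t e e0.
have : \forall n \near \oo, (n.+1%:R^-1 : R) < d.
  exact: near_infty_natSinv_lt (PosNum d0).
apply: filterS => n nd.
have n0 : 0 < n.+1%:R^-1 :> R by rewrite invr_gt0.
have := dP (t + n.+1%:R^-1); rewrite ltrDl ltrD2l => /(_ n0 nd).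
rewrite [t + _ - t]addrAC subrr add0r => /(le_trans (ler_coord_enorm _ i)).
rewrite !mxE => h.
have N0 : 0 < n.+1%:R :> R by [].
rewrite (_ : _ - _ = - (n.+1%:R * (x (t + n.+1%:R^-1) 0 i - x t 0 i -
  n.+1%:R^-1 * rvel x t 0 i))); last by field; rewrite lt0r_neq0.
by rewrite normrN normrM gtr0_norm// -ler_pdivlMl// [leRHS]mulrC.
Qed.

(** The right velocity is a pointwise limit of forward difference quotients, each continuous in
    time. *)
Lemma rvel_measurable i : measurable_fun [set: R] (fun s => rvel x s 0 i).
Proof.
apply: (@measurable_fun_cvg _ (measurableTypeR R) R setT
   (fun n t => n.+1%:R * (x (t + n.+1%:R^-1) 0 i - x t 0 i))) => [n|t _]; last first.
  exact: rvel_quotient_cvg.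
have cxi : continuous (fun s => x s 0 i).
  by move=> s; exact: (coord_cvg _ _ i (cx s)).
apply: measurable_funM => //; apply: measurable_funB; apply: continuous_measurable_fun => //.
move=> s; have ct : (fun t : R => t + n.+1%:R^-1) @ s --> s + n.+1%:R^-1.
  by apply: (@cvgD _ _ _ (nbhs s) _ id (cst _)); [exact: cvg_id|exact: cvg_cst].
exact: (cvg_comp _ _ ct (cxi _)).
Qed.

Lemma D2_regular s : D2_at x s -> regular_at x (rvel x) s.
Proof.
move=> d2 i; have [d1 dd1] := D2_derivable _ d2; split.
  by rewrite D2_rvel//; exact: coord_is_derive.
have [dc _] := coord_is_derive _ _ i dd1.
apply: near_eq_derivable dc => //.
have : \forall r \near s, D2_at x r by apply: near_join.
by apply: filterS => r /D2_rvel ->.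
Qed.

End OneSidedDerivative.

Section SmoothPieces.
Context {R : realType} (T : R) (x : R -> 'rV[R]_3).
Hypothesis sx : smooth_pieces T x.

Lemma enorm_lim_le {F : set_system R} {FF : ProperFilter F} (g : R -> 'rV[R]_3)
    (l c : 'rV[R]_3) (K : R) :
  g @ F --> l -> (\forall s \near F, enorm (g s - c) <= K) -> enorm (l - c) <= K.
Proof.
move=> gl gK; have h : (fun s => enorm (g s - c)) @ F --> enorm (l - c).
  exact: (@cvg_comp _ _ _ g (fun y : 'rV[R]_3 => enorm (y - c)) F (nbhs l) _ gl
    (enorm_sub_continuous c l)).
by apply: (cvgr_to_le h); exact: gK.
Qed.

Lemma near_bound {F : set_system R} {FF : Filter F} (g : R -> 'rV[R]_3) (l : 'rV[R]_3)
    (e : R) (P : R -> Prop) : g @ F --> l -> 0 < e ->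
  (forall s, enorm (g s - l) <= e -> P s) -> \forall s \near F, P s.
Proof. by move=> gl e0 gP; exact: filterS gP (enorm_near _ _ _ gl e0). Qed.

Lemma max3_ge (a b c : R) : let m := Num.max a (Num.max b c) in
  [/\ a <= m, b <= m & c <= m].
Proof. by split; rewrite !le_max lexx ?orbT. Qed.

Lemma enorm_le_near (v l : 'rV[R]_3) (c e : R) :
  enorm l <= c -> enorm (v - l) <= e -> enorm v <= c + e.
Proof. by move=> lc ve; have := ler_enormD (v - l) l; rewrite subrK; lra. Qed.

(** Near [t] the speed is close to one of three numbers below 1: the speed at [t], if it exists, and
    the two one-sided ones. Half of the gap between their maximum and 1 is kept as margin, and
    compactness makes the bound uniform. *)
Lemma smooth_pieces_speed : exists k : R,
  [/\ 0 <= k, k < 1 & forall t, derivable x t 1 -> enorm (derive1 x t) <= k].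
Proof.
have [pd pD] := periodic_derive1 T x (sp_periodic _ _ sx).
have H : \forall K \near (1 : R)^'-, forall t, derivable x t 1 -> enorm (derive1 x t) <= K.
  apply: (periodic_covering T (sp_period _ _ sx) (1 : R)^'- _
    (fun K t => derivable x t 1 -> enorm (derive1 x t) <= K)).
    by move=> K t; rewrite pD pd.
  move=> t.
  have [c [c1 cd cl cr]] : exists c, [/\ c < 1,
      derivable x t 1 -> enorm (derive1 x t) <= c, enorm (lvel x t) <= c &
      enorm (rvel x t) <= c].
    exists (Num.max (if `[< derivable x t 1 >] then enorm (derive1 x t) else 0)
      (Num.max (enorm (lvel x t)) (enorm (rvel x t)))); split.
    - rewrite !gt_max (sp_lvel_lt1 _ _ sx) (sp_rvel_lt1 _ _ sx) !andbT.
      by case: asboolP => // /(sp_vel_lt1 _ _ sx).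
    - by move=> dt; rewrite le_max; case: asboolP => // _; rewrite lexx.
    - by rewrite !le_max lexx !orbT.
    - by rewrite !le_max lexx !orbT.
  have c0 : 0 <= c by exact: le_trans (enorm_ge0 _) cl.
  have e0 : 0 < (1 - c) / 2 by rewrite divr_gt0 ?subr_gt0.
  exists (fun s => derivable x s 1 -> enorm (derive1 x s) <= c + (1 - c) / 2); split.
    apply: near_sides.
    - by move=> /cd h; rewrite (le_trans h)// lerDl ltW.
    - apply: (near_bound _ _ _ _ (lvelP _ (sp_lvel _ _ sx) t) e0) => s hs _.
      exact: (enorm_le_near _ _ _ _ cl hs).
    - apply: (near_bound _ _ _ _ (rvelP _ (sp_rvel _ _ sx) t) e0) => s hs _.
      exact: (enorm_le_near _ _ _ _ cr hs).
  apply: (near_left _ _ _ e0) => K K1 Kc s h dx.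
  have Kc' : c + (1 - c) / 2 <= K by clear - Kc; lra.
  exact: le_trans (h dx) Kc'.
have [d d0 dP] := at_left_delta _ _ H.
(* [1 - d / 2] is a bound from the left neighbourhood of 1 just found; the maximum with 0 provides
   [0 <= k]. *)
pose k := Num.max (1 - d / 2) 0; exists k; split.
- by rewrite le_max lexx orbT.
- by rewrite gt_max ltr01 andbT; lra.
- by move=> t dt; rewrite le_max (dP (1 - d / 2))//; lra.
Qed.

(** The covering argument for speeds, with three finite numbers at each [t]: the norms of the second
    derivative there, possibly a default value, and of its one-sided limits. *)
Lemma smooth_pieces_acceleration : exists2 L : R,
  0 <= L & forall t, D2_at x t -> enorm (derive1 (derive1 x) t) <= L.
Proof.
have [pd pD] := periodic_derive1 T x (sp_periodic _ _ sx).
have [pdd pDD] := periodic_derive1 T _ pd.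
have H : \forall K \near +oo, forall t, enorm (derive1 (derive1 x) t) <= K.
  apply: (periodic_covering T (sp_period _ _ sx) +oo _
    (fun K t => enorm (derive1 (derive1 x) t) <= K)).
    by move=> K t; rewrite pdd.
  move=> t.
  set l := lim (derive1 (derive1 x) s @[s --> t^'-]).
  set r := lim (derive1 (derive1 x) s @[s --> t^'+]).
  have [c [cd cl cr]] : exists c, [/\ enorm (derive1 (derive1 x) t) <= c,
      enorm l <= c & enorm r <= c].
    by eexists; exact: max3_ge.
  exists (fun s => enorm (derive1 (derive1 x) s) <= c + 1); split.
    apply: near_sides.
    - by apply: (le_trans cd); rewrite lerDl.
    - apply: (near_bound _ l _ _ (sp_lacc _ _ sx t) ltr01) => s hs.
      exact: (enorm_le_near _ _ _ _ cl hs).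
    - apply: (near_bound _ r _ _ (sp_racc _ _ sx t) ltr01) => s hs.
      exact: (enorm_le_near _ _ _ _ cr hs).
  exists (c + 1); split; first exact: num_real.
  by move=> K cK s /le_trans; apply; exact: ltW.
have [K [_ KP]] := H.
exists (Num.max 0 (K + 1)); first by rewrite le_max lexx.
by move=> t _; rewrite le_max (KP (K + 1)) ?orbT// ltrDl.
Qed.

(** On each side of any time the nearby times are regular, so the mean value inequality holds
    locally, and [local_lipschitz_global] carries it across the exceptional times. *)
Lemma smooth_pieces_lipschitz k :
  (forall t, derivable x t 1 -> enorm (derive1 x t) <= k) -> lipschitz3 k x.
Proof.
move=> kx.
have k0 : 0 <= k.
  have [_ n1] := near_dnbhs_sides _ _ (sp_near _ _ sx 0).
  have [d d0 dP] := at_right_delta _ _ n1.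
  have [dx _] := D2_derivable _ _ (dP (d / 2) ltac:(lra) ltac:(lra)).
  exact: le_trans (enorm_ge0 _) (kx _ dx).
have main a b : a <= b -> enorm (x b - x a) <= k * (b - a).
  move=> ab; apply: local_lipschitz_global => // t _.
  have [n1 n2] := near_dnbhs_sides _ _ (sp_near _ _ sx t).
  have [d1 d10 P1] := at_left_delta _ _ n1; have [d2 d20 P2] := at_right_delta _ _ n2.
  have sub a' b' : a' <= b' -> (forall s, a' < s < b' -> D2_at x s) ->
      enorm (x b' - x a') <= k * (b' - a').
    move=> ab' D2; have h : enorm (x b' - x a' - (b' - a') *: 0) <= k * (b' - a').
      apply: vector_mvt => //.
      - by move=> s /D2 /D2_derivable[].
      - by move=> s /D2 /D2_derivable[ds _]; rewrite subr0; exact: kx.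
      - by move=> i; apply: coord_within; exact: (sp_continuous _ _ sx).
    by rewrite scaler0 subr0 in h.
  exists (Num.min d1 d2) => [|s _]; first by rewrite lt_min d10.
  rewrite lt_min => /andP[s1 s2].
  have [st|ts] := leP s t.
    rewrite enormBC distrC ger0_norm ?subr_ge0//; apply: sub => // r /andP[sr rt].
    apply: P1 => //; move: s1; rewrite distrC ger0_norm ?subr_ge0//; lra.
  rewrite gtr0_norm ?subr_gt0//; apply: sub => //; first exact: ltW.
  move=> r /andP[tr rs]; apply: P2 => //; move: s2.
  by rewrite gtr0_norm ?subr_gt0//; lra.
move=> s s'; have [h|h] := leP s' s.
  by rewrite ger0_norm ?subr_ge0//; exact: main.
by rewrite enormBC distrC gtr0_norm ?subr_gt0//; apply: main; exact: ltW.
Qed.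

Lemma smooth_pieces_rvel_le k :
  (forall t, derivable x t 1 -> enorm (derive1 x t) <= k) -> forall t, enorm (rvel x t) <= k.
Proof.
move=> kx t; rewrite -[rvel x t]subr0.
have [_ n1] := near_dnbhs_sides _ _ (sp_near _ _ sx t).
apply: enorm_lim_le (rvelP _ (sp_rvel _ _ sx) t) _.
by apply: filterS n1 => s /D2_derivable[ds _]; rewrite subr0; exact: kx.
Qed.

(* The one-sided velocities are the limits of the velocities at nearby
   regular times, which differ by at most [L |s' - s|]. *)
Lemma smooth_pieces_local L : 0 <= L ->
  (forall t, D2_at x t -> enorm (derive1 (derive1 x) t) <= L) ->
  forall t, exists2 d, 0 < d & forall s,
    (t < s -> s < t + d -> enorm (rvel x s - rvel x t) <= L * (s - t)) /\
    (s < t -> t - d < s -> enorm (rvel x s - lvel x t) <= L * (t - s)).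
Proof.
move=> L0 Lx t.
have [n1 n2] := near_dnbhs_sides _ _ (sp_near _ _ sx t).
have [d1 d10 P1] := at_left_delta _ _ n1; have [d2 d20 P2] := at_right_delta _ _ n2.
have sub a' b' : a' <= b' -> (forall s, a' <= s <= b' -> D2_at x s) ->
    enorm (derive1 x b' - derive1 x a') <= L * (b' - a').
  move=> ab' D2; have h : enorm (derive1 x b' - derive1 x a' - (b' - a') *: 0) <= L * (b' - a').
    apply: vector_mvt => //.
    - by move=> s /andP[h1 h2]; have [] // := D2_derivable _ _ (D2 s ltac:(lra)).
    - by move=> s /andP[h1 h2]; rewrite subr0; apply/Lx/D2; lra.
    - move=> i; apply: continuous_in_subspaceT => s; rewrite inE/= in_itv/= => /D2.
      by move=> /D2_derivable[_ /derivable1_continuous c]; exact: (coord_cvg _ _ i c).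
  by rewrite scaler0 subr0 in h.
exists (Num.min d1 d2); first by rewrite lt_min d10.
have [m1 m2] : Num.min d1 d2 <= d1 /\ Num.min d1 d2 <= d2 by rewrite !ge_min !lexx orbT.
move=> s; split => h1 h2.
  rewrite (D2_rvel _ s); last by apply: P2 => //; lra.
  rewrite enormBC; apply: enorm_lim_le (rvelP _ (sp_rvel _ _ sx) t) _.
  have st : 0 < s - t by lra.
  apply: (near_right _ _ (s - t)) => // r tr rs.
  rewrite enormBC (le_trans (sub r s _ _))//; first by lra.
    by move=> q /andP[rq qs]; apply: P2; lra.
  by rewrite ler_wpM2l//; lra.
rewrite (D2_rvel _ s); last by apply: P1 => //; lra.
rewrite enormBC; apply: enorm_lim_le (lvelP _ (sp_lvel _ _ sx) t) _.
have st : 0 < t - s by lra.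
apply: (near_left _ _ (t - s)) => // r tr rs.
rewrite (le_trans (sub s r _ _))//; first by lra.
  by move=> q /andP[rq qs]; apply: P1; lra.
by rewrite ler_wpM2l//; lra.
Qed.

End SmoothPieces.

Section VelocityJumps.
Context {R : realType} (T S : R) (x y : R -> 'rV[R]_3) (tau L M : R).
Hypothesis sx : smooth_pieces T x.
Hypothesis sy : smooth_pieces S y.
Hypothesis L0 : 0 <= L.
Hypothesis M0 : 0 <= M.
Hypothesis Lx : forall t, D2_at x t -> enorm (derive1 (derive1 x) t) <= L.
Hypothesis My : forall t, D2_at y t -> enorm (derive1 (derive1 y) t) <= M.

Lemma rvel_lipschitz a b : a <= b ->
  (forall s, a <= s <= b -> ~ breaking x s) ->
  enorm (rvel x b - rvel x a) <= L * (b - a).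
Proof.
move=> ab nb; apply: local_lipschitz_global => // t tab.
have [d d0 dP] := smooth_pieces_local _ _ sx _ L0 Lx t.
exists d => // s _; have lr : lvel x t = rvel x t by exact: contrapT (nb t tab).
have [s1|s1|->] := ltgtP s t; last by rewrite !subrr enorm0 normr0 mulr0.
- rewrite ler0_norm ?subr_le0 ?(ltW s1)// opprB => std.
  by rewrite -lr; apply: (dP s).2 => //; rewrite ltrBlDr addrC -ltrBlDr.
- rewrite gtr0_norm ?subr_gt0// => std.
  by apply: (dP s).1 => //; rewrite addrC -ltrBlDr.
Qed.

Lemma enorm_sub_sub (a b c d : 'rV[R]_3) (h k : R) :
  enorm (a - b) <= h -> enorm (c - d) <= k -> enorm (a - c - (b - d)) <= h + k.
Proof.
move=> h1 h2; have -> : a - c - (b - d) = a - b - (c - d).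
  by apply/rowP => i; rewrite !mxE; ring.
by apply: le_trans (ler_enormB _ _) _; rewrite lerD.
Qed.

(** Equal jumps cancel: the difference of velocities tends to its own value from the left as well as
    from the right, so the local estimates chain through the breaking times. *)
Lemma jump_difference_lipschitz :
  (forall t, lvel y (t + tau) - lvel x t = rvel y (t + tau) - rvel x t) ->
  lipschitz3 (M + L) (fun t => rvel y (t + tau) - rvel x t).
Proof.
move=> jump; have main a b : a <= b ->
    enorm ((rvel y (b + tau) - rvel x b) - (rvel y (a + tau) - rvel x a)) <= (M + L) * (b - a).
  move=> ab; apply: (local_lipschitz_global (fun t => rvel y (t + tau) - rvel x t)) => //.
    exact: addr_ge0.
  move=> t _; have [d d0 dP] := smooth_pieces_local _ _ sx _ L0 Lx t.
  have [e e0 eP] := smooth_pieces_local _ _ sy _ M0 My (t + tau).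
  exists (Num.min d e) => [|s _]; first by rewrite lt_min d0.
  rewrite lt_min => /andP[].
  have [s1|s1|->] := ltgtP s t; last by rewrite !subrr enorm0 normr0 mulr0.
  (* To the left of [t], [jump] replaces the right velocities at [t] by the left ones, to which the
     nearby velocities are close. *)
  - rewrite ler0_norm ?subr_le0 ?(ltW s1)// opprB -(jump t) mulrDl => sd se.
    apply: enorm_sub_sub.
      rewrite (_ : t - s = t + tau - (s + tau)); last by ring.
      apply: (eP (s + tau)).2; first by rewrite ltrD2r.
      by rewrite ltrBlDr -ltrBlDl; lra.
    by apply: (dP s).2 => //; lra.
  - rewrite gtr0_norm ?subr_gt0// mulrDl => sd se.
    apply: enorm_sub_sub.
      rewrite (_ : s - t = s + tau - (t + tau)); last by ring.
      by apply: (eP (s + tau)).1; [rewrite ltrD2r|lra].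
    by apply: (dP s).1 => //; lra.
move=> s s'; have [h|h] := leP s' s.
  by rewrite ger0_norm ?subr_ge0//; exact: main.
by rewrite enormBC distrC gtr0_norm ?subr_gt0//; apply: main; exact: ltW.
Qed.

End VelocityJumps.

Section Instances.
Context {R : realType}.
Implicit Types (x G : R -> 'rV[R]_3).

Lemma C2_at_D2_at x t : C2_at x t -> D2_at x t.
Proof. by apply: filterS => s []. Qed.

Lemma piecewise_C2_countable x : piecewise_C2 x -> countable [set t | ~ C2_at x t].
Proof.
move=> [fin _].
suff -> : [set t | ~ C2_at x t] =
    \bigcup_(n : nat) ([set t | ~ C2_at x t] `&` `[- n%:R, n%:R]%classic).
  by apply: bigcup_countable => // n _; exact: finite_set_countable.
apply/seteqP; split => [t ct|t [n _ []//]].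
exists (Num.truncn `|t|).+1 => //; split => //=.
have := truncn_itv (normr_ge0 t) => /andP[_ /ltW]; rewrite ler_norml.
by rewrite in_itv.
Qed.

Lemma piecewise_C2_near x t : piecewise_C2 x -> \forall s \near t^', C2_at x s.
Proof.
move=> [fin _]; have := finite_near_dnbhs _ t (fin (t - 1) (t + 1)).
rewrite !near_withinE => h.
have : \forall s \near t, `|t - s| < 1.
  by apply/nbhs_ballP; exists 1 => //= s; rewrite -ball_normE.
move: h; apply: filterS2 => s h ts st; apply: contrapT => ns; apply: (h st).
split => //=; rewrite in_itv/=; move: ts; rewrite ltr_norml => /andP[]; lra.
Qed.

Lemma piecewise_C2_smooth_pieces (T : R) x : 0 < T -> Defs.periodic T x ->
  continuous x -> piecewise_C2 x -> velocities_lt1 x -> smooth_pieces T x.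
Proof.
move=> T0 px cx wx vx; have [_ lim4] := wx; split => //.
- apply: sub_countable (piecewise_C2_countable _ wx); apply: subset_card_le => t /= nd c2.
  exact/nd/C2_at_D2_at.
- by move=> t; apply: filterS (piecewise_C2_near _ t wx) => s; exact: C2_at_D2_at.
- by move=> t; have [l1 l2 l3 l4] := lim4 t; exact: l1.
- by move=> t; have [l1 l2 l3 l4] := lim4 t; exact: l2.
- by move=> t; have [l1 l2 l3 l4] := lim4 t; exact: l3.
- by move=> t; have [l1 l2 l3 l4] := lim4 t; exact: l4.
- by move=> t; have [v1 v2 v3] := vx t; exact: v1.
- by move=> t; have [v1 v2 v3] := vx t; exact: v2.
- by move=> t; have [v1 v2 v3] := vx t; exact: v3.
Qed.

Section Image.
Variables (mu : R) (G x : R -> 'rV[R]_3).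
Let X := image_trajectory mu G x.

Lemma derivable_image t : derivable G t 1 -> derivable x t 1 ->
  derivable X t 1 /\ derive1 X t = - derive1 G t + mu *: derive1 x t.
Proof.
move=> dG dx.
have := is_deriveD (is_deriveN (DeriveDef dG erefl)) (is_deriveZ mu (DeriveDef dx erefl)).
by move=> [d e]; rewrite !derive1E; split.
Qed.

Hypothesis CG : forall t, C2_at G t.
Hypothesis wx : piecewise_C2 x.

Lemma image_second t : derivable (derive1 G) t 1 -> derivable (derive1 x) t 1 ->
  (\forall s \near t, derivable G s 1 /\ derivable x s 1) ->
  derivable (derive1 X) t 1 /\
  derive1 (derive1 X) t = - derive1 (derive1 G) t + mu *: derive1 (derive1 x) t.
Proof.
move=> dG dx n.
have n' : \forall s \near t, - derive1 G s + mu *: derive1 x s = derive1 X s.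
  by apply: filterS n => s [dGs dxs]; rewrite (derivable_image s dGs dxs).2.
have [d e] := is_deriveD (is_deriveN (DeriveDef dG erefl)) (is_deriveZ mu (DeriveDef dx erefl)).
split; first exact: near_eq_derivable n' d.
by rewrite !derive1E -e; apply: near_eq_derive; apply: filterS n' => s es; exact: esym es.
Qed.

Lemma image_C2 t : C2_at x t -> \forall s \near t, [/\ derivable X s 1,
  derive1 X s = - derive1 G s + mu *: derive1 x s, derivable (derive1 X) s 1 &
  derive1 (derive1 X) s = - derive1 (derive1 G) s + mu *: derive1 (derive1 x) s].
Proof.
move=> cx.
have n : \forall s \near t, C2_at G s /\ C2_at x s.
  by apply: filterI; [exact: near_join (CG t)|exact: near_join cx].
apply: filterS n => s [cGs cxs].
have [dG ddG _] := nbhs_singleton cGs; have [dx ddx _] := nbhs_singleton cxs.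
have [d e] := derivable_image s dG dx.
have [dd ee] : derivable (derive1 X) s 1 /\
    derive1 (derive1 X) s = - derive1 (derive1 G) s + mu *: derive1 (derive1 x) s.
  by apply: image_second => //; apply: filterS2 cGs cxs => r [? _ _] [].
by split.
Qed.

Lemma image_cvg (F : set_system R) (FF : ProperFilter F) (f g h : R -> 'rV[R]_3) :
  (\forall s \near F, f s = - g s + mu *: h s) -> cvg (g @ F) -> cvg (h @ F) -> cvg (f @ F).
Proof.
move=> fgh cg ch; have c : (fun s => - g s + mu *: h s) @ F --> - lim (g @ F) + mu *: lim (h @ F).
  exact: (cvgD (cvgN cg) (cvgZ (cvg_cst mu) ch)).
have e : \forall s \near F, (fun s => - g s + mu *: h s) s = f s by apply: filterS fgh.
have fl : f @ F --> - lim (g @ F) + mu *: lim (h @ F) by exact: (cvg_trans (near_eq_cvg e) c).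
by apply/cvg_ex; eexists; exact: fl.
Qed.

(** At a breaking time the velocity does not exist and limits of speeds below 1 are only known to be
    at most 1, so the strict bound is an assumption there. At any other time the trajectory is
    derivable and both limits are its velocity. *)
Lemma image_smooth_pieces (T : R) : 0 < T -> Defs.periodic T X -> continuous x ->
  sub_luminal X ->
  (forall t, breaking X t -> enorm (lvel X t) < 1 /\ enorm (rvel X t) < 1) ->
  smooth_pieces T X.
Proof.
move=> T0 pX cx [_ sX] bX.
have cX : continuous X.
  have cG : continuous G.
    by move=> s; have [dG _ _] := nbhs_singleton (CG s); exact: (derivable1_continuous _ _ dG).
  by move=> s; exact: (cvgD (cvgN (cG s)) (cvgZ (cvg_cst mu) (cx s))).
have nX t : \forall s \near t^', D2_at X s.
  apply: filterS (piecewise_C2_near _ t wx) => s /image_C2.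
  by apply: filterS => r [].
have [nl nr] : (forall t, \forall s \near t^'-, C2_at x s) /\
    (forall t, \forall s \near t^'+, C2_at x s).
  by split=> t; have [] := near_dnbhs_sides _ _ (piecewise_C2_near _ t wx).
have G1 t : {for t, continuous (derive1 G)}.
  by have [_ dG _] := nbhs_singleton (CG t); exact: (derivable1_continuous _ _ dG).
have G2 t : {for t, continuous (derive1 (derive1 G))}.
  by have [_ _ cG] := nbhs_singleton (CG t); exact: cG.
have [_ lim4] := wx.
have lX t : cvg (derive1 X s @[s --> t^'-]).
  apply: (image_cvg _ _ _ (derive1 G) (derive1 x)).
  - by apply: filterS (nl t) => s /image_C2 /nbhs_singleton[_ e _ _]; exact: e.
  - by apply/cvg_ex; eexists; exact: cvg_at_left_filter (G1 t).
  - by have [l1 l2 l3 l4] := lim4 t; exact: l1.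
have rX t : cvg (derive1 X s @[s --> t^'+]).
  apply: (image_cvg _ _ _ (derive1 G) (derive1 x)).
  - by apply: filterS (nr t) => s /image_C2 /nbhs_singleton[_ e _ _]; exact: e.
  - by apply/cvg_ex; eexists; exact: cvg_at_right_filter (G1 t).
  - by have [l1 l2 l3 l4] := lim4 t; exact: l2.
have lr1 t : enorm (lvel X t) < 1 /\ enorm (rvel X t) < 1.
  have [lr|/bX//] := pselect (lvel X t = rvel X t).
  have [d e] := not_breaking_derivable X cX nX lX rX t lr.
  by rewrite lr -e; split; exact: sX.
apply: (Build_smooth_pieces _ T X T0 pX cX _ nX lX rX _ _ sX _ _).
- apply: sub_countable (piecewise_C2_countable _ wx); apply: subset_card_le => t /= nd c2.
  by apply: nd; apply: filterS (image_C2 t c2) => s [].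
- move=> t; apply: (image_cvg _ _ _ (derive1 (derive1 G)) (derive1 (derive1 x))).
  + by apply: filterS (nl t) => s /image_C2 /nbhs_singleton[_ _ _ e]; exact: e.
  + by apply/cvg_ex; eexists; exact: cvg_at_left_filter (G2 t).
  + by have [l1 l2 l3 l4] := lim4 t; exact: l3.
- move=> t; apply: (image_cvg _ _ _ (derive1 (derive1 G)) (derive1 (derive1 x))).
  + by apply: filterS (nr t) => s /image_C2 /nbhs_singleton[_ _ _ e]; exact: e.
  + by apply/cvg_ex; eexists; exact: cvg_at_right_filter (G2 t).
  + by have [l1 l2 l3 l4] := lim4 t; exact: l4.
- by move=> t; have [l1 l2] := lr1 t; exact: l1.
- by move=> t; have [l1 l2] := lr1 t; exact: l2.
Qed.

End Image.
End Instances.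

(** * Musical orbits *)

Section Reparametrization.
Context {R : realType} (b : bool) (a : R).
Let c : R := pm b.

Lemma pm_sqr : c * c = 1. Proof. by rewrite /c /pm; case: b; ring. Qed.

Lemma norm_pm : `|c| = 1.
Proof. by rewrite /c /pm; case: b; rewrite ?normrN normr1. Qed.

Lemma enorm_pmZ (v : 'rV[R]_3) : enorm (c *: v) = enorm v.
Proof. by rewrite enormZ norm_pm mul1r. Qed.

Lemma lipschitz3_affine k (x : R -> 'rV[R]_3) :
  lipschitz3 k x -> lipschitz3 k (fun s => x (a + c * s)).
Proof.
move=> kx s s'; have := kx (a + c * s) (a + c * s').
by rewrite opprD addrACA subrr add0r -mulrBr normrM norm_pm mul1r.
Qed.

Lemma countable_affine (A : set R) : countable A -> countable [set s | A (a + c * s)].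
Proof.
move=> cA; have h : [set s | A (a + c * s)] `<=` (fun y => c * (y - a)) @` A.
  move=> s As; exists (a + c * s) => //=.
  by rewrite addrAC subrr add0r mulrA pm_sqr mul1r.
exact: sub_countable (card_le_trans (subset_card_le h) (card_image_le _ _)) cA.
Qed.

Lemma is_derive_affine (s : R) : is_derive s 1 (fun r : R => a + c * r) c.
Proof.
have := is_deriveD (is_derive_cst a s 1) (is_deriveZ c (is_derive_id s (1 : R))).
by rewrite add0r [c *: 1]mulr1.
Qed.

Lemma measurable_affine (f : R -> R) : measurable_fun [set: R] f ->
  measurable_fun [set: R] (fun s => c * f (a + c * s)).
Proof.
move=> mf; apply: measurable_funM => //.
apply: (measurableT_comp mf) => //.
by apply: measurable_funD => //; exact: measurable_funM.
Qed.

Lemma regular_at_affine (x v : R -> 'rV[R]_3) s : regular_at x v (a + c * s) ->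
  regular_at (fun s => x (a + c * s)) (fun s => c *: v (a + c * s)) s.
Proof.
move=> h i; have [d1 d2] := h i; split.
  have -> : (c *: v (a + c * s)) 0 i = v (a + c * s) 0 i * c by rewrite mxE mulrC.
  exact: (@is_derive1_comp _ _ (fun r => a + c * r) s _ _ d1 (is_derive_affine s)).
have [d _] := is_deriveZ c 
  (@is_derive1_comp _ _ (fun r => a + c * r) s _ _ (DeriveDef d2 erefl) (is_derive_affine s)).
have -> // : (fun r => (c *: v (a + c * r)) 0 i) =
    c \*: ((fun r => v r 0 i) \o (fun r => a + c * r)).
by apply/funext => r; rewrite !mxE.
Qed.

End Reparametrization.

(** The change of time [s |-> t + pm b * s] treats advanced and retarded delays together: velocities
    are multiplied by [pm b] and breaking times are pulled back. In reversed time the right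
    velocities of the original curves act as left ones. *)
Lemma smooth_pieces_delay_difference {R : realType} (T S : R) (x y : R -> 'rV[R]_3)
    (tau r M : R) :
  smooth_pieces T x -> smooth_pieces S y ->
  (forall s, breaking x s -> x s = y (s + tau)) ->
  (forall s, breaking x s -> rvel x s = rvel y (s + tau)) ->
  (forall s, lvel y (s + tau) - lvel x s = rvel y (s + tau) - rvel x s) ->
  (forall s s', enorm (x s - y s') <= M) ->
  forall b t, sobolev2 2 (eball r) (natural_function b x y tau t).
Proof.
move=> sx sy pos vel jump xyM b t.
have [kx [kx0 kx1 kxP]] := smooth_pieces_speed _ _ sx.
have [ky [ky0 ky1 kyP]] := smooth_pieces_speed _ _ sy.
have [Lx Lx0 LxP] := smooth_pieces_acceleration _ _ sx.
have [Ly Ly0 LyP] := smooth_pieces_acceleration _ _ sy.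
pose k := Num.max kx ky.
have [kxk kyk] : kx <= k /\ ky <= k by rewrite !le_max !lexx orbT.
have widen (f : R -> 'rV[R]_3) (h h' : R) : h <= h' -> lipschitz3 h f -> lipschitz3 h' f.
  by move=> hh fh s s'; apply: le_trans (fh s s') _; rewrite ler_wpM2r.
(* The velocity of [x] varies at rate at most [Lx] between breaking times and the difference of
   velocities at rate at most [Ly + Lx]; the larger constant serves for both. A time is exceptional
   as soon as one of the two curves is irregular there. *)
apply: (delay_difference_sobolev k (Ly + Lx) M r
  (fun s => x (t + pm b * s)) (fun s => y (t + tau + pm b * s))
  (fun s => pm b *: rvel x (t + pm b * s))
  (fun s => pm b *: rvel y (t + tau + pm b * s))
  [set s | breaking x (t + pm b * s)]
  ([set s | ~ D2_at x (t + pm b * s)] `|` [set s | ~ D2_at y (t + tau + pm b * s)])).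
- exact: le_trans kx0 kxk.
- by rewrite gt_max kx1.
- exact: addr_ge0.
- apply: lipschitz3_affine; apply: widen kxk _; exact: smooth_pieces_lipschitz sx _ kxP.
- apply: lipschitz3_affine; apply: widen kyk _; exact: smooth_pieces_lipschitz sy _ kyP.
- move=> s; rewrite enorm_pmZ; apply: le_trans kxk.
  exact: smooth_pieces_rvel_le sx _ kxP _.
- move=> s; rewrite enorm_pmZ; apply: le_trans kyk.
  exact: smooth_pieces_rvel_le sy _ kyP _.
- move=> s s' ss nZ; rewrite -scalerBr enorm_pmZ ler0_norm ?subr_le0// opprB.
  have h a a' : a <= a' -> (forall z, a <= z <= a' -> ~ breaking x z) ->
      enorm (rvel x a' - rvel x a) <= (Ly + Lx) * (a' - a).
    move=> aa nb; apply: le_trans (rvel_lipschitz _ _ _ sx Lx0 LxP _ _ aa nb) _.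
    by rewrite ler_wpM2r ?subr_ge0// lerDr.
  have nZ' z : breaking x z -> ~ s <= pm b * (z - t) <= s'.
    by move=> bz; apply: nZ => /=; rewrite mulrA pm_sqr mul1r subrKC.
  case: (b) nZ' => nZ'; rewrite /pm/= ?mul1r ?mulN1r.
    rewrite enormBC; apply: le_trans (h _ _ _ _) _; rewrite ?lerD2l//.
      by move=> z /andP[z1 z2] /nZ'; apply; rewrite /pm mul1r; lra.
    by rewrite opprD addrACA subrr add0r.
  apply: le_trans (h _ _ _ _) _; rewrite ?lerD2l ?lerN2//.
    by move=> z /andP[z1 z2] /nZ'; apply; rewrite /pm mulN1r; lra.
  by rewrite opprD addrACA subrr add0r opprK addrC.
- have E := jump_difference_lipschitz _ _ _ _ _ _ _ sx sy Lx0 Ly0 LxP LyP jump.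
  have {}E := lipschitz3_affine b t _ _ E.
  move=> s s'; apply: le_trans (E s s'); rewrite -[leRHS](enorm_pmZ b) scalerBr !scalerBr.
  by rewrite /= !(addrAC t tau).
- by move=> s /= /pos ->; rewrite addrAC.
- by move=> s /= /vel ->; rewrite addrAC.
- move=> i; have := measurable_affine b t _ (rvel_measurable x (sp_continuous _ _ sx)
    (sp_near _ _ sx) (sp_rvel _ _ sx) i).
  by congr (measurable_fun _ _); apply/funext => s; rewrite mxE.
- move=> i; have := measurable_affine b (t + tau) _ (rvel_measurable y (sp_continuous _ _ sy)
    (sp_near _ _ sy) (sp_rvel _ _ sy) i).
  by congr (measurable_fun _ _); apply/funext => s; rewrite mxE.
- rewrite -bigcup2E; apply: bigcup_countable => // -[|[|n]] _ /=; last exact: countable0.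
    exact: countable_affine (sp_countable _ _ sx).
  exact: countable_affine (sp_countable _ _ sy).
- move=> s nA; apply: regular_at_affine; apply: D2_regular.
  by apply: contrapT => h; apply: nA; left.
- move=> s nA; apply: regular_at_affine; apply: D2_regular.
  by apply: contrapT => h; apply: nA; right.
- by move=> s s'; exact: xyM.
Qed.

Theorem theorem2p6 (R : realType) (Mp T : R) (xe xp : R -> 'rV[R]_3)
    (mu : R) (G : R -> 'rV[R]_3) (tau r_pi : R)
    (hMp : 0 < Mp)
    (hmusical : musical_orbit Mp T xe xp mu G tau)
    (hp : range xp `<=` eball r_pi)
    (hX : range (image_trajectory mu G xe) `<=` eball r_pi) :
  forall (b : bool) (t : R),
    sobolev2 2 (eball r_pi)
      (natural_function b xp (image_trajectory mu G xe) tau t).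
Proof.
have [[orb T0 _ pp _ vp _ _] _ _ CG _ sX bij _ pos pX lv rv] := hmusical.
have [[ce _] [cp _] we wp _ _ _ _] := orb.
set X := image_trajectory mu G xe in hX sX bij pos pX lv rv *.
have [_ _ surj] := bij.
have sp := piecewise_C2_smooth_pieces T xp T0 pp cp wp vp.
have sXX : smooth_pieces T X.
  (* By surjectivity every breaking time of the image comes from one of the proton, and the
     one-sided velocities there are those of the proton, below 1. *)
  apply: (image_smooth_pieces mu G xe CG we T T0 pX ce sX) => t /surj[s bs <-].
  have [_ v2 v3] := vp s; split; [rewrite -(lv s bs); exact: v2|].
  by rewrite -(rv s bs); exact: v3.
apply: (smooth_pieces_delay_difference T T _ _ _ _ (r_pi + r_pi) sp sXX pos rv) => [s|s s'].
  (* At a breaking time of the proton both differences are 0. Elsewhere neither trajectory jumps: a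
     jump of the image at [s + tau] would come from a breaking time of the proton, which could only
     be [s]. *)
  have [bs|nbs] := pselect (breaking xp s); first by rewrite (lv s bs) (rv s bs) !subrr.
  rewrite (contrapT nbs); congr (_ - _); apply: contrapT => /surj[s' bs' /addIr ss].
  by apply: nbs; rewrite -ss.
apply: le_trans (ler_enormB _ _) _; apply: lerD; apply: ltW.
  by apply: hp; exists s.
by apply: hX; exists s'.
Qed.
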